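(* Consider the system $x_{k+1}=f(x_k,w_k)=g(x_k)+Dw_k$ on the state space $\mathbf{X}$ and suppose that conditions (A1), (A2) and (A3) given in the context hold. Let $P^k(x,\mathcal{A})=\mathbb{P}\{x_k\in\mathcal{A} : x_0=x\}$. Then there exists an invariant probability measure $\pi$ on $\mathcal{B}(\mathbf{X})$ for the Markov chain $\{x_k\}$ such that, for every $x\in\mathbf{X}$, $$\lim_{k\rightarrow\infty}\ \sup_{\mathcal{A}\in\mathcal{B}(\mathbf{X})} \bigl| P^k(x,\mathcal{A})-\pi(\mathcal{A})\bigr| = 0,$$ and, for every initial state $x_0\in\mathbf{X}$, the Law of Large Numbers $$\lim_{k\rightarrow\infty}\frac{1}{k}\sum_{j=1}^k h(x_j)= \mathbb{E}_\pi\{h(x)\}\quad\text{almost surely}$$ holds for every $h:\mathbf{X}\rightarrow\mathbb{R}$ such that $\mathbb{E}_\pi(|h(x)|)<\infty$, where $\mathbb{E}_\pi\{h(x)\}=\int \pi(dx)h(x)$.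
   Context: Setting. $x_{k+1}=f(x_k,w_k):=g(x_k)+Dw_k$, with $x_k\in\mathbf{X}\subseteq\mathbb{R}^{n_x}$, $w_k\in\mathbf{W}\subseteq\mathbb{R}^{n_w}$, $D$ a real matrix, and $g:\mathbf{X}\to\mathbf{X}$ continuous with $g(0)=0$. $\mathcal{B}(\mathbf{X})$ is the Borel $\sigma$-algebra. Under an i.i.d. disturbance, $\{x_k\}$ is a time-homogeneous Markov chain with transition probability $P(x,\mathcal{A})=\mathbb{P}\{x_{k+1}\in\mathcal{A}: x_k=x\}$; a probability measure $\pi$ is invariant if $\pi(\mathcal{A})=\int\pi(dx)P(x,\mathcal{A})$ for all $\mathcal{A}\in\mathcal{B}(\mathbf{X})$. (A1) $\{w_k\in\mathbf{W}:k\in\mathbb{N}\}$ is a zero mean, i.i.d. disturbance sequence with a non-singular (with respect to Lebesgue measure) probability distribution supported in $\mathbf{W}$, a bounded set containing the origin in its interior; and $\mathbb{P}\{\|w\|\le\lambda\}>0$ for all $\lambda>0$. (A2) There is a bounded set $\mathbf{X}_f\subseteq\mathbf{X}$ containing the origin in its interior such that for all $x\in\mathbf{X}_f$: (i) $f(x,w)\in\mathbf{X}_f$ for all $w\in\mathbf{W}$ (robust invariance); (ii) $f(x,w)=Ax+Dw$, where $A$ is Schur stable and $(A,D)$ is controllable. (A3) The system has an ISS-Lyapunov function, in the sense that $\mathbf{X}$ contains the origin in its interior and is robustly invariant ($f(x,w)\in\mathbf{X}$ for all $x\in\mathbf{X}$, $w\in\mathbf{W}$), and at least one of the following holds: (a)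 there exist a continuous $V:\mathbf{X}\to\mathbb{R}_+$, $\mathcal{K}_\infty$-functions $\alpha_1,\alpha_2,\alpha_3$ and a $\mathcal{K}$-function $\sigma$ such that $\alpha_1(\|x\|)\le V(x)\le\alpha_2(\|x\|)$ and $V(f(x,w))-V(x)\le-\alpha_3(\|x\|)+\sigma(\|w\|)$ for all $x\in\mathbf{X}$, $w\in\mathbf{W}$; (b) there exist a Lipschitz continuous $V:\mathbf{X}\to\mathbb{R}_+$ and $\mathcal{K}_\infty$-functions $\alpha_1,\alpha_2,\alpha_3$ such that $\alpha_1(\|x\|)\le V(x)\le\alpha_2(\|x\|)$ and $V(f(x,0))-V(x)\le-\alpha_3(\|x\|)$ for all $x\in\mathbf{X}$, and either $f$ is Lipschitz continuous on $\mathbf{X}\times\mathbf{W}$ or $f(x,w)=g(x)+w$ with $g$ continuous on $\mathbf{X}$. A $\mathcal{K}$-function is a continuous strictly increasing $\phi:\mathbb{R}_+\to\mathbb{R}_+$ with $\phi(0)=0$; it is a $\mathcal{K}_\infty$-function if in addition $\phi(s)\to\infty$ as $s\to\infty$. *)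

(* Defs.v *)
From HB Require Import structures.
From mathcomp Require Import all_boot all_order all_algebra finmap.
From mathcomp Require Import all_classical all_reals all_analysis.
From mathcomp.real_closed Require Import complex.

Set Implicit Arguments.
Unset Strict Implicit.
Unset Printing Implicit Defensive.

Import Order.TTheory GRing.Theory Num.Theory.
Import numFieldNormedType.Exports.

Local Open Scope classical_set_scope.
Local Open Scope ring_scope.

(* The library norm on matrices is the max norm. *)
Definition enorm (R : realType) (n : nat) (x : 'cV[R]_n) : R :=
  Num.sqrt (\sum_(i < n) x i ord0 ^+ 2).

Definition borel (T : ptopologicalType) := g_sigma_algebraType (@open T).

(* [state X0] is the subset X with the subspace topology; [measurableType]
   asks for a base point, for which 0 is taken. Its Borel sigma-algebra is
   [borel (state X0)]. *)
Definition state (R : realType) (n : nat) (X : set 'cV[R]_n) (X0 : X 0) : Type :=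
  set_type X.

Definition origin (R : realType) (n : nat) (X : set 'cV[R]_n) (X0 : X 0) :
  state X0 := exist _ 0 (mem_set X0).

Definition point_of (R : realType) (n : nat) (X : set 'cV[R]_n) (X0 : X 0)
  (x : state X0) : 'cV[R]_n := \val (x : set_type X).

HB.instance Definition _ (R : realType) (n : nat) (X : set 'cV[R]_n)
  (X0 : X 0) := Topological.copy (state X0) (set_type X).
HB.instance Definition _ (R : realType) (n : nat) (X : set 'cV[R]_n)
  (X0 : X 0) := isPointed.Build (state X0) (origin X0).

Arguments state {R n X} X0.
Arguments origin {R n X} X0.
Arguments point_of {R n X X0} x.

(* On Borel sets, this iterated integral is the n-fold product of the
   one-dimensional Lebesgue measure (n = 0: the unit mass of the only point). *)
Fixpoint lebesgueN (R : realType) (n : nat) : set 'cV[R]_n -> \bar R :=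
  match n with
  | 0 => fun A => (\1_A (0 : 'cV[R]_0))%:E
  | m.+1 => fun A => (\int[lebesgue_measure]_t
      lebesgueN [set v : 'cV[R]_m | A (col_mx (const_mx t : 'cV[R]_1) v)])%E
  end.

Definition mutually_singular (R : realType) (d : measure_display)
    (T : measurableType d) (mu nu : set T -> \bar R) : Prop :=
  exists N : set T, [/\ measurable N, mu N = 0%E & nu (~` N) = 0%E].

Definition independent_seq (R : realType) (d d' : measure_display)
    (Omega : measurableType d) (T : measurableType d') (P : probability Omega R)
    (w : nat -> {RV P >-> T}) : Prop :=
  forall (s : {fset nat}) (A : nat -> set T),
    (forall k, measurable (A k)) ->
    P (\bigcap_(k in [set` s]) (w k @^-1` A k)) =
    (\prod_(k <- s) P (w k @^-1` A k))%E.

Definition identically_distributed (R : realType) (d d' : measure_display)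
    (Omega : measurableType d) (T : measurableType d') (P : probability Omega R)
    (w : nat -> {RV P >-> T}) : Prop :=
  forall (j k : nat) (A : set T), measurable A ->
    distribution P (w j) A = distribution P (w k) A.

(* Functions R_+ -> R_+ are functions on R of which only the restriction to
   [0, +oo[ matters. *)
Definition class_K (R : realType) (phi : R -> R) : Prop :=
  [/\ {within `[0, +oo[%classic, continuous phi},
      (forall s t, 0 <= s -> s < t -> phi s < phi t) & phi 0 = 0].

Definition class_Koo (R : realType) (phi : R -> R) : Prop :=
  class_K phi /\ phi s @[s --> +oo] --> +oo.

Definition schur_stable (R : realType) (n : nat) (A : 'M[R]_n) : Prop :=
  forall z : R[i], eigenvalue (map_mx (real_complex R) A) z -> `|z| < 1.

(* Kalman rank condition: rank [D, A D, ..., A^(n-1) D] = n. *)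
Definition controllable (R : realType) (n m : nat)
    (A : 'M[R]_n) (D : 'M[R]_(n, m)) : Prop :=
  \rank (\mxrow_(i < n) (A ^+ i *m D)) = n.

Section system.
Variables (R : realType) (nx nw : nat).
Variables (X : set 'cV[R]_nx) (X0 : X 0) (W : set 'cV[R]_nw).
Variables (g : state X0 -> state X0) (D : 'M[R]_(nx, nw)).

Definition dynamics (x : state X0) (w : 'cV[R]_nw) : 'cV[R]_nx :=
  point_of (g x) + D *m w.

Definition robustly_invariant (S : set 'cV[R]_nx) : Prop :=
  forall (x : state X0) (w : 'cV[R]_nw),
    S (point_of x) -> W w -> S (dynamics x w).

Definition linear_near_origin : Prop :=
  exists (Xf : set 'cV[R]_nx) (A : 'M[R]_nx),
    [/\ bounded_set Xf, Xf `<=` X, Xf° 0 & robustly_invariant Xf] /\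
    [/\ schur_stable A, controllable A D &
        forall (x : state X0) (w : 'cV[R]_nw), Xf (point_of x) -> W w ->
          dynamics x w = A *m point_of x + D *m w].

Definition lyapunov_bounds (V : state X0 -> R) (a1 a2 : R -> R) : Prop :=
  forall x : state X0,
    [/\ 0 <= V x, a1 (enorm (point_of x)) <= V x
      & V x <= a2 (enorm (point_of x))].

(* The successor state [dynamics x w] is designated by an element y of X. *)
Definition ISS_lyapunov : Prop :=
  exists (V : state X0 -> R) (a1 a2 a3 sigma : R -> R),
    [/\ class_Koo a1, class_Koo a2, class_Koo a3 & class_K sigma] /\
    [/\ continuous V, lyapunov_bounds V a1 a2 &
        forall (x y : state X0) (w : 'cV[R]_nw), W w ->
          point_of y = dynamics x w ->
          V y - V x <= - a3 (enorm (point_of x)) + sigma (enorm w)].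

Definition lipschitz_dynamics : Prop :=
  exists L : R, forall (x y : state X0) (w v : 'cV[R]_nw), W w -> W v ->
    enorm (dynamics x w - dynamics y v) <=
    L * enorm (col_mx (point_of x - point_of y) (w - v)).

(* This forces nw = nx. *)
Definition unit_gain_disturbance : Prop :=
  exists e : nw = nx, forall (x : state X0) (w : 'cV[R]_nw), W w ->
    dynamics x w = point_of (g x) + castmx (e, erefl 1%N) w.

Definition nominal_lipschitz_lyapunov : Prop :=
  (exists (V : state X0 -> R) (a1 a2 a3 : R -> R),
    [/\ class_Koo a1, class_Koo a2 & class_Koo a3] /\
    [/\ (exists L : R, forall x y : state X0,
           `|V x - V y| <= L * enorm (point_of x - point_of y)),
        lyapunov_bounds V a1 a2 &
        forall x y : state X0, point_of y = dynamics x 0 ->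
          V y - V x <= - a3 (enorm (point_of x))]) /\
  (lipschitz_dynamics \/ unit_gain_disturbance).

Definition has_ISS_lyapunov : Prop :=
  [/\ X° 0, robustly_invariant X & ISS_lyapunov \/ nominal_lipschitz_lyapunov].

Variables (d : measure_display) (Omega : measurableType d).
Variables (P : probability Omega R) (w : nat -> {RV P >-> borel 'cV[R]_nw}).

Definition admissible_disturbance : Prop :=
  [/\ bounded_set W, W° 0 & forall k t, W (w k t)] /\
  [/\ independent_seq w,
      identically_distributed w,
      (forall k i, ('E_P[fun t => (w k t : 'cV[R]_nw) i ord0] = 0)%E),
      (forall k, ~ mutually_singular (distribution P (w k)) (@lebesgueN R nw)) &
      (forall k (lambda : R), 0 < lambda ->
         (0 < P [set t | (enorm (w k t : 'cV[R]_nw) <= lambda)%R])%E)].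

(* [insubd] injects [dynamics _ _] into X; its default value is never used
   when X is robustly invariant and the disturbance has values in W. *)
Fixpoint trajectory (x0 : state X0) (k : nat) (t : Omega) : state X0 :=
  match k with
  | 0 => x0
  | j.+1 => let x := trajectory x0 j t in
      insubd (x : set_type X) (dynamics x (w j t))
  end.

Definition transition (k : nat) (x : state X0) (A : set (state X0)) : \bar R :=
  P [set t | A (trajectory x k t)].

Definition invariant_measure (pi : probability (borel (state X0)) R) : Prop :=
  forall A : set (borel (state X0)), measurable A ->
    (pi A = \int[pi]_x transition 1 x A)%E.

End system.

Arguments trajectory {R nx nw X X0} g D {d Omega P} w x0 k t.
Arguments transition {R nx nw X X0} g D {d Omega P} w k x A.
Arguments invariant_measure {R nx nw X X0} g D {d Omega P} w pi.

(* Main.v *)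
Require Import Defs.
From HB Require Import structures.
From mathcomp Require Import all_boot all_order all_algebra finmap.
From mathcomp Require Import all_classical all_reals all_analysis.
From mathcomp Require Import measurable_realfun ring lra.

Set Implicit Arguments.
Unset Strict Implicit.
Unset Printing Implicit Defensive.

Import Order.TTheory GRing.Theory Num.Theory.
Import numFieldNormedType.Exports.

Local Open Scope classical_set_scope.
Local Open Scope ring_scope.

(** Why the theorem holds. The state at time k is a function of the initial state
    and of the noise sequence. The proof finds an absorbing set C, reached from
    everywhere, and a uniform lower bound on the overlap of the laws, at some
    fixed time, of two copies of the chain started in C.

    Far from the origin, dissipation dominates the bounded noise, so the
    sublevel set C of the Lyapunov function V at a suitable level is absorbing,
    and it is reached in a deterministic time from every state
    (absorbing_level). From C, noise that happens to be small for N steps lets V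
    decrease until the state is in a prescribed neighbourhood of the origin,
    and this has a positive probability that does not depend on the state in C
    (small_noise_contraction, sublevel_charged).

    Near the origin the system is linear and controllable: moving the initial
    state a little has the same effect on the state after nx steps as adding
    small controls to the noise (small_controls). A law that is not singular
    overlaps with each of its small translates by a fixed amount, by a theorem
    of Steinhaus (translation_overlap), and this passes to finitely many
    independent terms (translate_overlap). So the laws after nx steps from two
    states near the origin have a fixed overlap (local_overlap), and the laws
    after N + nx steps from two states of C have one too
    (absorbing_set_overlap).

    With q < 1 the fraction not shared, the difference of two laws started in C
    shrinks by q every N + nx steps, uniformly over events. So these laws form
    a Cauchy sequence in total variation; the limit is an invariant probability
    measure pi, and the laws from any state converge to it
    (uniform_ergodicity).

    For the law of large numbers, take pi as initial law. Correlations of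
    bounded functions then decay, so their block averages converge in mean
    square. Almost sure convergence follows from the maximal inequality
    (maximal_ineq) for the measure-preserving map that advances the state and
    shifts the noise, and it extends to integrable functions by truncation, where
    the maximal inequality controls the error. Convergence does not depend on
    the first states of a trajectory, and the law at a large time is close to
    pi whatever the initial state, so it holds almost surely from every initial
    state (null_everywhere). *)

(** * Integrals under two measures that nearly dominate each other *)

Lemma sube_eq_addeC (R : realDomainType) (a b c e : \bar R) :
  a \is a fin_num -> b \is a fin_num -> c \is a fin_num -> e \is a fin_num ->
  (a - b = c - e -> a + e = c + b)%E.
Proof.
move=> /fineK<- /fineK<- /fineK<- /fineK<-.
rewrite -!(EFinN, EFinD) => /(congr1 fine)/= H; apply: (congr1 EFin); lra.
Qed.

Section approximate_domination.
Local Open Scope ereal_scope.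
Context d (T : measurableType d) (R : realType).
Variables p q : {finite_measure set T -> \bar R}.

(** By the Jordan decomposition of p - q, the measure p is at most q plus the
    positive part of p - q, whose total mass is at most e. *)
Lemma le_integral_almost_dominated (e L : R) (G : T -> \bar R) :
  (0 <= L)%R ->
  (forall A, measurable A -> p A <= q A + e%:E) ->
  measurable_fun setT G -> (forall x, 0 <= G x) -> (forall x, G x <= L%:E) ->
  \int[p]_x G x <= \int[q]_x G x + (L * e)%:E.
Proof.
move=> L0 pq mG G0 GL.
pose nu : {charge set T -> \bar R} :=
  cadd (charge_of_finite_measure p) (cscale (-1) (charge_of_finite_measure q)).
have nuE A : nu A = p A - q A by rewrite /nu /= /cadd /= cscaleN1.
have [P [N PN]] := Hahn_decomposition nu.
have key A : measurable A ->
    measure_add p (jordan_neg PN) A = measure_add q (jordan_pos PN) A.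
  move=> mA; rewrite !measure_addE.
  have := jordan_decomp PN mA; rewrite nuE /cadd/= cscaleN1 => decE.
  by rewrite [RHS]addeC; apply: sube_eq_addeC decE; exact: fin_num_measure.
have le1 : \int[p]_x G x <= \int[measure_add p (jordan_neg PN)]_x G x.
  by rewrite ge0_integral_measure_add// leeDl// integral_ge0.
apply: (le_trans le1).
rewrite (eq_measure_integral (measure_add q (jordan_pos PN))) => [|A mA _];
  last exact: key.
rewrite ge0_integral_measure_add// leeD2l//.
have [[mP posP] _ _ _] := PN.
have posE : jordan_pos PN setT <= e%:E.
  rewrite jordan_posE cjordan_posE /crestr0 mem_set// /crestr /= setTI nuE.
  by rewrite lee_subel_addl ?fin_num_measure// pq.
apply: (@le_trans _ _ (\int[jordan_pos PN]_x (cst L%:E) x)).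
  by apply: ge0_le_integral => //= x _; rewrite lee_fin.
rewrite integral_cst//= EFinM lee_wpmul2l// lee_fin //.
Qed.

End approximate_domination.

Lemma integral_prob_cst d (T : measurableType d) (R : realType)
    (p : probability T R) (c : \bar R) : (\int[p]_x cst c x = c)%E.
Proof.
by rewrite integral_cst// -[X in (_ * X = _)%E]/(p setT) probability_setT mule1.
Qed.

Lemma abse_sub_le (R : realDomainType) (a b : \bar R) (r : R) :
  a \is a fin_num -> b \is a fin_num ->
  (a <= b + r%:E -> b <= a + r%:E -> `|a - b| <= r%:E)%E.
Proof.
move=> /fineK<- /fineK<-; rewrite -EFinB -!EFinD !lee_fin => ab ba.
by rewrite ler_distl lerBlDr ab ba.
Qed.

Lemma integral_indicT d (T : measurableType d) (R : realType)
    (m : {measure set T -> \bar R}) (A : set T) : measurable A ->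
  (\int[m]_x (\1_A x)%:E = m A)%E.
Proof. by move=> mA; rewrite integral_indic// setIT. Qed.

Section overlap_bridge.
Local Open Scope ereal_scope.
Context (R : realType) dE (E : measurableType dE).
Variables (p1 p2 : probability E R) (B : set E) (phi : E -> \bar R) (q e : R).
Hypotheses (mB : measurable B) (mphi : measurable_fun setT phi).
Hypotheses (phi01 : forall x, 0 <= phi x <= 1).
Hypotheses (q_ge0 : (0 <= q)%R) (e_gt0 : (0 < e)%R).
Hypothesis phi_osc : forall y z, B y -> B z -> phi y <= phi z + q%:E.
Hypotheses (p1B : e%:E <= p1 B) (p2B : e%:E <= p2 B).

(** Let b be the infimum of phi on B. Under p1, phi is at most 1, and at most
    b + q on B; under p2 it is at least 0, and at least b on B. As B has mass at
    least e under both laws, the two averages differ by at most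
    1 - e (1 - b - q) - e b. *)
Lemma overlap_bridge :
  \int[p1]_x phi x <= \int[p2]_x phi x + (1 - e * (1 - q))%:E.
Proof.
have [y0 By0] : B !=set0.
  apply/set0P/negP => /eqP B0; move: p1B; rewrite B0 measure0 lee_fin => h.
  by have := lt_le_trans e_gt0 h; rewrite ltxx.
have pf x : phi x \is a fin_num.
  by have /andP[h0 h1] := phi01 x; rewrite ge0_fin_numE// (le_lt_trans h1)// ltry.
pose psi x := fine (phi x); have psiE x : phi x = (psi x)%:E by rewrite fineK.
have psi0 x : (0 <= psi x)%R by rewrite -lee_fin -psiE; have /andP[] := phi01 x.
have psi1 x : (psi x <= 1)%R by rewrite -lee_fin -psiE; have /andP[] := phi01 x.
pose A := [set psi x | x in B].
have A0 : A !=set0 by exists (psi y0), y0.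
have Alb : has_lbound A by exists 0%R => _ [x _ <-].
pose b := inf A.
have b0 : (0 <= b)%R by apply: lb_le_inf => // _ [x _ <-].
have bB x : B x -> (b <= psi x)%R by move=> Bx; apply: ge_inf => //; exists x.
have Bb x : B x -> (psi x <= b + q)%R.
  move=> Bx; rewrite -lerBlDr; apply: lb_le_inf => // _ [z Bz <-].
  by rewrite lerBlDr -lee_fin EFinD -!psiE; exact: phi_osc.
have b1 : (b <= 1)%R by apply: le_trans (bB _ By0) (psi1 _).
(* b + q may exceed 1, the bound that holds everywhere. *)
pose s := Num.min 1%R (b + q)%R.
have s1 : (s <= 1)%R by rewrite ge_min lexx.
have sb : (s <= b + q)%R by rewrite ge_min lexx orbT.
have mi : measurable_fun setT (fun x => (\1_B x)%:E : \bar R).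
  by apply/measurable_EFinP; exact: measurable_indic.
have i0 x : 0 <= (\1_B x)%:E :> \bar R by rewrite lee_fin.
have phi0 x : 0 <= phi x by have /andP[] := phi01 x.
have up : \int[p1]_x phi x + ((1 - s) * e)%:E <= 1.
  apply: (@le_trans _ _ (\int[p1]_x (phi x + (1 - s)%:E * (\1_B x)%:E))).
    rewrite ge0_integralD//; last 2 first.
    - by move=> x _; rewrite mule_ge0// lee_fin subr_ge0.
    - exact: measurable_funeM.
    rewrite ge0_integralZl//; last by rewrite lee_fin subr_ge0.
    rewrite integral_indicT// leeD2l// EFinM lee_wpmul2l// lee_fin subr_ge0//.
  rewrite -[leRHS](integral_prob_cst p1); apply: ge0_le_integral => //.
  - by move=> x _; rewrite adde_ge0// mule_ge0// lee_fin subr_ge0.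
  - by apply: emeasurable_funD => //; exact: measurable_funeM.
  move=> x _; rewrite psiE -EFinM -EFinD lee_fin indicE.
  have [xB|_] := boolP (x \in B); last by rewrite mulr0 addr0.
  rewrite mulr1 -lerBrDr opprB addrCA subrr addr0 /s le_min psi1/=.
  by apply: Bb; rewrite inE in xB.
have low : (b * e)%:E <= \int[p2]_x phi x.
  apply: (@le_trans _ _ (\int[p2]_x (b%:E * (\1_B x)%:E))).
    by rewrite ge0_integralZl// integral_indicT// EFinM lee_wpmul2l// lee_fin.
  apply: ge0_le_integral => //.
  - by move=> x _; rewrite mule_ge0// lee_fin.
  - exact: measurable_funeM.
  move=> x _; rewrite psiE -EFinM lee_fin indicE.
  have [xB|_] := boolP (x \in B); last by rewrite mulr0.
  by rewrite mulr1; apply: bB; rewrite inE in xB.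
apply: (@le_trans _ _ (1 - (1 - s) * e)%:E).
  by rewrite EFinB leeBrDr.
apply: le_trans (leeD2r _ low); rewrite -EFinD lee_fin.
have : (e * s <= e * (b + q))%R by rewrite ler_wpM2l// ltW.
lra.
Qed.

End overlap_bridge.

(** * Sequences of independent, identically distributed terms *)

(** Only initial segments of coordinates are constrained; the bound n is part of
    the data so that intersections are again of this form. *)
Definition cylinder d (T : measurableType d) : set (set (nat -> T)) :=
  [set B | exists n (A : nat -> set T), (forall k, measurable (A k)) /\
    B = [set v | forall k, (k < n)%N -> A k (v k)]].

Definition seqspace d (T : measurableType d) :=
  g_sigma_algebraType (@cylinder d T).

Section sequence_space.
Context d (T : measurableType d).
Local Notation S := (seqspace T).

Definition shift (v : S) : S := fun k => v k.+1.

Definition scons (x : T * S) : S := fun k => if k is j.+1 then x.2 j else x.1.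

Lemma scons_head_shift (v : S) : scons (v 0%N, shift v) = v.
Proof. by apply/funext => -[|k]. Qed.

Lemma measurable_cylinder n (A : nat -> set T) :
  (forall k, measurable (A k)) ->
  measurable ([set v | forall k, (k < n)%N -> A k (v k)] : set S).
Proof. by move=> mA; apply: sub_sigma_algebra; exists n, A. Qed.

Lemma setI_closed_cylinder : setI_closed (@cylinder d T).
Proof.
move=> _ _ [n [A [mA ->]]] [m [B [mB ->]]].
pose tr n (C : nat -> set T) k := if (k < n)%N then C k else setT.
exists (maxn n m), (fun k => tr n A k `&` tr m B k); split.
  by move=> k; apply: measurableI; rewrite /tr; case: ifP.
apply/seteqP; split => [v [vA vB] k _|v vAB].
  by split; rewrite /tr; case: ifP => // ?; [exact: vA|exact: vB].
split=> k kn; have := vAB k; rewrite leq_max kn ?orbT => /(_ isT) [];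
  by rewrite /tr kn.
Qed.

Lemma measurable_coord k : measurable_fun [set: S] (fun v : S => v k).
Proof.
move=> _ A mA; rewrite setTI.
rewrite (_ : _ @^-1` _ = [set v : S | forall j, (j < k.+1)%N ->
    (if j == k then A else setT) (v j)]).
  apply: (@measurable_cylinder k.+1 (fun j => if j == k then A else setT)) => j.
  by case: ifP.
apply/seteqP; split => [v Av j _|v /(_ k (ltnSn k))]; last by rewrite eqxx.
by case: eqP => [->|].
Qed.

Lemma measurable_to_seqspace d' (Y : measurableType d') (h : Y -> S) :
  (forall k, measurable_fun setT (fun y => h y k)) -> measurable_fun setT h.
Proof.
move=> mh; apply: (@measurability _ _ Y S setT h (@cylinder d T)) => //.
move=> _ [_ [n [A [mA ->]]] <-]; rewrite setTI.
rewrite (_ : _ @^-1` _ =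
    \bigcap_(k in [set k | (k < n)%N]) ((fun y => h y k) @^-1` A k)); last first.
  by apply/seteqP; split.
apply: fin_bigcap_measurable => [|k _]; first exact: finite_II.
by rewrite -[X in measurable X]setTI; exact: mh.
Qed.

Lemma measurable_shift : measurable_fun [set: S] shift.
Proof. by apply: (@measurable_to_seqspace _ S) => k; exact: measurable_coord. Qed.

Lemma measurable_scons : measurable_fun [set: T * S] scons.
Proof.
apply: (@measurable_to_seqspace _ (T * S)%type) => -[|k] /=; first exact: measurable_fst.
exact: measurableT_comp (measurable_coord k) measurable_snd.
Qed.

End sequence_space.

Section iid_law.
Local Open Scope ereal_scope.
Context (R : realType) d d' (Omega : measurableType d) (T : measurableType d').
Variables (P : probability Omega R) (w : nat -> {RV P >-> T}).

Definition noise (t : Omega) : seqspace T := fun k => w k t.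

Lemma measurable_noise : measurable_fun setT noise.
Proof. by apply: measurable_to_seqspace => k; exact: measurable_funP. Qed.

Definition noise_law : probability (seqspace T) R :=
  distribution P (mfun_Sub (mem_set measurable_noise)).

Definition coord_law : probability T R := distribution P (w 0%N).

Hypothesis (indw : independent_seq w) (idw : identically_distributed w).

Lemma noise_law_cylinder n (A : nat -> set T) : (forall k, measurable (A k)) ->
  noise_law [set v | forall k, (k < n)%N -> A k (v k)] =
  \prod_(k < n) coord_law (A k).
Proof.
move=> mA; have := indw [fset k | k in iota 0 n]%fset mA.
rewrite /noise_law/= /distribution/= /pushforward.
set B1 := \bigcap_(k in _) _; set B2 := _ @^-1` _.
have -> : B1 = B2.
  apply/seteqP; split => t /= tB k kn.
    by apply: tB => /=; rewrite !inE mem_iota.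
  by apply: tB; move: kn; rewrite /= !inE mem_iota.
move=> ->; rewrite (perm_big (iota 0 n)); last first.
  apply: uniq_perm; [exact: fset_uniq|exact: iota_uniq|].
  by move=> k; rewrite !inE.
rewrite -[n in iota 0 n]subn0 -/(index_iota 0 n) big_mkord; apply: eq_bigr => k _.
exact: (idw k 0%N (mA k)).
Qed.

(** The head of the sequence is independent of its tail, and the tail has the law
    of the whole sequence. By the product rule the two sides agree on products
    of a measurable set with a cylinder, which determine a finite measure. *)
Lemma noise_law_split (F : T * seqspace T -> \bar R) :
  measurable_fun setT F -> (forall x, 0 <= F x) ->
  \int[noise_law]_v F (v 0%N, shift v) =
  \int[coord_law]_x \int[noise_law]_v F (x, v).
Proof.
move=> mF F0.
pose h (v : seqspace T) := (v 0%N, shift v).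
have mh : measurable_fun setT h.
  by apply: measurable_fun_pair; [exact: measurable_coord|exact: measurable_shift].
rewrite -[RHS](fubini_tonelli1 (m1 := coord_law) (m2 := noise_law))//.
transitivity (\int[distribution noise_law (mfun_Sub (mem_set mh))]_x F x).
  by rewrite ge0_integral_distribution.
apply/esym/eq_measure_integral => E mE _.
apply: product_measure_unique => // A B mA mB.
have mA0 : measurable ((fun v : seqspace T => v 0%N) @^-1` A).
  by rewrite -[X in measurable X]setTI; exact: measurable_coord.
(* For fixed A both sides are finite measures of B: it is enough to compare
   them on cylinders. *)
pose a := NngNum (fine_ge0 (measure_ge0 coord_law A)).
have aE : a%:num%:E = coord_law A by rewrite /= fineK// fin_num_measure.
pose m0 : {measure set (seqspace T) -> \bar R} :=
  pushforward (mrestr noise_law mA0) (@shift _ T).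
pose m1 := m0 (@measurable_shift _ T).
pose m2 : {measure set (seqspace T) -> \bar R} := mscale a noise_law.
have m1E C : m1 C = noise_law (h @^-1` (A `*` C)).
  by congr (noise_law _); apply/seteqP; split => v [].
have m2E C : m2 C = coord_law A * noise_law C by rewrite -aE.
rewrite -[RHS]m2E; transitivity (m1 B); first by rewrite m1E.
have m1T : m1 setT < +oo.
  rewrite m1E; apply: (le_lt_trans (probability_le1 _ _)); last exact: ltry.
  by rewrite -[X in measurable X]setTI; apply: mh => //; exact: measurableX.
have cylT : cylinder (T := T) setT.
  by exists 0%N, (fun=> setT); split => //; apply/seteqP; split.
apply: (@measure_unique _ _ (seqspace T) (@cylinder _ T) (fun=> setT)) => //.
- exact: setI_closed_cylinder.
- by rewrite bigcup_const.
move=> _ [n [D [mD ->]]]; rewrite m1E m2E noise_law_cylinder//.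
pose AD k := if k is j.+1 then D j else A.
have -> : coord_law A * \prod_(k < n) coord_law (D k) =
    \prod_(k < n.+1) coord_law (AD k) by rewrite big_ord_recl.
rewrite -noise_law_cylinder; last by case.
congr (noise_law _); apply/seteqP; split => v.
  by move=> [vA vD] [|k] //= /vD.
by move=> vD; split; [exact: (vD 0%N)|move=> k kn; exact: (vD k.+1)].
Qed.

End iid_law.

(** * A chain driven by independent noise, as a skew product *)

Section skew_product.
Local Open Scope ereal_scope.
Context (R : realType) dE dT (E : measurableType dE) (T : measurableType dT).
Variables (f : E * T -> E) (mu : probability T R) (Q : probability (seqspace T) R).
Hypothesis mf : measurable_fun setT f.
Hypothesis splitQ : forall F : T * seqspace T -> \bar R,
  measurable_fun setT F -> (forall x, 0 <= F x) ->
  \int[Q]_v F (v 0%N, shift v) = \int[mu]_x \int[Q]_v F (x, v).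
Local Notation S := (seqspace T).

(** The chain consumes the head of its noise sequence at each step. Adding the
    remaining noise to the state turns the chain into the iteration of one map,
    which preserves a measure as soon as the chain has a stationary law. *)
Definition skew (y : E * S) : E * S := (f (y.1, y.2 0%N), shift y.2).

Definition orbit k (y : E * S) : E := (iter k skew y).1.

Lemma iter_skew_snd k y : (iter k skew y).2 = (fun j => y.2 (k + j)%N).
Proof.
elim: k => [|k IH] /=; first exact/funext.
by rewrite /shift IH; apply/funext => j; rewrite addnS.
Qed.

Lemma orbitS k y : orbit k.+1 y = f (orbit k y, y.2 k).
Proof. by rewrite /orbit iterS {1}/skew/= iter_skew_snd addn0. Qed.

Lemma orbit_skew k y : orbit k (skew y) = orbit k.+1 y.
Proof. by rewrite /orbit iterSr. Qed.

Lemma measurable_skew : measurable_fun setT skew.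
Proof.
apply: measurable_fun_pair; last first.
  exact: measurableT_comp (@measurable_shift _ T) measurable_snd.
apply: (measurableT_comp mf); apply: measurable_fun_pair => //.
exact: measurableT_comp (@measurable_coord _ T 0%N) measurable_snd.
Qed.

Lemma measurable_iter_skew k : measurable_fun setT (iter k skew).
Proof.
elim: k => [|k IH]; first exact: measurable_id.
exact: (measurableT_comp measurable_skew IH).
Qed.

Lemma measurable_orbit k : measurable_fun setT (orbit k).
Proof. exact: (measurableT_comp measurable_fst (measurable_iter_skew k)). Qed.

Lemma measurable_orbit_from k x : measurable_fun setT (fun v : S => orbit k (x, v)).
Proof. exact: (measurableT_comp (measurable_orbit k) (pair1_measurable x)). Qed.

Definition law k x : probability E R :=
  distribution Q (mfun_Sub (mem_set (measurable_orbit_from k x))).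

Lemma lawE k x A : law k x A = Q [set v | A (orbit k (x, v))].
Proof. by []. Qed.

Lemma integral_law k x (u : E -> \bar R) :
  measurable_fun setT u -> (forall y, 0 <= u y) ->
  \int[law k x]_y u y = \int[Q]_v u (orbit k (x, v)).
Proof. by move=> mu' u0; rewrite ge0_integral_distribution. Qed.

Lemma skew_split x (H : E * S -> \bar R) :
  measurable_fun setT H -> (forall y, 0 <= H y) ->
  \int[Q]_v H (skew (x, v)) = \int[mu]_a \int[Q]_v H (f (x, a), v).
Proof.
move=> mH H0.
pose F (z : T * S) := H (f (x, z.1), z.2).
have mF : measurable_fun setT F.
  apply: (measurableT_comp mH); apply: measurable_fun_pair => //.
  by apply: (measurableT_comp mf); exact: measurable_fun_pair.
by rewrite -(splitQ mF (fun z => H0 _)).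
Qed.

Lemma measurable_integralQ (G : E * S -> \bar R) :
  measurable_fun setT G -> (forall y, 0 <= G y) ->
  measurable_fun setT (fun x => \int[Q]_v G (x, v)).
Proof. by move=> mG G0; exact: (@measurable_fun_fubini_tonelli_F _ _ _ _ _ Q). Qed.

(** The tail of the noise sequence is independent of its first k terms and has
    the same law as the sequence itself, so that the future after time k is
    that of a chain started afresh from the state at time k. *)
Lemma markov_property k x (G : E * S -> \bar R) :
  measurable_fun setT G -> (forall y, 0 <= G y) ->
  \int[Q]_v G (iter k skew (x, v)) = \int[law k x]_y \int[Q]_v G (y, v).
Proof.
move=> mG G0; have g0 y : 0 <= \int[Q]_v G (y, v) by exact: integral_ge0.
have mg := measurable_integralQ mG G0.
rewrite integral_law//; elim: k x => [|k IH] x.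
  transitivity (\int[Q]_v G (x, v) * Q setT).
    by rewrite probability_setT mule1.
  by rewrite -integral_cst.
under eq_integral do rewrite iterSr.
under [RHS]eq_integral do rewrite -orbit_skew.
rewrite (skew_split x (measurableT_comp mG (measurable_iter_skew k)) (fun y => G0 _)).
rewrite (skew_split x (measurableT_comp mg (measurable_orbit k)) (fun y => g0 _)).
by apply: eq_integral => a _; rewrite /= IH.
Qed.

Lemma law_comp j k x (u : E -> \bar R) :
  measurable_fun setT u -> (forall y, 0 <= u y) ->
  \int[law (j + k) x]_y u y = \int[law j x]_y \int[law k y]_z u z.
Proof.
move=> mu' u0; under [RHS]eq_integral do rewrite integral_law//.
rewrite -(markov_property j x (measurableT_comp mu' (measurable_orbit k)) (fun y => u0 _)).
rewrite integral_law//; apply: eq_integral => v _.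
by rewrite /orbit /= -iterD addnC.
Qed.

Lemma measurable_integral_law k (u : E -> \bar R) :
  measurable_fun setT u -> (forall y, 0 <= u y) ->
  measurable_fun setT (fun x => \int[law k x]_y u y).
Proof.
move=> mu' u0; under eq_fun do rewrite integral_law//.
exact: (measurable_integralQ (measurableT_comp mu' (measurable_orbit k))
  (fun y => u0 _)).
Qed.

Lemma law_integral_indic k x A : measurable A ->
  law k x A = \int[law k x]_y (\1_A y)%:E.
Proof. by move=> mA; rewrite integral_indic// setIT. Qed.

Lemma measurable_indicE A : measurable A ->
  measurable_fun setT (fun y : E => (\1_A y)%:E : \bar R).
Proof. by move=> mA; apply/measurable_EFinP; exact: measurable_indic. Qed.

Lemma measurable_law k A : measurable A ->
  measurable_fun setT (fun x => law k x A).
Proof.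
move=> mA; under eq_fun do rewrite law_integral_indic//.
by apply: measurable_integral_law => //; exact: measurable_indicE.
Qed.

Lemma law_compA j k x A : measurable A ->
  law (j + k) x A = \int[law j x]_y law k y A.
Proof.
move=> mA; rewrite law_integral_indic// law_comp//; last exact: measurable_indicE.
by apply: eq_integral => y _; rewrite law_integral_indic.
Qed.

Definition stationary (pi : probability E R) :=
  forall A, measurable A -> pi A = \int[pi]_x law 1 x A.

Section stationary_measure.
Variable pi : probability E R.
Hypothesis pi_stat : stationary pi.

Lemma stationary_integral (u : E -> \bar R) :
  measurable_fun setT u -> (forall y, 0 <= u y) ->
  \int[pi]_x u x = \int[pi]_x \int[law 1 x]_y u y.
Proof.
move=> mu' u0.
pose X := mfun_Sub (mem_set (measurable_orbit 1)).
transitivity (\int[distribution (pi \x Q)%E X]_x u x).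
  apply: eq_measure_integral => A mA _.
  apply: (etrans (pi_stat mA)).
  by apply: eq_integral => x _; rewrite lawE; congr (Q _);
    apply/seteqP; split => v; rewrite /xsection /= inE.
rewrite ge0_integral_distribution//.
under [RHS]eq_integral do rewrite integral_law//.
exact: (fubini_tonelli1 (u \o orbit 1)
  (measurableT_comp mu' (measurable_orbit 1)) (fun y => u0 _)).
Qed.

(** Since the head of the noise is independent of the tail, a stationary law for
    the states makes the product with the noise law invariant. *)
Lemma integral_skew (G : E * S -> \bar R) :
  measurable_fun setT G -> (forall y, 0 <= G y) ->
  \int[(pi \x Q)%E]_y G (skew y) = \int[(pi \x Q)%E]_y G y.
Proof.
move=> mG G0.
have mGs : measurable_fun setT (G \o skew).
  exact: (measurableT_comp mG measurable_skew).
rewrite [LHS](fubini_tonelli1 (G \o skew) mGs (fun y => G0 _)).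
rewrite [RHS](fubini_tonelli1 G mG G0) /fubini_F.
rewrite [RHS]stationary_integral//; last 2 first.
- exact: measurable_integralQ.
- by move=> y; exact: integral_ge0.
by apply: eq_integral => x _; rewrite (markov_property 1).
Qed.

End stationary_measure.

End skew_product.

(** * Convergence in total variation from an overlap condition *)

Section real_sequences.
Context (R : realType).

(** The bound makes the sequence Cauchy, and passes to the limit in j. *)
Lemma cvg_tail_bound (a r : nat -> R) :
  (forall k j, `|a (j + k)%N - a k| <= r k) -> r @ \oo --> 0 ->
  cvg (a @ \oo) /\ forall k, `|lim (a @ \oo) - a k| <= r k.
Proof.
move=> ar r0.
have ca : cvg (a @ \oo).
  apply/cauchy_cvgP/cauchyP => e e0.
  have [N _ HN] : \forall k \near \oo, `|r k| < e by move/cvgr0Pnorm_lt : r0; exact.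
  exists (a N); exists N => // n /= Nn; rewrite /ball /= distrC.
  apply: (le_lt_trans _ (HN N (leqnn _))); apply: (le_trans _ (ler_norm _)).
  by rewrite -{1}(subnK Nn) ar.
split=> // k.
have : `|a j - a k| @[j --> \oo] --> `|lim (a @ \oo) - a k|.
  by apply: cvg_norm; apply: cvgB => //; exact: cvg_cst.
move=> cak; rewrite -(cvg_lim _ cak)//; apply: limr_le; first by apply/cvg_ex; eexists; exact: cak.
near=> j; have kj : (k <= j)%N by near: j; exact: nbhs_infty_ge.
by rewrite -(subnK kj) ar.
Unshelve. all: by end_near. Qed.

Lemma cvg_sumr (f : nat -> nat -> R) (l : nat -> R) n :
  (forall i, f i k @[k --> \oo] --> l i) ->
  \sum_(0 <= i < n) f i k @[k --> \oo] --> \sum_(0 <= i < n) l i.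
Proof.
move=> fl; elim: n => [|n IH].
  by under eq_fun do rewrite big_nil; rewrite big_nil; exact: cvg_cst.
under eq_fun do rewrite big_nat_recr//=.
by rewrite big_nat_recr//=; exact: cvgD.
Qed.

End real_sequences.

Section dobrushin.
Local Open Scope ereal_scope.
Context (R : realType) dE (E : measurableType dE).
Variable L : nat -> E -> probability E R.
Hypothesis mL : forall k A, measurable A -> measurable_fun setT (fun x => L k x A).
Hypothesis compL : forall j k x A, measurable A ->
  L (j + k) x A = \int[L j x]_y L k y A.
Variables (C : set E) (x0 : E) (T0 : nat) (q : R).
Hypotheses (mC : measurable C) (Cx0 : C x0).
Hypothesis absorbC : forall k x, C x -> L k x (~` C) = 0.
Hypotheses (T0_gt0 : (0 < T0)%N) (q_ge0 : (0 <= q)%R) (q_lt1 : (q < 1)%R).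
Hypothesis overlap : forall x y A, C x -> C y -> measurable A ->
  L T0 x A <= L T0 y A + q%:E.

(** Each block of T0 steps contracts by the factor q. *)
Definition rate k : R := (q ^+ (k %/ T0))%R.

Lemma rate_ge0 k : (0 <= rate k)%R. Proof. exact: exprn_ge0. Qed.

Lemma cvg_rate : (rate k @[k --> \oo] --> 0)%R.
Proof.
apply: (@cvg_comp _ _ _ (fun k => k %/ T0)%N (fun n => q ^+ n)%R _ \oo).
  move=> A [N _ NA]; exists (N * T0)%N => // k /= Nk.
  by apply: NA; rewrite /= leq_divRL.
by apply: cvg_expr; rewrite ger0_norm.
Qed.

Lemma ae_absorb k x : C x -> {ae L k x, forall y, C y}.
Proof. by move=> Cx; exists (~` C); split; [exact: measurableC|exact: absorbC|]. Qed.

(** Induction over blocks of T0 steps. With n steps to go, the probability of A as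
    a function of the state in C lies between its infimum m and m + rate n. The
    constant m contributes equally from x and from y, and the excess over m,
    which is at most rate n, contributes at most q * rate n more from x than
    from y. *)
Lemma osc_rate k x y A : C x -> C y -> measurable A ->
  L k x A <= L k y A + (rate k)%:E.
Proof.
move=> + + mA; elim/ltn_ind: k x y => k IH x y Cx Cy.
have [kT|Tk] := ltnP k T0.
  rewrite /rate divn_small// expr0.
  by rewrite (le_trans (probability_le1 _ mA))// leeDr.
rewrite -(subnKC Tk); set n := (k - T0)%N.
have nk : (n < k)%N by rewrite ltn_subrL T0_gt0 (leq_trans T0_gt0).
have {}IH := IH n nk.
pose phi z := fine (L n z A).
have phiE z : (phi z)%:E = L n z A by rewrite fineK// fin_num_measure.
have phi0 z : (0 <= phi z)%R by exact/fine_ge0/measure_ge0.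
have mphi : measurable_fun setT phi.
  apply/measurable_EFinP; rewrite (_ : EFin \o phi = L n ^~ A); first exact: mL.
  by apply/funext => z; exact: phiE.
pose V := [set phi z | z in C].
have V0 : V !=set0 by exists (phi x0), x0.
have Vlb : has_lbound V by exists 0%R => _ [z _ <-].
pose m := inf V.
have m0 : (0 <= m)%R by apply: lb_le_inf => // _ [z _ <-].
have mphiC z : C z -> (m <= phi z)%R by move=> Cz; apply: ge_inf => //; exists z.
have phim z : C z -> (phi z - m <= rate n)%R.
  move=> Cz; rewrite lerBlDr addrC -lerBlDr; apply: lb_le_inf => // _ [z' Cz' <-].
  by rewrite lerBlDr -lee_fin EFinD !phiE; exact: IH.
pose G z : R := (Num.min (Num.max (phi z - m) 0) (rate n))%R.
have mG : measurable_fun setT (EFin \o G).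
  apply/measurable_EFinP; apply: measurable_minr => //.
  by apply: measurable_maxr => //; exact: measurable_funB.
have G0 z : (0 <= G z)%R by rewrite /G le_min rate_ge0 andbT le_max lexx orbT.
have GL z : (G z <= rate n)%R by rewrite /G ge_min lexx orbT.
have intE z : C z -> L (T0 + n) z A = m%:E + \int[L T0 z]_u (G u)%:E.
  move=> Cz; rewrite compL//.
  transitivity (\int[L T0 z]_u (cst m%:E u + (G u)%:E)).
    apply: ge0_ae_eq_integral => //.
    - exact: mL.
    - by apply: emeasurable_funD.
    - by move=> u _; rewrite adde_ge0 ?lee_fin.
    apply: filterS (ae_absorb T0 Cz) => u Cu _.
    rewrite -phiE -EFinD; congr (_%:E); rewrite /G max_l ?subr_ge0 ?mphiC//.
    by rewrite min_l ?phim// subrKC.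
  rewrite ge0_integralD//; last by move=> u _; rewrite lee_fin.
  by rewrite integral_prob_cst.
rewrite !intE// -addeA leeD2l//.
have -> : rate (T0 + n) = (rate n * q)%R.
  by rewrite /rate divnDl// divnn T0_gt0 exprD expr1 mulrC.
apply: le_integral_almost_dominated => //; first exact: rate_ge0.
by move=> B mB; exact: overlap.
Qed.

(** The law at time j + k is the average over y, within C, of the laws at time k
    started from y. *)
Lemma law_upper j k x y A : C x -> C y -> measurable A ->
  L (j + k) y A <= L k x A + (rate k)%:E.
Proof.
move=> Cx Cy mA; rewrite compL//.
have -> : L k x A + (rate k)%:E = \int[L j y]_z cst (L k x A + (rate k)%:E) z.
  by rewrite integral_prob_cst.
apply: ae_ge0_le_integral => //; first exact: mL.
  by move=> z _; rewrite adde_ge0// lee_fin rate_ge0.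
by apply: filterS (ae_absorb j Cy) => z Cz _; exact: osc_rate.
Qed.

Lemma law_lower j k x y A : C x -> C y -> measurable A ->
  L k x A <= L (j + k) y A + (rate k)%:E.
Proof.
move=> Cx Cy mA; rewrite compL//.
have -> : L k x A = \int[L j y]_z cst (L k x A) z.
  by rewrite integral_prob_cst.
have -> : \int[L j y]_z L k z A + (rate k)%:E =
    \int[L j y]_z (L k z A + cst (rate k)%:E z).
  rewrite ge0_integralD//; first by rewrite integral_prob_cst.
  - exact: mL.
  - by move=> z _; rewrite lee_fin rate_ge0.
apply: ae_ge0_le_integral => //.
- by move=> z _; rewrite adde_ge0// lee_fin rate_ge0.
- by apply: emeasurable_funD => //; exact: mL.
by apply: filterS (ae_absorb j Cy) => z Cz _; exact: osc_rate.
Qed.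


Let mass k A : R := fine (L k x0 A).

Let massE k A : measurable A -> (mass k A)%:E = L k x0 A.
Proof. by move=> mA; rewrite fineK// fin_num_measure. Qed.

Let mass_cvg A : measurable A ->
  cvg (mass ^~ A @ \oo) /\
  forall k, (`|lim (mass ^~ A @ \oo) - mass k A| <= rate k)%R.
Proof.
move=> mA; apply: cvg_tail_bound; last exact: cvg_rate.
move=> k j; rewrite ler_distlC lerBlDr -!lee_fin !EFinD !massE//.
by rewrite law_lower//= law_upper.
Qed.

(** On measurable sets the limit exists and is non-negative; the absolute value
    keeps the function non-negative on the other sets. *)
Definition limit_law (A : set E) : \bar R := (`|lim (mass ^~ A @ \oo)|%R)%:E.

Let limit_lawE A : measurable A -> limit_law A = (lim (mass ^~ A @ \oo))%:E.
Proof.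
move=> mA; rewrite /limit_law ger0_norm//; apply: limr_ge.
  by have [] := mass_cvg mA.
by apply: nearW => k; exact/fine_ge0/measure_ge0.
Qed.

Lemma law_le_limit k x A : C x -> measurable A ->
  L k x A <= limit_law A + (rate k)%:E.
Proof.
move=> Cx mA; rewrite limit_lawE// -(fineK (fin_num_measure (L k x) A mA)).
rewrite -EFinD lee_fin -lerBlDr; apply: limr_ge; first by have [] := mass_cvg mA.
near=> j; rewrite lerBlDr -lee_fin EFinD massE// fineK ?fin_num_measure//.
have kj : (k <= j)%N by near: j; exact: nbhs_infty_ge.
by rewrite -(subnK kj) law_lower.
Unshelve. all: by end_near. Qed.

Lemma limit_le_law k x A : C x -> measurable A ->
  limit_law A <= L k x A + (rate k)%:E.
Proof.
move=> Cx mA; rewrite limit_lawE// -(fineK (fin_num_measure (L k x) A mA)).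
rewrite -EFinD lee_fin; apply: limr_le; first by have [] := mass_cvg mA.
near=> j; rewrite -lee_fin EFinD massE// fineK ?fin_num_measure//.
have kj : (k <= j)%N by near: j; exact: nbhs_infty_ge.
by rewrite -(subnK kj) law_upper.
Unshelve. all: by end_near. Qed.

Let limit_law0 : limit_law set0 = 0.
Proof.
rewrite limit_lawE//; congr (_%:E); apply/cvg_lim => //.
by under eq_fun do rewrite /mass measure0; exact: cvg_cst.
Qed.

Let limit_law_ge0 A : 0 <= limit_law A.
Proof. by rewrite lee_fin. Qed.

Let limit_law_bigsetU (F : nat -> set E) n :
  (forall i, measurable (F i)) -> trivIset setT F ->
  \sum_(0 <= i < n) limit_law (F i) = limit_law (\big[setU/set0]_(i < n) F i).
Proof.
move=> mF tF; under eq_bigr do rewrite limit_lawE//.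
rewrite sumEFin limit_lawE; last exact: bigsetU_measurable.
congr (_%:E); apply/esym/cvg_lim => //.
have -> : (mass ^~ (\big[setU/set0]_(i < n) F i)) =
    (fun k => \sum_(0 <= i < n) mass k (F i))%R.
  apply/funext => k; apply: EFin_inj; rewrite massE; last exact: bigsetU_measurable.
  rewrite measure_bigsetU// -sumEFin big_mkord.
  by apply: eq_bigr => i _; rewrite massE.
by apply: cvg_sumr => i; have [] := mass_cvg (mF i).
Qed.

(** The convergence to limit_law is uniform in the set, so the limit in time and
    the limit over partial unions can be exchanged. *)
Let limit_law_sigma_additive : semi_sigma_additive limit_law.
Proof.
move=> F mF tF mUF.
have mU n : measurable (\big[setU/set0]_(i < n) F i) by exact: bigsetU_measurable.
rewrite (_ : (fun n => _) =
    fun n => (lim (mass ^~ (\big[setU/set0]_(i < n) F i) @ \oo))%:E); last first.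
  by apply/funext => n; rewrite limit_law_bigsetU// limit_lawE.
rewrite limit_lawE//.
apply/fine_cvgP; split; first exact: nearW.
set l := lim _; rewrite (_ : fine \o _ =
  fun n => lim (mass ^~ (\big[setU/set0]_(i < n) F i) @ \oo))//.
apply/cvgrPdist_le => e e0.
have e3 : (0 < e / 3)%R by rewrite divr_gt0.
have [k _ /(_ k (leqnn k)) rk] : \forall k \near \oo, (`|rate k| <= e / 3)%R.
  by move/cvgr0Pnorm_le : cvg_rate; exact.
have {}rk : (rate k <= e / 3)%R by apply: le_trans rk; exact: ler_norm.
have : L k x0 (\big[setU/set0]_(i < n) F i) @[n --> \oo] --> L k x0 (\bigcup_n F n).
  rewrite (_ : (fun n => _) = fun n => \sum_(0 <= i < n) L k x0 (F i)).
    exact: measure_semi_sigma_additive.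
  by apply/funext => n; rewrite measure_bigsetU// big_mkord.
rewrite -(massE k mUF) => /fine_cvg /cvgrPdist_le /(_ _ e3) [N _ NH].
exists N => // n /= /NH {NH}; rewrite /= -/(mass k _) => h.
have [_ /(_ k) h1] := mass_cvg mUF; have [_ /(_ k) h2] := mass_cvg (mU n).
move: h h1 h2; rewrite -/l; set a := mass _ _; set b := mass _ _; set c := lim _.
rewrite !ler_norml => /andP[? ?] /andP[? ?] /andP[? ?]; lra.
Qed.

HB.instance Definition _ := isMeasure.Build _ _ _ limit_law
  limit_law0 limit_law_ge0 limit_law_sigma_additive.

Let limit_lawT : limit_law setT = 1.
Proof.
rewrite limit_lawE//; congr (_%:E); apply/cvg_lim => //.
by under eq_fun do rewrite /mass probability_setT; exact: cvg_cst.
Qed.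

HB.instance Definition _ := Measure_isProbability.Build _ _ _ limit_law limit_lawT.

Lemma limit_law_absorb : limit_law (~` C) = 0.
Proof.
rewrite limit_lawE; last exact: measurableC.
congr (_%:E); apply/cvg_lim => //.
by under eq_fun do rewrite /mass absorbC//; exact: cvg_cst.
Qed.

(** The law at time k + 1 is the average of the one-step laws over the law at time
    k; both are within rate k of their limits. *)
Lemma limit_law_stationary A : measurable A ->
  limit_law A = \int[limit_law]_x L 1 x A.
Proof.
move=> mA.
have L1 x : 0 <= L 1 x A <= 1 by rewrite measure_ge0 probability_le1.
have cmp k : limit_law A <= \int[limit_law]_x L 1 x A + (rate k + rate (k + 1))%:E /\
    \int[limit_law]_x L 1 x A <= limit_law A + (rate k + rate (k + 1))%:E.
  have h : \int[L k x0]_x L 1 x A <= \int[limit_law]_x L 1 x A + (1 * rate k)%:E.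
    apply: (@le_integral_almost_dominated _ _ _ (L k x0) limit_law (rate k) 1) => //.
    - by move=> B mB; exact: law_le_limit.
    - exact: mL.
    - by move=> x; case/andP: (L1 x).
  have h' : \int[limit_law]_x L 1 x A <= \int[L k x0]_x L 1 x A + (1 * rate k)%:E.
    apply: (@le_integral_almost_dominated _ _ _ limit_law (L k x0) (rate k) 1) => //.
    - by move=> B mB; exact: limit_le_law.
    - exact: mL.
    - by move=> x; case/andP: (L1 x).
  move: h h'; rewrite -compL// mul1r => h h'; rewrite EFinD; split.
    rewrite addeA; apply: le_trans (limit_le_law (k + 1) Cx0 mA) _.
    by rewrite leeD2r.
  rewrite [X in _ + X]addeC addeA; apply: le_trans h' _; rewrite leeD2r//.
  exact: law_le_limit.
have r0 : (rate k + rate (k + 1) @[k --> \oo] --> 0)%R.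
  rewrite -[X in _ --> X]addr0; apply: cvgD; first exact: cvg_rate.
  by rewrite (cvg_shiftn 1 rate); exact: cvg_rate.
have small (a b : \bar R) :
    (forall k, a <= b + (rate k + rate (k + 1))%:E) -> a <= b.
  move=> ab; apply/lee_addgt0Pr => e e0.
  have [k _ /(_ k (leqnn k)) rk] : \forall k \near \oo, (`|rate k + rate (k + 1)| <= e)%R.
    by move/cvgr0Pnorm_le : r0; exact.
  apply: le_trans (ab k) _; rewrite leeD2l// lee_fin.
  by apply: le_trans rk; exact: ler_norm.
by apply/eqP; rewrite eq_le !small// => k; have [] := cmp k.
Qed.

Hypothesis reachC : forall x, exists k, L k x (~` C) = 0.

(** From x, the chain is in C at time k0; the uniform bounds on C apply from
    then on. *)
Lemma total_variation_bound x : exists k0, forall k A, measurable A ->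
  `|L (k0 + k) x A - limit_law A| <= (rate k)%:E.
Proof.
have [k0 k0C] := reachC x; exists k0 => k A mA.
have aeC : {ae L k0 x, forall y, C y}.
  by exists (~` C); split; [exact: measurableC|exact: k0C|].
have hu : L (k0 + k) x A <= limit_law A + (rate k)%:E.
  rewrite compL// -[leRHS](integral_prob_cst (L k0 x)).
  apply: ae_ge0_le_integral => //; first exact: mL.
    by move=> z _; rewrite adde_ge0// lee_fin rate_ge0.
  by apply: filterS aeC => y Cy _; exact: law_le_limit.
have hl : limit_law A <= L (k0 + k) x A + (rate k)%:E.
  rewrite compL// -[leLHS](integral_prob_cst (L k0 x)).
  rewrite -[(rate k)%:E](integral_prob_cst (L k0 x)) -ge0_integralD//; last 2 first.
  - exact: mL.
  - by move=> z _; rewrite lee_fin rate_ge0.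
  apply: ae_ge0_le_integral => //.
  - by move=> z _; rewrite adde_ge0// lee_fin rate_ge0.
  - by apply: emeasurable_funD => //; exact: mL.
  by apply: filterS aeC => y Cy _; exact: limit_le_law.
by apply: abse_sub_le => //; exact: fin_num_measure.
Qed.

Lemma uniform_ergodicity : exists pi : probability E R,
  [/\ forall A, measurable A -> pi A = \int[pi]_x L 1 x A,
      pi (~` C) = 0,
      forall k x A, C x -> measurable A -> L k x A <= pi A + (rate k)%:E &
      forall x, exists k0, forall k A, measurable A ->
        `|L (k0 + k) x A - pi A| <= (rate k)%:E].
Proof.
exists limit_law; split.
- exact: limit_law_stationary.
- exact: limit_law_absorb.
- by move=> k x A; exact: law_le_limit.
- exact: total_variation_bound.
Qed.

End dobrushin.

(** * The maximal inequality and almost sure convergence of time averages *)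

Section maximal_inequality.
Local Open Scope ereal_scope.
Context (R : realType) d (Y : measurableType d) (m : probability Y R).
Variable Theta : Y -> Y.
Hypothesis mTheta : measurable_fun setT Theta.
Hypothesis invTheta : forall G : Y -> \bar R, measurable_fun setT G ->
  (forall y, 0 <= G y) -> \int[m]_y G (Theta y) = \int[m]_y G y.

Definition birkhoff_sum (phi : Y -> R) n y : R :=
  (\sum_(0 <= j < n) phi (iter j Theta y))%R.

Lemma birkhoff_sumS phi n y :
  birkhoff_sum phi n.+1 y = (phi y + birkhoff_sum phi n (Theta y))%R.
Proof.
rewrite /birkhoff_sum big_nat_recl//; congr (_ + _)%R.
by apply: eq_bigr => j _; rewrite -iterSr.
Qed.

Lemma measurable_iterT j : measurable_fun setT (iter j Theta).
Proof.
by elim: j => [|j IH]; [exact: measurable_id|exact: (measurableT_comp mTheta IH)].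
Qed.

Lemma measurable_birkhoff_sum phi n : measurable_fun setT phi ->
  measurable_fun setT (birkhoff_sum phi n).
Proof.
move=> mphi; apply: measurable_sum => j.
exact: (measurableT_comp mphi (measurable_iterT j)).
Qed.

Lemma integral_iterT j (G : Y -> \bar R) : measurable_fun setT G ->
  (forall y, 0 <= G y) -> \int[m]_y G (iter j Theta y) = \int[m]_y G y.
Proof.
move=> mG G0; elim: j => [//|j IH]; rewrite -IH.
under eq_integral do rewrite iterSr.
rewrite -(invTheta (measurableT_comp mG (measurable_iterT j)) (fun y => G0 _)).
by [].
Qed.

Section maximal.
Variables (psi : Y -> R) (lam : R).
Hypotheses (mpsi : measurable_fun setT psi) (psi0 : forall y, (0 <= psi y)%R).
Hypothesis lam0 : (0 < lam)%R.

(** The maximum over n <= N of the Birkhoff sums of psi - lam, in the recursive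
    form on which the maximal inequality rests. *)
Fixpoint Mx N y : R :=
  if N is N'.+1 then Num.max 0%R (psi y - lam + Mx N' (Theta y))%R else 0%R.

Let Mx_ge0 N y : (0 <= Mx N y)%R.
Proof. by case: N => [//|N] /=; rewrite le_max lexx. Qed.

Let Mx_nd N y : (Mx N y <= Mx N.+1 y)%R.
Proof.
elim: N y => [|N IH] y; first exact: Mx_ge0.
by rewrite [leLHS]/= [leRHS]/= ge_max !le_max lexx/= lerD2l IH orbT.
Qed.

Let mMx N : measurable_fun setT (Mx N).
Proof.
elim: N => [|N IH]; first exact: measurable_cst.
apply: measurable_maxr => //; apply: measurable_funD.
  exact: measurable_funB.
exact: (measurableT_comp IH mTheta).
Qed.

Let birkhoff_le_Mx n N y : (n <= N)%N ->
  (birkhoff_sum psi n y - n%:R * lam <= Mx N y)%R.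
Proof.
elim: N n y => [|N IH] [|n] y //.
- by rewrite /birkhoff_sum big_nil mul0r subr0.
- by move=> _; rewrite /birkhoff_sum big_nil mul0r subr0 Mx_ge0.
rewrite ltnS => /(IH _ (Theta y)) h.
rewrite birkhoff_sumS /= le_max; apply/orP; right.
move: h; rewrite -natr1; lra.
Qed.

Let D N := [set y | (0 < Mx N y)%R].

Let mD N : measurable (D N).
Proof.
have m0 : measurable_fun [set: Y] (fun=> 0%R : R) by exact: measurable_cst.
have h := measurable_fun_ltr m0 (mMx N).
by have := h measurableT [set true] I; rewrite setTI.
Qed.

Let mpsiE : measurable_fun setT (fun y => (psi y)%:E).
Proof. exact/measurable_EFinP. Qed.

Let psiE0 y : 0 <= (psi y)%:E. Proof. by rewrite lee_fin. Qed.

Let mMxE N : measurable_fun setT (fun y => (Mx N y)%:E).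
Proof. by apply/measurable_EFinP; exact: mMx. Qed.

Let MxE0 N y : 0 <= (Mx N y)%:E. Proof. by rewrite lee_fin Mx_ge0. Qed.

Let mMT N : measurable_fun setT (fun y => (Mx N (Theta y))%:E).
Proof. by apply/measurable_EFinP; exact: (measurableT_comp (mMx N) mTheta). Qed.

Let intMx_fin N : \int[m]_y (psi y)%:E < +oo -> \int[m]_y (Mx N y)%:E < +oo.
Proof.
move=> psifin; elim: N => [|N IH]; first by rewrite integral0.
apply: (@le_lt_trans _ _ (\int[m]_y ((psi y)%:E + (Mx N (Theta y))%:E))).
  apply: ge0_le_integral => //; first exact: emeasurable_funD.
  move=> y _; rewrite -EFinD lee_fin /= ge_max addr_ge0 ?Mx_ge0//=.
  by rewrite lerD2r gerBl ltW.
rewrite ge0_integralD// lte_add_pinfty//.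
by rewrite (invTheta (mMxE N) (MxE0 N)).
Qed.

(** Where Mx N.+1 is positive it equals psi - lam + Mx N after Theta, and elsewhere
    it is 0. Integrate and cancel: Mx N after Theta has the same integral as
    Mx N, which is at most that of Mx N.+1. *)
Let maximal_finite N : \int[m]_y (psi y)%:E < +oo ->
  lam%:E * m (D N) <= \int[m]_y (psi y)%:E.
Proof.
move=> psifin; case: N => [|N].
  rewrite (_ : D 0 = set0) ?measure0 ?mule0 ?integral_ge0//.
  by apply/seteqP; split => y; rewrite /D /= ?ltxx.
have mlD : measurable_fun setT (fun y => lam%:E * (\1_(D N.+1) y)%:E).
  by apply: measurable_funeM; apply/measurable_EFinP; exact: measurable_indic.
have lD0 y : 0 <= lam%:E * (\1_(D N.+1) y)%:E by apply: mule_ge0; rewrite lee_fin ?(ltW lam0)// indicE ler0n.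
have key : \int[m]_y ((Mx N.+1 y)%:E + lam%:E * (\1_(D N.+1) y)%:E) <=
    \int[m]_y ((psi y)%:E + (Mx N (Theta y))%:E).
  apply: ge0_le_integral => //.
  - by move=> y _; rewrite adde_ge0.
  - exact: emeasurable_funD.
  - exact: emeasurable_funD.
  move=> y _; rewrite -EFinM -!EFinD lee_fin indicE.
  have [yD|] := boolP (y \in D N.+1).
    move: yD; rewrite inE /D /= lt_max ltxx/= => h.
    by rewrite max_r ?(ltW h)// mulr1; lra.
  rewrite notin_setE /D /= => /negP; rewrite -leNgt => M0.
  have -> : Num.max 0%R (psi y - lam + Mx N (Theta y))%R = 0%R.
    by apply/le_anti; rewrite M0 le_max lexx.
  by rewrite mulr0 addr0 addr_ge0 ?Mx_ge0.
rewrite ge0_integralD// in key.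
rewrite ge0_integralD// in key.
rewrite ge0_integralZl// in key; last 2 first.
- by apply/measurable_EFinP; exact: measurable_indic.
- by rewrite lee_fin ltW.
rewrite integral_indic// setIT in key.
rewrite (invTheta (mMxE N) (MxE0 N)) in key.
have le2 : \int[m]_y (Mx N y)%:E <= \int[m]_y (Mx N.+1 y)%:E.
  by apply: ge0_le_integral => // y _; rewrite lee_fin Mx_nd.
have fin1 : \int[m]_y (Mx N.+1 y)%:E \is a fin_num.
  by rewrite ge0_fin_numE ?intMx_fin// integral_ge0.
rewrite -(leeD2lE _ _ fin1); apply: (le_trans key).
by rewrite addeC leeD2r.
Qed.

(** Hopf's maximal inequality, the source of all almost sure statements here. The
    sets D N increase with N, and the bound on their measure does not depend
    on N. *)
Lemma maximal_ineq : exists D0 : set Y, [/\ measurable D0,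
  lam%:E * m D0 <= \int[m]_y (psi y)%:E &
  forall y n, ~ D0 y -> (birkhoff_sum psi n y <= n%:R * lam)%R].
Proof.
exists (\bigcup_N D N); split; first exact: bigcupT_measurable.
  have [psifin|] := ltP (\int[m]_y (psi y)%:E) +oo; last first.
    by rewrite leye_eq => /eqP ->; rewrite leey.
  have : lam%:E * m (D N) @[N --> \oo] --> lam%:E * m (\bigcup_N D N).
    apply: cvgeZl => //; apply: nondecreasing_cvg_mu => //.
      exact: bigcupT_measurable.
    apply/nondecreasing_seqP => N; apply/subsetPset => y; rewrite /D /= => h.
    exact: lt_le_trans (Mx_nd N y).
  move=> cv; rewrite -(cvg_lim _ cv)//; apply: lime_le.
    by apply/cvg_ex; eexists; exact: cv.
  by apply: nearW => N; exact: maximal_finite.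
move=> y n yD; rewrite leNgt; apply/negP => h; apply: yD; exists n => //=.
by apply: lt_le_trans (birkhoff_le_Mx _ (leqnn n)); rewrite subr_gt0.
Qed.

End maximal.

End maximal_inequality.

Section sliding_sums.
Context (R : realType).
Variables (a : nat -> R) (B : R).
Hypothesis aB : forall j, 0 <= a j <= B.

Lemma sum_shift_bound i n :
  `|\sum_(0 <= j < n) a (i + j)%N - \sum_(0 <= j < n) a j| <= i%:R * B.
Proof.
elim: i => [|i IH]; first by rewrite mul0r subrr normr0.
have -> : \sum_(0 <= j < n) a (i.+1 + j)%N =
    \sum_(0 <= j < n) a (i + j)%N + (a (i + n)%N - a i).
  have h : \sum_(0 <= j < n.+1) a (i + j)%N =
    a i + \sum_(0 <= j < n) a (i.+1 + j)%N.
    rewrite big_nat_recl// addn0; congr (_ + _).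
    by apply: eq_bigr => j _; rewrite addSnnS.
  by move: h; rewrite big_nat_recr//=; lra.
have /andP[a0 a1] := aB (i + n)%N; have /andP[a2 a3] := aB i.
move: IH; rewrite !ler_norml -natr1 mulrDl mul1r => /andP[h1 h2].
by apply/andP; split; lra.
Qed.

Lemma sum_window_bound k n :
  `|\sum_(0 <= j < n) \sum_(0 <= i < k) a (i + j)%N - k%:R * \sum_(0 <= j < n) a j|
    <= k%:R * (k%:R * B).
Proof.
have natE x : k%:R * x = \sum_(0 <= i < k) x :> R.
  by rewrite sumr_const_nat subn0 mulr_natl.
rewrite exchange_big /= natE -sumrB.
apply: le_trans (ler_norm_sum _ _ _) _; rewrite [leRHS]natE.
apply: ler_sum_nat => i /andP[_ ik].
apply: le_trans (sum_shift_bound i n) _; rewrite ler_wpM2r ?ler_nat 1?ltnW//.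
by have /andP[] := aB 0%N; exact: le_trans.
Qed.

End sliding_sums.

Section law_of_large_numbers.
Context (R : realType) d (Y : measurableType d) (m : probability Y R).
Variable Theta : Y -> Y.
Hypothesis mTheta : measurable_fun setT Theta.
Hypothesis invTheta : forall G : Y -> \bar R, measurable_fun setT G ->
  (forall y, 0 <= G y)%E -> (\int[m]_y G (Theta y) = \int[m]_y G y)%E.

Local Notation S := (birkhoff_sum Theta).

(** Almost sure convergence of the averages to c, in a quantitative form that is
    stable under approximation in mean (lln_approx). *)
Definition lln (phi : Y -> R) (c : R) := forall e : R, 0 < e ->
  exists D : set Y, [/\ measurable D, (m D <= e%:E)%E &
    forall y, ~ D y -> \forall n \near \oo, `|n%:R^-1 * S phi n y - c| <= e].

(** For a large block length k, the block averages are within e of c in mean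
    square. The maximal inequality applied to their squared deviation bounds,
    off a small set, the time averages of this square; and the time averages of
    the block averages are, up to O(1/n), those of phi. *)
Lemma lln_of_mean (phi : Y -> R) (B c : R) :
  measurable_fun setT phi -> (forall y, 0 <= phi y <= B) ->
  (forall e : R, 0 < e -> exists2 k, (0 < k)%N &
    (\int[m]_y ((k%:R^-1 * S phi k y - c) ^+ 2)%:E <= e%:E)%E) ->
  lln phi c.
Proof.
move=> mphi phiB mean e0' e0'0; set e := e0' / 2.
have e_gt0 : 0 < e by rewrite divr_gt0.
have [k k0 hk] := mean (e * e ^+ 2) ltac:(by rewrite mulr_gt0 ?exprn_gt0).
pose psi y := (k%:R^-1 * S phi k y - c) ^+ 2.
have mS := measurable_birkhoff_sum mTheta k mphi.
have mpsi : measurable_fun setT psi.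
  apply: measurable_funX; apply: measurable_funB => //.
  exact: measurable_funM.
have psi0 y : 0 <= psi y by exact: sqr_ge0.
have le_ : 0 < e ^+ 2 by rewrite exprn_gt0.
have [D [mD hD HD]] := maximal_ineq mTheta invTheta mpsi psi0 le_.
exists D; split => //.
  have : ((e ^+ 2)%:E * m D <= (e ^+ 2)%:E * e%:E)%E.
    by apply: le_trans hD _; rewrite -EFinM mulrC.
  rewrite lee_pmul2l// => h; apply: le_trans h _; rewrite lee_fin /e; lra.
move=> y Dy.
have kR : 0 < k%:R :> R by rewrite ltr0n.
have bound n : `|k%:R^-1 * \sum_(0 <= j < n) S phi k (iter j Theta y) - n%:R * c|
    <= n%:R * e.
  have -> : n%:R * c = \sum_(0 <= j < n) c by rewrite sumr_const_nat subn0 mulr_natl.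
  rewrite mulr_sumr -sumrB.
  apply: le_trans (ler_norm_sum _ _ _) _.
  have h j : `|k%:R^-1 * S phi k (iter j Theta y) - c| <=
      e / 2 + psi (iter j Theta y) / (2 * e).
    (* From 2 e |x| <= e ^ 2 + x ^ 2. *)
    rewrite /psi; move: (_ - c) => x.
    have -> : e / 2 + x ^+ 2 / (2 * e) = `|x| + (e - `|x|) ^+ 2 / (2 * e).
      by rewrite sqrrB real_normK ?num_real//; field; rewrite gt_eqF.
    by rewrite lerDl divr_ge0 ?sqr_ge0// mulr_ge0 ?ltW.
  apply: (@le_trans _ _ (\sum_(0 <= j < n) (e / 2 + psi (iter j Theta y) / (2 * e)))).
    by apply: ler_sum => j _; exact: h.
  rewrite big_split /= sumr_const_nat subn0 -mulr_suml -[\sum_(_ <= _ < _) _]/(S psi n y).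
  have := HD y n Dy.
  rewrite -(ler_pM2r (_ : 0 < (2 * e)^-1)); last by rewrite invr_gt0 mulr_gt0.
  rewrite -[e / 2 *+ n]mulr_natl.
  have -> : n%:R * e ^+ 2 / (2 * e) = n%:R * (e / 2).
    by field; rewrite gt_eqF.
  move=> h'; rewrite (_ : n%:R * e = n%:R * (e / 2) + n%:R * (e / 2)) ?lerD2l//.
  by field.
pose a j := phi (iter j Theta y).
have aB j : 0 <= a j <= B by exact: phiB.
have B0 : 0 <= B by have /andP[] := aB 0%N; exact: le_trans.
near=> n.
have n0 : (0 < n)%N by near: n; exact: nbhs_infty_gt.
have nR : 0 < n%:R :> R by rewrite ltr0n.
have nbig : k%:R * B <= n%:R * e.
  rewrite -ler_pdivrMr//; near: n; exact: nbhs_infty_ger.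
have := bound n; have := sum_window_bound aB k n.
have -> : \sum_(0 <= j < n) a j = S phi n y by [].
have -> : \sum_(0 <= j < n) \sum_(0 <= i < k) a (i + j)%N =
    \sum_(0 <= j < n) S phi k (iter j Theta y).
  by apply: eq_bigr => j _; apply: eq_bigr => i _; rewrite /a iterD.
set A := \sum_(_ <= _ < _) _; set s := S phi n y.
move=> h1 h2.
have h3 : `|k%:R^-1 * A - s| <= k%:R * B.
  rewrite -(ler_pM2l kR) -{1}[k%:R](gtr0_norm kR) -normrM mulrBr mulrA.
  by rewrite divff ?gt_eqF// mul1r.
rewrite -(ler_pM2l nR) -{1}[n%:R](gtr0_norm nR) -normrM mulrBr mulrA.
rewrite divff ?gt_eqF// mul1r.
rewrite (_ : s - n%:R * c = (k%:R^-1 * A - n%:R * c) - (k%:R^-1 * A - s)); last by ring.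
apply: le_trans (ler_normB _ _) _.
rewrite (_ : n%:R * e0' = n%:R * e + n%:R * e); last by rewrite /e; field.
by apply: lerD => //; exact: le_trans nbig.
Unshelve. all: by end_near. Qed.

(** The time averages of the non-negative error phi - phi' are bounded, off a small
    set, by the maximal inequality. *)
Lemma lln_approx (phi : Y -> R) (c : R) :
  (forall e : R, 0 < e -> exists (phi' : Y -> R) (c' : R),
    [/\ lln phi' c', measurable_fun setT (fun y => phi y - phi' y),
        (forall y, phi' y <= phi y),
        (\int[m]_y (phi y - phi' y)%:E <= e%:E)%E & `|c - c'| <= e]) ->
  lln phi c.
Proof.
move=> approx e e0; pose l := e / 3.
have l0 : 0 < l by rewrite divr_gt0.
(* An error of integral l * l has averages below l off a set of measure l. *)
pose dl := Num.min l (l * l).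
have dl0 : 0 < dl by rewrite lt_min l0 mulr_gt0.
have [phi' [c' [lln' mrho rho0 irho cc']]] := approx dl dl0.
have rho_ge0 y : 0 <= phi y - phi' y by rewrite subr_ge0.
have [D1 [mD1 mD1l HD1]] := lln' l l0.
have [D2 [mD2 mD2l HD2]] := maximal_ineq mTheta invTheta mrho rho_ge0 l0.
have mD2l' : (m D2 <= l%:E)%E.
  rewrite -(@lee_pmul2l _ l%:E)//; apply: le_trans mD2l _.
  by apply: le_trans irho _; rewrite -EFinM lee_fin /dl ge_min lexx orbT.
exists (D1 `|` D2); split; first exact: measurableU.
  apply: le_trans (measureU2 _ mD1 mD2) _.
  apply: le_trans (leeD mD1l mD2l') _; rewrite -EFinD lee_fin /l; lra.
move=> y; rewrite /= not_orP => -[yD1 yD2].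
have := HD1 y yD1; apply: filterS2 (nbhs_infty_gt 0) => n n0 h1.
have nR : 0 < n%:R :> R by rewrite ltr0n.
have : n%:R^-1 * S (fun y => phi y - phi' y) n y <= l.
  by rewrite ler_pdivrMl// HD2.
have : 0 <= n%:R^-1 * S (fun y => phi y - phi' y) n y.
  by apply: mulr_ge0; [rewrite invr_ge0 ltW|apply: sumr_ge0].
rewrite (_ : S _ n y = S phi n y - S phi' n y); last by rewrite -sumrB.
have cl : `|c - c'| <= l by apply: le_trans cc' _; rewrite ge_min lexx.
move: h1 cl; rewrite !ler_norml mulrBr => /andP[? ?] /andP[? ?] ? ?.
have el : e = l + l + l by rewrite /l; field.
by rewrite el; apply/andP; split; lra.
Qed.

(** For each threshold e, the points at which the averages are not eventually
    within e of c lie in sets of arbitrarily small measure. *)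
Lemma lln_ae (phi : Y -> R) (c : R) (N : set Y) : measurable N ->
  (forall y, N y -> ~ (n%:R^-1 * S phi n y @[n --> \oo] --> c)) ->
  lln phi c -> m N = 0%E.
Proof.
move=> mN Nnc H.
pose bad e := [set y | ~ \forall n \near \oo, `|n%:R^-1 * S phi n y - c| <= e].
have nbad e : 0 < e -> m.-negligible (bad e).
  move=> e0.
  have K i : 0 < Num.min e i.+1%:R^-1 by rewrite lt_min e0 invr_gt0 ltr0n.
  pose D i := sval (cid (H _ (K i))).
  have [mD mDe HD] : [/\ forall i, measurable (D i),
      forall i, (m (D i) <= (Num.min e i.+1%:R^-1)%:E)%E &
      forall i y, ~ D i y -> \forall n \near \oo, `|n%:R^-1 * S phi n y - c| <= e].
    split=> i; rewrite /D; case: cid => /= A [mA hA HA] //.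
    move=> y Ay; apply: filterS (HA y Ay) => n; move/le_trans; apply.
    by rewrite ge_min lexx.
  exists (\bigcap_i D i); split; first exact: bigcapT_measurable.
    apply/eqP; rewrite eq_le measure_ge0 andbT; apply/lee_addgt0Pr => r r0.
    rewrite add0e; pose i := Num.truncn r^-1.
    apply: (@le_trans _ _ (m (D i))).
      by apply: le_measure; rewrite ?inE//; [exact: bigcapT_measurable|exact: bigcap_inf].
    apply: le_trans (mDe i) _; rewrite lee_fin ge_min; apply/orP; right.
    rewrite -[leRHS]invrK lef_pV2 ?posrE ?invr_gt0// ltW// /i.
    exact: truncnS_gt.
  move=> y by_ i _; apply: contrapT => Diy; apply: by_; exact: HD Diy.
suff : m.-negligible N by move/negligibleP; apply.
apply: (@negligibleS _ _ _ m (\bigcup_i bad i.+1%:R^-1)); last first.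
  by apply: negligible_bigcup => i; apply: nbad; rewrite invr_gt0 ltr0n.
move=> y /Nnc ny; apply: contrapT => nb; apply: ny.
apply/cvgrPdist_le => e e0; pose i := Num.truncn e^-1.
have : ~ bad i.+1%:R^-1 y by move=> hb; apply: nb; exists i.
move=> /contrapT; apply: filterS => n; rewrite distrC => /le_trans; apply.
rewrite -[leRHS]invrK lef_pV2 ?posrE ?invr_gt0 ?ltr0n// ltW//.
exact: truncnS_gt.
Qed.

End law_of_large_numbers.

(** * The law of large numbers for a mixing chain *)

Section markov_lln.
Local Open Scope ereal_scope.
Context (R : realType) dE dT (E : measurableType dE) (T : measurableType dT).
Variables (f : E * T -> E) (mu : probability T R) (Q : probability (seqspace T) R).
Hypothesis mf : measurable_fun setT f.
Hypothesis splitQ : forall F : T * seqspace T -> \bar R,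
  measurable_fun setT F -> (forall x, 0 <= F x) ->
  \int[Q]_v F (v 0%N, shift v) = \int[mu]_x \int[Q]_v F (x, v).
Variable pi : probability E R.
Hypothesis pi_stat : stationary Q mf pi.
Variables (C : set E) (r : nat -> R).
Hypotheses (mC : measurable C) (piC : pi (~` C) = 0).
Hypotheses (r_ge0 : forall j, (0 <= r j)%R) (r_cvg : r @ \oo --> 0%R).
Hypothesis mixing : forall j x A, C x -> measurable A ->
  law Q mf j x A <= pi A + (r j)%:E.

Local Notation S := (seqspace T).
Local Notation m := (pi \x Q)%E.
Local Notation sk := (skew f).

Let mskew : measurable_fun setT sk := measurable_skew mf.
Let invskew := integral_skew splitQ pi_stat.

Let aeC : {ae pi, forall x, C x}.
Proof. by exists (~` C); split => //; exact: measurableC. Qed.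

Section bounded.
Variables (b : E -> R) (B c : R).
Hypotheses (mb : measurable_fun setT b) (b_ge0 : forall x, (0 <= b x)%R).
Hypotheses (b_le : forall x, (b x <= B)%R) (cE : \int[pi]_x (b x)%:E = c%:E).

Let phi (y : E * S) : R := b y.1.
Let Sb := birkhoff_sum sk phi.

Let B_ge0 : (0 <= B)%R.
Proof. exact: le_trans (b_ge0 point) (b_le point). Qed.

Let c_ge0 : (0 <= c)%R.
Proof. by rewrite -lee_fin -cE integral_ge0// => x _; rewrite lee_fin. Qed.

Let mbE : measurable_fun setT (fun x => (b x)%:E).
Proof. exact/measurable_EFinP. Qed.

Let bE0 x : 0 <= (b x)%:E. Proof. by rewrite lee_fin. Qed.

Let mphi : measurable_fun setT phi.
Proof. exact: measurableT_comp mb measurable_fst. Qed.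

Let Sb_ge0 k y : (0 <= Sb k y)%R. Proof. by apply: sumr_ge0 => j _; exact: b_ge0. Qed.

Let mSb k : measurable_fun setT (Sb k).
Proof. exact: measurable_birkhoff_sum. Qed.

Let int_fst (u : E -> \bar R) : measurable_fun setT u -> (forall x, 0 <= u x) ->
  \int[m]_y u y.1 = \int[pi]_x u x.
Proof.
move=> mu' u0.
rewrite (fubini_tonelli1 (u \o fst) (measurableT_comp mu' measurable_fst) (fun y => u0 _)).
by apply: eq_integral => x _; rewrite /fubini_F/= integral_prob_cst.
Qed.

Let int_law_le j x : C x -> \int[law Q mf j x]_y (b y)%:E <= (c + B * r j)%:E.
Proof.
move=> Cx; rewrite EFinD -cE.
by apply: le_integral_almost_dominated => // A mA; exact: mixing.
Qed.

(** Given the state x at time 0, the mean of b after j steps is at most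
    c + B * r j, whatever x in C; multiply by b x and average. *)
Let cross_le j : \int[m]_y (b y.1 * b (orbit f j y))%:E <= (c * (c + B * r j))%:E.
Proof.
have mo := measurable_orbit mf j.
have mF : measurable_fun setT (fun y : E * S => (b y.1 * b (orbit f j y))%:E).
  apply/measurable_EFinP; apply: measurable_funM => //.
  exact: measurableT_comp mb mo.
have K0 : (0 <= c + B * r j)%R by rewrite addr_ge0// mulr_ge0.
rewrite (fubini_tonelli1 _ mF); last by move=> y; rewrite lee_fin mulr_ge0.
apply: (@le_trans _ _ (\int[pi]_x ((c + B * r j)%:E * (b x)%:E))).
  apply: ae_ge0_le_integral => //.
  - by move=> x _; apply: integral_ge0 => v _; rewrite lee_fin mulr_ge0.
  - by apply: measurable_fun_fubini_tonelli_F => // y; rewrite lee_fin mulr_ge0.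
  - by move=> x _; rewrite mule_ge0// lee_fin.
  - by apply: measurable_funeM.
  apply: filterS aeC => x Cx _; rewrite /fubini_F /=.
  under eq_integral do rewrite EFinM.
  rewrite ge0_integralZl//; last first.
    apply/measurable_EFinP; apply: (measurableT_comp mb).
    exact: measurable_orbit_from.
  rewrite muleC lee_wpmul2r//.
  by rewrite -(integral_law _ mf _ _ mbE bE0) int_law_le.
by rewrite ge0_integralZl// ?lee_fin// cE -EFinM mulrC.
Qed.

Let sumr_r k : R := (\sum_(0 <= j < k) r j.+1)%R.

(** Split off the first of k + 1 terms: its square is at most B ^ 2, the cross
    terms are bounded by cross_le, and the square of the sum of the others has the
    same mean as the square of the sum of k terms, by stationarity. *)
Let second_moment k : \int[m]_y (Sb k y ^+ 2)%:E <=
  (k%:R * B ^+ 2 + k%:R ^+ 2 * c ^+ 2 + 2 * c * B * (k%:R * sumr_r k))%:E.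
Proof.
have mSkew n : measurable_fun setT (fun y => Sb n (sk y)).
  exact: measurableT_comp (mSb n) mskew.
elim: k => [|k IH].
  under eq_integral => y _ do rewrite /Sb /birkhoff_sum big_nil expr0n/=.
  by rewrite integral0 lee_fin /sumr_r big_nil !(mul0r, mulr0, expr0n, addr0).
have -> : \int[m]_y (Sb k.+1 y ^+ 2)%:E =
    \int[m]_y ((phi y ^+ 2)%:E + (\sum_(0 <= j < k) (2 * (phi y * b (orbit f j.+1 y))))%R%:E
      + (Sb k (sk y) ^+ 2)%:E).
  apply: eq_integral => y _; rewrite /Sb birkhoff_sumS -!EFinD; congr (_%:E).
  rewrite sqrrD -mulr_sumr -mulr_sumr mulr_natl; congr (_ + _ *+ 2 + _)%R.
  congr (_ * _)%R; apply: eq_bigr => j _; rewrite /phi; congr (b _).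
  by rewrite -orbit_skew.
have mcross j : measurable_fun setT (fun y : E * S => (2 * (phi y * b (orbit f j.+1 y)))%R).
  apply: measurable_funM => //; apply: measurable_funM => //.
  exact: measurableT_comp mb (measurable_orbit mf j.+1).
have cross0 j (y : E * S) : (0 <= 2 * (phi y * b (orbit f j.+1 y)))%R.
  by rewrite mulr_ge0// mulr_ge0// b_ge0.
have m1 : measurable_fun setT (fun y => (phi y ^+ 2)%:E).
  by apply/measurable_EFinP; exact: measurable_funX.
have m2 : measurable_fun setT (fun y : E * S =>
    (\sum_(0 <= j < k) (2 * (phi y * b (orbit f j.+1 y))))%R%:E).
  by apply/measurable_EFinP; exact: measurable_sum.
have m3 : measurable_fun setT (fun y => (Sb k (sk y) ^+ 2)%:E).
  by apply/measurable_EFinP; exact: measurable_funX.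
have n1 y : 0 <= (phi y ^+ 2)%:E by rewrite lee_fin sqr_ge0.
have n2 (y : E * S) : 0 <= (\sum_(0 <= j < k) (2 * (phi y * b (orbit f j.+1 y))))%R%:E.
  by rewrite lee_fin sumr_ge0.
have n3 y : 0 <= (Sb k (sk y) ^+ 2)%:E by rewrite lee_fin sqr_ge0.
rewrite ge0_integralD//; last 2 first.
- by move=> y _; rewrite adde_ge0.
- exact: emeasurable_funD.
rewrite ge0_integralD//.
rewrite (invskew (G := fun y => (Sb k y ^+ 2)%:E)); last 2 first.
- by apply/measurable_EFinP; exact: measurable_funX.
- by move=> y; rewrite lee_fin sqr_ge0.
have b1 : \int[m]_y (phi y ^+ 2)%:E <= (B ^+ 2)%:E.
  rewrite -[leRHS](integral_prob_cst m); apply: ge0_le_integral => //.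
  by move=> y _ /=; rewrite lee_fin lerXn2r ?nnegrE /phi ?b_ge0 ?b_le.
have b2 : \int[m]_y (\sum_(0 <= j < k) (2 * (phi y * b (orbit f j.+1 y))))%R%:E <=
    (2 * (k%:R * c ^+ 2 + c * B * sumr_r k))%:E.
  under eq_integral do rewrite -sumEFin.
  rewrite ge0_integral_sum//; last 2 first.
  - by move=> j; apply/measurable_EFinP; exact: mcross.
  - by move=> j y _; rewrite lee_fin.
  have -> : (2 * (k%:R * c ^+ 2 + c * B * sumr_r k))%:E =
      \sum_(0 <= j < k) (2 * (c * (c + B * r j.+1)))%:E.
    rewrite sumEFin; congr (_%:E); rewrite -mulr_sumr -mulr_sumr big_split /=.
    by rewrite -mulr_sumr sumr_const_nat subn0 -mulr_natl /sumr_r; ring.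
  apply: lee_sum => j _; under eq_integral do rewrite EFinM.
  rewrite ge0_integralZl//; last 2 first.
  - apply/measurable_EFinP; apply: measurable_funM => //.
    exact: measurableT_comp mb (measurable_orbit mf j.+1).
  - by move=> y _; rewrite lee_fin mulr_ge0// b_ge0.
  by rewrite [leRHS]EFinM lee_wpmul2l ?lee_fin// cross_le.
apply: (le_trans (leeD (leeD b1 b2) IH)); rewrite -!EFinD lee_fin.
have r1 : (0 <= r k.+1)%R by [].
have sr0 : (0 <= sumr_r k)%R by apply: sumr_ge0.
have -> : sumr_r k.+1 = (sumr_r k + r k.+1)%R by rewrite /sumr_r big_nat_recr.
rewrite -natr1.
have h1 : (0 <= c * B)%R by rewrite mulr_ge0.
have h2 : (0 <= c * B * ((k%:R + 1) * r k.+1))%R.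
  by rewrite mulr_ge0// mulr_ge0// addr_ge0.
rewrite -subr_ge0.
set x := (X in (0 <= X)%R).
have -> : x = (2 * (c * B * ((k%:R + 1) * r k.+1)) + c ^+ 2)%R by rewrite /x; ring.
by rewrite addr_ge0 ?sqr_ge0// mulr_ge0.
Qed.

Let first_moment k : \int[m]_y (Sb k y)%:E = (k%:R * c)%:E.
Proof.
rewrite /Sb /birkhoff_sum; under eq_integral do rewrite -sumEFin.
have mphiE : measurable_fun setT (fun y => (phi y)%:E) by exact/measurable_EFinP.
rewrite ge0_integral_sum//; last 2 first.
- move=> j; apply/measurable_EFinP; apply: (measurableT_comp mphi).
  exact: measurable_iterT.
- by move=> j y _; rewrite lee_fin b_ge0.
have -> : (k%:R * c)%:E = \sum_(0 <= j < k) c%:E.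
  by rewrite sumEFin sumr_const_nat subn0 mulr_natl.
apply: eq_bigr => j _.
rewrite (integral_iterT mskew invskew j mphiE (fun y => bE0 y.1)).
by rewrite (int_fst mbE bE0).
Qed.

(** The variance of the sum of k terms is at most k B ^ 2 plus a multiple of k times
    r 1 + .. + r k; divided by k ^ 2 it tends to 0, by Cesaro. *)
Lemma mean_square_cvg (e : R) : (0 < e)%R -> exists2 k, (0 < k)%N &
  \int[m]_y ((k%:R^-1 * Sb k y - c) ^+ 2)%:E <= e%:E.
Proof.
move=> e0.
have rS : r j.+1 @[j --> \oo] --> 0%R by rewrite (cvg_shiftS r).
have ces := cesaro rS.
have hlim : (B ^+ 2 / k.+1%:R + 2 * c * B * (sumr_r k.+1 / k.+1%:R))%R @[k --> \oo] --> 0%R.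
  rewrite -[X in _ --> X](_ : (B ^+ 2 * 0 + 2 * c * B * 0 = 0)%R); last by rewrite !mulr0 addr0.
  apply: cvgD; apply: cvgM; try exact: cvg_cst.
    exact: cvg_harmonic.
  by under eq_fun do rewrite mulrC; exact: ces.
have /cvgr0Pnorm_le/(_ _ e0)[K _ /(_ K (leqnn K)) hK] := hlim.
exists K.+1 => //; set k := K.+1 in hK *.
have k0 : (0 < k%:R :> R)%R by rewrite ltr0n.
have mV : measurable_fun setT (fun y => ((Sb k y - k%:R * c) ^+ 2)%:E).
  by apply/measurable_EFinP; apply: measurable_funX; exact: measurable_funB.
have V0 y : 0 <= ((Sb k y - k%:R * c) ^+ 2)%:E by rewrite lee_fin sqr_ge0.
have mS2 : measurable_fun setT (fun y => (Sb k y ^+ 2)%:E).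
  by apply/measurable_EFinP; exact: measurable_funX.
have S20 y : 0 <= (Sb k y ^+ 2)%:E by rewrite lee_fin sqr_ge0.
have mS1 : measurable_fun setT (fun y => (Sb k y)%:E) by exact/measurable_EFinP.
have S10 y : 0 <= (Sb k y)%:E by rewrite lee_fin.
have kc0 : (0 <= 2 * (k%:R * c))%R by rewrite !mulr_ge0.
have varE : \int[m]_y ((Sb k y - k%:R * c) ^+ 2)%:E + (2 * (k%:R * c) * (k%:R * c))%:E =
    \int[m]_y (Sb k y ^+ 2)%:E + ((k%:R * c) ^+ 2)%:E.
  have e1 : (2 * (k%:R * c) * (k%:R * c))%:E =
      \int[m]_y ((2 * (k%:R * c))%:E * (Sb k y)%:E).
    by rewrite ge0_integralZl ?lee_fin// first_moment -EFinM.
  have e2 : ((k%:R * c) ^+ 2)%:E = \int[m]_y cst ((k%:R * c) ^+ 2)%:E y.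
    by rewrite integral_prob_cst.
  rewrite e1 e2 -ge0_integralD//; last 2 first.
  - by move=> y _; rewrite mule_ge0 ?lee_fin.
  - by apply: measurable_funeM.
  rewrite -ge0_integralD//; last by move=> y _; rewrite lee_fin sqr_ge0.
  apply: eq_integral => y _; rewrite -EFinM -!EFinD; congr (_%:E); ring.
have varle : \int[m]_y ((Sb k y - k%:R * c) ^+ 2)%:E <=
    (k%:R * B ^+ 2 + 2 * c * B * (k%:R * sumr_r k))%:E.
  have fK : (2 * (k%:R * c) * (k%:R * c))%:E \is a fin_num by [].
  rewrite -(leeD2rE _ _ fK).
  rewrite varE; apply: le_trans (leeD2r _ (second_moment k)) _.
  by rewrite -!EFinD lee_fin le_eqVlt; apply/orP; left; apply/eqP; ring.
have -> : \int[m]_y ((k%:R^-1 * Sb k y - c) ^+ 2)%:E =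
    (k%:R ^- 2)%:E * \int[m]_y ((Sb k y - k%:R * c) ^+ 2)%:E.
  rewrite -ge0_integralZl ?lee_fin ?invr_ge0 ?sqr_ge0//.
  apply: eq_integral => y _; rewrite -EFinM; congr (_%:E).
  by field; rewrite gt_eqF.
apply: (@le_trans _ _ ((k%:R ^- 2)%:E * (k%:R * B ^+ 2 + 2 * c * B * (k%:R * sumr_r k))%:E)).
  by rewrite lee_wpmul2l// lee_fin invr_ge0 sqr_ge0.
rewrite -EFinM lee_fin; apply: le_trans hK; apply: le_trans (ler_norm _).
rewrite le_eqVlt; apply/orP; left; apply/eqP.
by field; rewrite gt_eqF.
Qed.

Lemma lln_bounded : lln m sk phi c.
Proof.
apply: (@lln_of_mean _ _ _ m sk mskew invskew phi B c) => //.
  by move=> y; rewrite b_ge0 b_le.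
exact: mean_square_cvg.
Qed.

End bounded.

End markov_lln.

Lemma measurable_cvg_set d (Y : measurableType d) (R : realType)
    (a : nat -> Y -> R) (c : R) : (forall n, measurable_fun setT (a n)) ->
  measurable [set y | a n y @[n --> \oo] --> c].
Proof.
move=> ma.
have -> : [set y | a n y @[n --> \oo] --> c] =
    \bigcap_i \bigcup_N \bigcap_(n in [set n | (N <= n)%N])
      [set y | `|a n y - c| <= i.+1%:R^-1].
  apply/seteqP; split => y /=.
    move=> /cvgrPdist_le ac i _.
    have [N _ HN] := ac i.+1%:R^-1 ltac:(by rewrite invr_gt0 ltr0n).
    by exists N => // n /= Nn; rewrite distrC; exact: HN.
  move=> H; apply/cvgrPdist_le => e e0.
  have [N _ HN] := H (Num.truncn e^-1) I.
  exists N => // n /= Nn; rewrite distrC; apply: le_trans (HN n Nn) _.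
  by rewrite invf_ple ?posrE ?ltr0n// ltW// truncnS_gt.
apply: bigcapT_measurable => i; apply: bigcupT_measurable => N.
apply: bigcap_measurableType => n _.
have h : measurable_fun setT (fun y => `|a n y - c|).
  by apply: measurableT_comp => //; exact: measurable_funB.
have := measurable_fun_ler h (measurable_cst (i.+1%:R^-1 : R)).
by move=> /(_ measurableT [set true] I); rewrite setTI.
Qed.

Section markov_lln_integrable.
Local Open Scope ereal_scope.
Context (R : realType) dE dT (E : measurableType dE) (T : measurableType dT).
Variables (f : E * T -> E) (mu : probability T R) (Q : probability (seqspace T) R).
Hypothesis mf : measurable_fun setT f.
Hypothesis splitQ : forall F : T * seqspace T -> \bar R,
  measurable_fun setT F -> (forall x, 0 <= F x) ->
  \int[Q]_v F (v 0%N, shift v) = \int[mu]_x \int[Q]_v F (x, v).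
Variable pi : probability E R.
Hypothesis pi_stat : stationary Q mf pi.
Variables (C : set E) (r : nat -> R).
Hypotheses (mC : measurable C) (piC : pi (~` C) = 0).
Hypotheses (r_ge0 : forall j, (0 <= r j)%R) (r_cvg : r @ \oo --> 0%R).
Hypothesis mixing : forall j x A, C x -> measurable A ->
  law Q mf j x A <= pi A + (r j)%:E.

Local Notation S := (seqspace T).
Local Notation m := (pi \x Q)%E.
Local Notation sk := (skew f).

Let mskew : measurable_fun setT sk := measurable_skew mf.
Let invskew := integral_skew splitQ pi_stat.

(** Truncate h at a large integer, so that the bounded case applies and the error
    has a small integral. *)
Lemma lln_nonneg (h : E -> R) (c : R) : measurable_fun setT h ->
  (forall x, (0 <= h x)%R) -> \int[pi]_x (h x)%:E = c%:E ->
  lln m sk (h \o fst) c.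
Proof.
move=> mh h0 hc.
apply: (@lln_approx _ _ _ m sk mskew invskew) => e e0.
pose hn n x : R := Num.min (h x) n%:R.
have mhn n : measurable_fun setT (hn n) by exact: measurable_minr.
have hn0 n x : (0 <= hn n x)%R by rewrite le_min h0 ler0n.
have hnh n x : (hn n x <= h x)%R by rewrite ge_min lexx.
have hnB n x : (hn n x <= n%:R)%R by rewrite ge_min lexx orbT.
have mhnE n : measurable_fun setT (fun x => (hn n x)%:E) by exact/measurable_EFinP.
have mhE : measurable_fun setT (fun x => (h x)%:E) by exact/measurable_EFinP.
have hnE0 n x : 0 <= (hn n x)%:E by rewrite lee_fin.
have hE0 x : 0 <= (h x)%:E by rewrite lee_fin.
have cv : \int[pi]_x (hn n x)%:E @[n --> \oo] --> \int[pi]_x (h x)%:E.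
  have -> : \int[pi]_x (h x)%:E = \int[pi]_x limn (fun n => (hn n x)%:E).
    apply: eq_integral => x _; apply/esym/cvg_lim => //.
    apply: cvg_near_cst; exists (Num.truncn (h x)).+1 => // n /= hn_.
    congr (_%:E); rewrite /hn min_l//; apply: ltW.
    by apply: lt_le_trans (truncnS_gt _) _; rewrite ler_nat.
  apply: cvg_monotone_convergence => //.
  move=> x _ n k nk; rewrite lee_fin le_min ge_min lexx/=.
  by rewrite ge_min ler_nat nk orbT.
pose cn n := fine (\int[pi]_x (hn n x)%:E).
have cnE n : \int[pi]_x (hn n x)%:E = (cn n)%:E.
  rewrite fineK// ge0_fin_numE; last by apply: integral_ge0 => x _; rewrite lee_fin.
  apply: (@le_lt_trans _ _ (\int[pi]_x (h x)%:E)); last by rewrite hc ltry.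
  by apply: ge0_le_integral => // x _; rewrite lee_fin.
rewrite hc in cv; have cv2 : cn n @[n --> \oo] --> c by exact: (fine_cvg cv).
have /cvgrPdist_le/(_ e e0)[n _ Hn] := cv2.
have ccn : (`|c - cn n| <= e)%R := Hn n (leqnn n).
have mrho : measurable_fun setT (fun x => (h x - hn n x)%R) by exact: measurable_funB.
have rho0 x : (0 <= h x - hn n x)%R by rewrite subr_ge0.
have mrhoE : measurable_fun setT (fun x => (h x - hn n x)%:E) by exact/measurable_EFinP.
have rhoE0 x : 0 <= (h x - hn n x)%:E by rewrite lee_fin.
have irho : \int[pi]_x (h x - hn n x)%:E = (c - cn n)%:E.
  apply/eqP; rewrite EFinB eq_sym sube_eq//; last by rewrite fin_num_adde_defl.
  rewrite -cnE -ge0_integralD// -hc; apply/eqP; apply: eq_integral => x _.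
  by rewrite -EFinD subrK.
exists (hn n \o fst), (cn n); split => //.
- apply: (lln_bounded splitQ pi_stat mC piC r_ge0 r_cvg mixing (B := n%:R)) => //.
- exact: (measurableT_comp mrho measurable_fst).
- by move=> y; exact: hnh.
rewrite (fubini_tonelli1 (fun y : E * S => (h y.1 - hn n y.1)%:E)); last 2 first.
- apply/measurable_EFinP; exact: (measurableT_comp mrho measurable_fst).
- by move=> y; rewrite lee_fin.
rewrite /fubini_F /=; under eq_integral do rewrite integral_prob_cst.
rewrite irho lee_fin; exact: le_trans (ler_norm _) ccn.
Qed.

Definition diverging (h : E -> R) (c : R) : set (E * S) :=
  ~` [set y | (n%:R^-1 * birkhoff_sum sk (h \o fst) n y)%R @[n --> \oo] --> c].

Lemma measurable_diverging h c : measurable_fun setT h -> measurable (diverging h c).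
Proof.
move=> mh; apply: measurableC; apply: measurable_cvg_set => n.
apply: measurable_funM => //; apply: measurable_birkhoff_sum => //.
exact: (measurableT_comp mh measurable_fst).
Qed.

(** Dropping the first term of a trajectory changes its n-th average by O(1/n). *)
Lemma diverging_skew h c y : diverging h c y -> diverging h c (sk y).
Proof.
move=> ydiv; apply: contra_not ydiv => /= cv.
rewrite -cvg_shiftS.
have -> : [sequence (n.+1%:R^-1 * birkhoff_sum sk (h \o fst) n.+1 y)%R]_n =
  (fun n => n.+1%:R^-1 * h y.1 + (1 - n.+1%:R^-1) *
     (n%:R^-1 * birkhoff_sum sk (h \o fst) n (sk y)))%R.
  apply/funext => n; rewrite /= birkhoff_sumS /= mulrDr; congr (_ + _)%R.
  have [->|n0] := posnP n; first by rewrite /birkhoff_sum big_nil !mulr0.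
  by field; rewrite nat1r !pnatr_eq0 -lt0n n0.
have h1 : (n.+1%:R^-1 : R)%R @[n --> \oo] --> (0%R : R) by exact: cvg_harmonic.
have h2 : (1 - n.+1%:R^-1 : R)%R @[n --> \oo] --> (1 - 0 : R)%R.
  by apply: cvgB => //; exact: cvg_cst.
have := cvgD (cvgM h1 (cvg_cst (h y.1))) (cvgM h2 cv).
rewrite mul0r subr0 mul1r add0r => H; exact: H.
Qed.

Lemma diverging_ae (h : E -> R) : pi.-integrable setT (EFin \o h) ->
  m (diverging h (\int[pi]_x h x)%R) = 0.
Proof.
move=> ih; have mh : measurable_fun setT h.
  by apply/measurable_EFinP; exact: measurable_int ih.
pose hp := (h^\+)%R; pose hm := (h^\-)%R.
have hE x : h x = (hp x - hm x)%R by rewrite -{1}(funrposBneg h).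
have mhp : measurable_fun setT hp by exact: measurable_funrpos.
have mhm : measurable_fun setT hm by exact: measurable_funrneg.
have hp0 x : (0 <= hp x)%R by exact: funrpos_ge0.
have hm0 x : (0 <= hm x)%R by exact: funrneg_ge0.
have ihp : pi.-integrable setT (EFin \o hp) by exact: integrable_funrpos.
have ihm : pi.-integrable setT (EFin \o hm) by exact: integrable_funrneg.
pose cp := fine (\int[pi]_x (hp x)%:E); pose cm := fine (\int[pi]_x (hm x)%:E).
have cpE : \int[pi]_x (hp x)%:E = cp%:E by rewrite fineK// integrable_fin_num.
have cmE : \int[pi]_x (hm x)%:E = cm%:E by rewrite fineK// integrable_fin_num.
have cE : (\int[pi]_x h x)%R = (cp - cm)%R.
  rewrite /Rintegral /cp /cm -fineB ?integrable_fin_num// -integralB_EFin//.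
  congr fine; apply: eq_integral => x _; by rewrite -EFinB hE.
have hpz : m (diverging hp cp) = 0.
  apply: (lln_ae (phi := hp \o fst) (c := cp) (Theta := sk)) => //.
  - exact: measurable_diverging.
  - exact: lln_nonneg.
have hmz : m (diverging hm cm) = 0.
  apply: (lln_ae (phi := hm \o fst) (c := cm) (Theta := sk)) => //.
  - exact: measurable_diverging.
  - exact: lln_nonneg.
rewrite cE.
apply: (@subset_measure0 _ _ _ _ _ (diverging hp cp `|` diverging hm cm)).
- exact: measurable_diverging.
- by apply: measurableU; exact: measurable_diverging.
- move=> y; apply: contra_notP; rewrite /= not_orP => -[/contrapT yp /contrapT ym].
  have -> : (fun n => n%:R^-1 * birkhoff_sum sk (h \o fst) n y)%R =
     (fun n => n%:R^-1 * birkhoff_sum sk (hp \o fst) n y -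
               n%:R^-1 * birkhoff_sum sk (hm \o fst) n y)%R.
    apply/funext => n; rewrite -mulrBr -sumrB; congr (_ * _)%R.
    by apply: eq_bigr => j _; rewrite /= hE.
  exact: cvgB.
- apply/eqP; rewrite eq_le measure_ge0 andbT.
  have := measureU2 m (measurable_diverging cp mhp) (measurable_diverging cm mhm).
  by move/le_trans; apply; rewrite -[leRHS]adde0; apply: leeD; [move/eqP : hpz|move/eqP : hmz];
    rewrite eq_le => /andP[].
Qed.

Hypothesis pi_limit : forall x (e : R), (0 < e)%R -> exists k, forall A,
  measurable A -> law Q mf k x A <= pi A + e%:E.

(** At a large time the chain started at x is nearly stationary, and a future in
    B stays in B under the shift; hence Q of the section of B at x is at most
    the mean of the sections over a law close to pi, where almost all of them
    are null. *)
Lemma null_everywhere (B : set (E * S)) : measurable B ->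
  (forall y, B y -> B (sk y)) -> m B = 0 ->
  forall x, Q [set v | B (x, v)] = 0.
Proof.
move=> mB invB mB0 x.
have m1B : measurable_fun setT (fun y => (\1_B y)%:E : \bar R).
  by apply/measurable_EFinP; exact: measurable_indic.
have B0 y : 0 <= (\1_B y)%:E :> \bar R by rewrite lee_fin.
pose u z := \int[Q]_v (\1_B (z, v))%:E.
have mB_ z : measurable [set v | B (z, v)].
  have := pair1_measurable z measurableT mB; rewrite setTI.
  by [].
have uE z : u z = Q [set v | B (z, v)].
  rewrite /u -[in RHS](setIT [set v | B (z, v)]) -integral_indic//.
have u0 z : 0 <= u z by exact: integral_ge0.
have u1 z : u z <= 1 by rewrite uE; exact: probability_le1.
have mu' : measurable_fun setT u by exact: (measurable_integralQ Q m1B B0).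
have piu0 : \int[pi]_z u z = 0.
  rewrite -[LHS](fubini_tonelli1 (fun y => (\1_B y)%:E) m1B B0) integral_indic//.
  by rewrite setIT.
pose A := [set z | u z != 0].
have mA : measurable A.
  rewrite (_ : A = ~` (u @^-1` [set 0])).
    by apply: measurableC; rewrite -[X in measurable X]setTI; exact: mu'.
  by apply/seteqP; split => z /= /eqP.
have piA : pi A = 0.
  have : ae_eq pi setT u (cst 0).
    apply/ae_eq_integral_abs => //; rewrite -[RHS]piu0.
    by apply: eq_integral => z _; rewrite gee0_abs.
  move=> uae; apply/(negligibleP _ mA); apply: negligibleS uae => z /= uz.
  by move=> /(_ I) uz0; move: uz; rewrite /A /= uz0 eqxx.
apply/eqP; rewrite eq_le measure_ge0 andbT; apply/lee_addgt0Pr => e e0.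
rewrite add0e; have [k hk] := pi_limit x e0.
apply: (@le_trans _ _ (\int[law Q mf k x]_z u z)).
  rewrite -(markov_property mf splitQ k x m1B B0) -uE; apply: ge0_le_integral => //.
  - exact: measurableT_comp m1B (pair1_measurable x).
  - exact: measurableT_comp (measurableT_comp m1B (measurable_iter_skew mf k)) (pair1_measurable x).
  move=> v _; rewrite lee_fin !indicE ler_nat.
  have [|//] := boolP ((x, v) \in B); rewrite inE => Bxv.
  have : B (iter k sk (x, v)) by elim: k {hk} => //= k; exact: invB.
  by move/mem_set => ->.
apply: (@le_trans _ _ (\int[law Q mf k x]_z (\1_A z)%:E)).
  apply: ge0_le_integral => //.
    by apply/measurable_EFinP; exact: measurable_indic.
  move=> z _; rewrite indicE; have [zA|] := boolP (z \in A); first exact: u1.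
  by rewrite notin_setE /A /= => /negP; rewrite negbK => /eqP ->.
rewrite integral_indic// setIT; apply: le_trans (hk A mA) _.
by rewrite piA add0e.
Qed.

(** The averages are taken over the states at times 1, 2, .., hence the skew map
    in the statement. They converge almost surely for the stationary chain; the
    set where they do not is null for every initial state by null_everywhere. *)
Theorem markov_law_of_large_numbers (h : E -> R) x :
  pi.-integrable setT (EFin \o h) ->
  Q [set v | diverging h (\int[pi]_x h x)%R (sk (x, v))] = 0.
Proof.
move=> ih; have mh : measurable_fun setT h.
  by apply/measurable_EFinP; exact: measurable_int ih.
have mD := measurable_diverging (\int[pi]_x h x)%R mh.
apply: (null_everywhere (B := sk @^-1` diverging h (\int[pi]_x h x)%R)).
- by rewrite -[X in measurable X]setTI; exact: mskew.
- by move=> y; exact: diverging_skew.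
set B := diverging h _ in mD *.
have m1B : measurable_fun setT (fun y => (\1_B y)%:E : \bar R).
  by apply/measurable_EFinP; exact: measurable_indic.
have B0 y : 0 <= (\1_B y)%:E :> \bar R by rewrite lee_fin.
rewrite -[RHS](diverging_ae ih) -/B -[LHS]integral_indicT; last first.
  by rewrite -[X in measurable X]setTI; exact: mskew.
by rewrite -[RHS]integral_indicT// -(invskew m1B B0).
Qed.

End markov_lln_integrable.

(** * Borel sets of column vectors and of the state space *)

Section borel_generalities.

Lemma measurable_open (T : ptopologicalType) (U : set T) :
  open U -> measurable (U : set (borel T)).
Proof. by move=> oU; apply: sub_sigma_algebra. Qed.

Lemma measurable_closed (T : ptopologicalType) (U : set T) :
  closed U -> measurable (U : set (borel T)).
Proof. by move=> cU; rewrite -[U]setCK; apply: measurableC; apply: measurable_open; exact: closed_openC. Qed.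

Lemma measurable_into_borel d (Y : measurableType d) (T : ptopologicalType)
    (h : Y -> borel T) :
  (forall U : set T, open U -> measurable (h @^-1` U)) -> measurable_fun setT h.
Proof.
move=> H; apply: (@measurability _ _ Y (borel T) setT h (@open T)) => //.
by move=> _ [U oU <-]; rewrite setTI; exact: H.
Qed.

Lemma continuous_borel (T1 T2 : ptopologicalType) (h : T1 -> T2) :
  continuous h -> measurable_fun [set: borel T1] (h : borel T1 -> borel T2).
Proof.
move=> /continuousP ch; apply: (@measurable_into_borel _ (borel T1)) => U oU.
by apply: measurable_open; exact: ch.
Qed.

Lemma continuous_borel_real (R : realType) (T1 : ptopologicalType) (h : T1 -> R) :
  continuous h -> measurable_fun [set: borel T1] (h : borel T1 -> R).
Proof.
move=> /continuousP ch; apply: (measurability _ (RGenOInfty.measurableE R)).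
move=> _ [_ [x ->] <-]; rewrite setTI; apply: measurable_open; apply: ch.
exact: rray_open.
Qed.

End borel_generalities.

Section borel_column_vectors.
Variables (R : realType) (n : nat).
Implicit Types (v u : 'cV[R]_n).

Lemma ball_colP v e u : 0 < e ->
  ball v e u <-> forall i, `|v i ord0 - u i ord0| < e.
Proof.
move=> e0; split => [[_ h] i|h]; first exact: h.
by split => // i j; rewrite ord1; exact: h.
Qed.

Lemma coord_continuous_col i : continuous (fun v : 'cV[R]_n => v i ord0).
Proof. exact: coord_continuous. Qed.

Lemma measurable_coord_col i :
  measurable_fun setT (fun v : borel 'cV[R]_n => (v : 'cV[R]_n) i ord0).
Proof. exact: continuous_borel_real (@coord_continuous_col i). Qed.

(** Open sets of R^n are countable unions of rational boxes, so that
    measurability can be checked coordinatewise. *)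
Lemma measurable_into_col d (Y : measurableType d) (h : Y -> borel 'cV[R]_n) :
  (forall i, measurable_fun setT (fun y => (h y : 'cV[R]_n) i ord0)) ->
  measurable_fun setT h.
Proof.
move=> mh; apply: measurable_into_borel => U oU.
pose box (qk : 'cV[rat]_n * nat) : set 'cV[R]_n :=
  [set v | forall i, `|ratr (qk.1 i ord0) - v i ord0| < qk.2.+1%:R^-1].
pose F qk : set Y := if `[< box qk `<=` U >] then h @^-1` box qk else set0.
have -> : h @^-1` U = \bigcup_qk F qk.
  apply/seteqP; split => [y /= Uhy|y [qk _]]; last first.
    by rewrite /F; case: asboolP => // qkU /qkU.
  have : nbhs (h y : 'cV[R]_n) U by exact: open_nbhs_nbhs.
  rewrite -nbhs_ballE => -[e /= e0 heU].
  pose k := Num.truncn (e / 2)^-1.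
  have ke : k.+1%:R^-1 < e / 2.
    by rewrite invf_plt ?posrE ?ltr0n ?divr_gt0// truncnS_gt.
  have k0 : 0 < k.+1%:R^-1 :> R by rewrite invr_gt0 ltr0n.
  have qP i : exists q : rat, `|ratr q - (h y : 'cV[R]_n) i ord0| < k.+1%:R^-1.
    have [q] := @rat_in_itvoo R ((h y : 'cV[R]_n) i ord0 - k.+1%:R^-1)
      ((h y : 'cV[R]_n) i ord0 + k.+1%:R^-1) ltac:(by rewrite ltrBlDr -addrA ltrDl addr_gt0).
    by rewrite in_itv/= => /andP[q1 q2]; exists q; rewrite ltr_distl q1 q2.
  pose q : 'cV[rat]_n := \col_i sval (cid (qP i)).
  have qE i : `|ratr (q i ord0) - (h y : 'cV[R]_n) i ord0| < k.+1%:R^-1.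
    by rewrite mxE; case: cid.
  exists (q, k) => //; rewrite /F asboolT//= => v qv; apply: heU.
  apply/ball_colP => // i.
  have := qv i; have := qE i; rewrite /= => h1 h2.
  rewrite (_ : _ - _ = (ratr (q i ord0) - v i ord0) - (ratr (q i ord0) - (h y : 'cV[R]_n) i ord0)); last by ring.
  apply: le_lt_trans (ler_normB _ _) _; rewrite [e]splitr.
  by apply: ltrD; [exact: lt_trans h2 ke|exact: lt_trans h1 ke].
apply: countable_bigcupT_measurable; first exact: countableP.
move=> qk; rewrite /F; case: asboolP => // _.
have -> : h @^-1` box qk = \bigcap_(i in [set: 'I_n])
    [set y | `|ratr (qk.1 i ord0) - (h y : 'cV[R]_n) i ord0| < qk.2.+1%:R^-1].
  by apply/seteqP; split => y /= H i; [move=> _; exact: H|exact: (H i I)].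
apply: fin_bigcap_measurable => [|i _]; first exact: finite_finset.
have m1 : measurable_fun setT (fun y => `|ratr (qk.1 i ord0) - (h y : 'cV[R]_n) i ord0|).
  by apply: measurableT_comp => //; exact: measurable_funB.
have := measurable_fun_ltr m1 (measurable_cst (qk.2.+1%:R^-1 : R)).
by move=> /(_ measurableT [set true] I); rewrite setTI.
Qed.

Lemma measurable_addl_col u :
  measurable_fun setT (fun v : borel 'cV[R]_n => (v : 'cV[R]_n) + u : borel 'cV[R]_n).
Proof.
apply: (@measurable_into_col _ (borel 'cV[R]_n)) => i.
under eq_fun do rewrite mxE.
by apply: measurable_funD => //; exact: measurable_coord_col.
Qed.

End borel_column_vectors.

Section borel_mulmx.
Variables (R : realType) (n k : nat) (M : 'M[R]_(n, k)).

Lemma measurable_mulmx d (Y : measurableType d) (h : Y -> borel 'cV[R]_k) i :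
  measurable_fun setT h ->
  measurable_fun setT (fun y => (M *m (h y : 'cV[R]_k)) i ord0).
Proof.
move=> mh; under eq_fun do rewrite mxE.
apply: measurable_sum => j; apply: measurable_funM => //.
exact: (measurableT_comp (measurable_coord_col j) mh).
Qed.

End borel_mulmx.

Section borel_state.
Variables (R : realType) (n : nat) (X : set 'cV[R]_n) (X0 : X 0).
Local Notation E := (borel (state X0)).

Lemma point_of_in (x : state X0) : X (point_of x).
Proof. by case: x => v Xv /=; exact: set_mem. Qed.

Lemma point_of_continuous : continuous (point_of : state X0 -> 'cV[R]_n).
Proof. exact: initial_continuous. Qed.

Lemma open_stateP (U : set (state X0)) : open U ->
  exists2 W : set 'cV[R]_n, open W & U = point_of @^-1` W.
Proof. by move=> [W oW <-]; exists W. Qed.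

Lemma measurable_point_of : measurable_fun [set: E] (point_of : E -> borel 'cV[R]_n).
Proof. exact: continuous_borel point_of_continuous. Qed.

Lemma measurable_into_state d (Y : measurableType d) (h : Y -> E) :
  measurable_fun setT ((fun y => point_of (h y : state X0)) : Y -> borel 'cV[R]_n) ->
  measurable_fun setT h.
Proof.
move=> mh; apply: measurable_into_borel => U /open_stateP[W oW ->].
rewrite -[X in measurable X]setTI; apply: mh => //.
exact: measurable_open.
Qed.

(** Borel sets of a subspace are traces of Borel sets, even if the subspace is not
    itself Borel. *)
Lemma measurable_state_trace (A : set E) : measurable A ->
  exists2 B : set (borel 'cV[R]_n), measurable B & A = point_of @^-1` B.
Proof.
move=> mA.
have : preimage_set_system setT (point_of : E -> 'cV[R]_n)
    ((@open 'cV[R]_n).-sigma.-measurable) A.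
  rewrite -g_sigma_preimageE; apply: sub_sigma_algebra2 mA.
  by move=> U /open_stateP[W oW ->]; exists W => //; rewrite setTI.
by move=> [B mB <-]; exists B => //; rewrite setTI.
Qed.

End borel_state.

(** * Lebesgue measure in dimension n as a translation-invariant measure *)

Section translation_R.
Local Open Scope ereal_scope.
Context (R : realType).

Lemma lebesgue_measure_shift (s : R) (A : set R) : measurable A ->
  lebesgue_measure [set t | A (t + s)%R] = lebesgue_measure A :> \bar R.
Proof.
move=> mA.
have ms : measurable_fun setT ((fun t => t + s)%R : measurableTypeR R -> measurableTypeR R).
  exact: measurable_funD.
pose m0 : {measure set (measurableTypeR R) -> \bar R} :=
  pushforward (@lebesgue_measure R) (fun t : measurableTypeR R => (t + s)%R : measurableTypeR R).
apply/esym/(@lebesgue_measure_unique R (m0 ms)) => // _ [[a b]] _ <-.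
rewrite /m0 /= /pushforward.
rewrite (_ : _ @^-1` _ = `](a - s)%R, (b - s)%R]%classic); last first.
  by apply/seteqP; split => t /=; rewrite !in_itv/= ltrBlDr lerBrDr.
rewrite !lebesgue_measure_itv/= !lte_fin ltrD2r.
by case: ifPn => // _; rewrite -!EFinB; congr (_%:E); ring.
Qed.

Lemma integral_shift (s : R) (u : R -> \bar R) :
  measurable_fun setT u -> (forall t, 0 <= u t) ->
  \int[lebesgue_measure]_t u (t + s)%R = \int[lebesgue_measure]_t u t.
Proof.
move=> mu u0.
have ms : measurable_fun setT ((fun t => t + s)%R : measurableTypeR R -> measurableTypeR R).
  exact: measurable_funD.
rewrite -[LHS](ge0_integral_pushforward ms (@lebesgue_measure R) measurableT mu)//.
by apply: eq_measure_integral => A mA _; exact: lebesgue_measure_shift.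
Qed.

End translation_R.

Definition box (R : realType) n (M : R) : set 'cV[R]_n :=
  [set v | forall i, `|v i ord0| <= M].

Lemma measurable_box (R : realType) n (M : R) :
  measurable (box M : set (borel 'cV[R]_n)).
Proof.
rewrite (_ : box M = \bigcap_(i in [set: 'I_n]) [set v | `|v i ord0| <= M]).
  apply: fin_bigcap_measurable => [|i _]; first exact: finite_finset.
  have h : measurable_fun setT (fun v : borel 'cV[R]_n => `|(v : 'cV[R]_n) i ord0|).
    by apply: measurableT_comp => //; exact: measurable_coord_col.
  have := measurable_fun_ler h (measurable_cst (M : R)).
  by move=> /(_ measurableT [set true] I); rewrite setTI.
by apply/seteqP; split => v /= H i; [move=> _; exact: H|exact: (H i I)].
Qed.

Lemma bigcup_box (R : realType) n : \bigcup_k box k%:R = [set: 'cV[R]_n].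
Proof.
apply/seteqP; split => // v _; exists (Num.truncn (\sum_i `|v i ord0|)).+1 => //= i.
apply: ltW; apply: le_lt_trans (truncnS_gt _).
by rewrite (bigD1 i)//= lerDl sumr_ge0.
Qed.

(** What the rest of the proof uses of Lebesgue measure; the equation only on
    measurable sets, since the iterated integral is no measure on all sets. *)
Definition is_lebesgueN (R : realType) n (mu : set (borel 'cV[R]_n) -> \bar R) :=
  [/\ forall A : set (borel 'cV[R]_n), measurable A -> lebesgueN A = mu A,
      forall M : R, (mu (box M) < +oo)%E &
      forall (u : 'cV[R]_n) (A : set (borel 'cV[R]_n)), measurable A ->
        mu [set v | A ((v : 'cV[R]_n) + u)] = mu A].

Section lebesgueN_step.
Local Open Scope ereal_scope.
Context (R : realType) (n : nat).
Variable mu : {sigma_finite_measure set (borel 'cV[R]_n) -> \bar R}.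
Hypothesis muP : is_lebesgueN mu.

Definition col_cons (x : measurableTypeR R * borel 'cV[R]_n) : borel 'cV[R]_n.+1 :=
  col_mx (const_mx x.1 : 'cV[R]_1) (x.2 : 'cV[R]_n).

Lemma measurable_col_cons : measurable_fun setT col_cons.
Proof.
apply: measurable_into_col => i; rewrite /col_cons.
under eq_fun do rewrite mxE.
case: (@fintype.split 1 n i) => j.
  by under eq_fun do rewrite mxE; exact: measurable_fst.
exact: measurableT_comp (measurable_coord_col j) measurable_snd.
Qed.

Lemma col_consD (t s : R) (v u : 'cV[R]_n) :
  ((col_cons (t, v) : 'cV[R]_n.+1) + col_cons (s, u))%R = col_cons ((t + s)%R, (v + u)%R).
Proof.
have := add_col_mx (const_mx t : 'cV[R]_1) v (const_mx s) u.
rewrite (_ : const_mx t + const_mx s = const_mx (t + s))%R; first exact.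
by apply/matrixP => i j; rewrite !mxE.
Qed.

Lemma col_cons_surj (u : 'cV[R]_n.+1) : exists s (u' : 'cV[R]_n), u = col_cons (s, u').
Proof.
pose u1 : 'cV[R]_(1 + n) := u.
exists (usubmx u1 ord0 ord0), (dsubmx u1).
have E : const_mx (usubmx u1 ord0 ord0) = usubmx u1.
  by apply/matrixP => i j; rewrite mxE !ord1.
have := vsubmxK u1; rewrite -{1}E => H; exact: (esym H).
Qed.

(** The image under col_cons of the product of the Lebesgue measure on the line
    with mu has these properties: a translation acts separately on the first
    coordinate and on the others. *)
Lemma is_lebesgueN_step : exists mu' : {sigma_finite_measure set (borel 'cV[R]_n.+1) -> \bar R},
  is_lebesgueN mu'.
Proof.
have [muE mufin mutr] := muP.
pose pm : {measure set (measurableTypeR R * borel 'cV[R]_n) -> \bar R} :=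
  (@lebesgue_measure R \x mu)%E.
pose m0 : {measure set (borel 'cV[R]_n.+1) -> \bar R} := pushforward pm col_cons.
pose m1 := m0 measurable_col_cons.
have m1fin M : m1 (box M) < +oo.
  have : m1 (box M) <= pm (`[(- M)%R, M]%classic `*` box M).
    apply: (le_measure pm); rewrite ?inE.
    - by rewrite -[X in measurable X]setTI; apply: measurable_col_cons => //; exact: measurable_box.
    - by apply: measurableX; [exact: measurable_itv|exact: measurable_box].
    move=> [t v] /= tvM; split.
      have : (`|(col_mx (const_mx t : 'cV[R]_1) v) (lshift n ord0) ord0| <= M)%R := tvM _.
      by rewrite col_mxEu mxE ler_norml in_itv.
    move=> i.
    have : (`|(col_mx (const_mx t : 'cV[R]_1) v) (rshift 1 i) ord0| <= M)%R := tvM _.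
    by rewrite col_mxEd.
  have -> : pm (`[(- M)%R, M]%classic `*` box M) =
      lebesgue_measure (`[(- M)%R, M]%classic : set R) * mu (box M).
    by apply: product_measure1E; [exact: measurable_itv|exact: measurable_box].
  move/le_lt_trans; apply.
  rewrite lte_mul_pinfty ?mufin//.
  by rewrite ge0_fin_numE// lebesgue_measure_itv/=; case: ifP => _; rewrite -?EFinB ltry.
have sf : sigma_finite setT m1.
  exists (fun k => box k%:R); first by rewrite bigcup_box.
  by move=> k; split; [exact: measurable_box|exact: m1fin].
pose sfm := Measure_isSigmaFinite.Build _ _ _ m1 sf.
pose m2 : {sigma_finite_measure set (borel 'cV[R]_n.+1) -> \bar R} := HB.pack (Measure.sort m1) (Measure.class m1) sfm.
exists m2; split.
- move=> A mA.
  have mA' : measurable (col_cons @^-1` A).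
    by rewrite -[X in measurable X]setTI; exact: measurable_col_cons.
  change (lebesgueN A = \int[lebesgue_measure]_t mu (xsection (col_cons @^-1` A) t)).
  rewrite /=; apply: eq_integral => t _.
  rewrite -muE; last exact: measurable_xsection.
  by congr lebesgueN; apply/seteqP; split => v; rewrite /xsection/= inE.
- exact: m1fin.
move=> u A mA.
have [s [u' ->]] := col_cons_surj u.
have mA' : measurable (col_cons @^-1` A).
  by rewrite -[X in measurable X]setTI; exact: measurable_col_cons.
pose phi (t : measurableTypeR R) := mu (xsection (col_cons @^-1` A) t).
change (\int[lebesgue_measure]_t mu (xsection (col_cons @^-1`
    [set v | A ((v : 'cV[R]_n.+1) + col_cons (s, u'))%R]) t) =
  \int[lebesgue_measure]_t phi t).
rewrite -(integral_shift s (u := phi)); last 2 first.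
- exact: (measurable_fun_xsection mu mA').
- by move=> t; exact: measure_ge0.
apply: eq_integral => t _; rewrite /phi -[RHS](mutr u' _ (measurable_xsection (t + s)%R mA')).
congr (mu _); apply/seteqP.
by split => v; rewrite /xsection /= !inE /= col_consD.
Qed.

End lebesgueN_step.

Lemma lebesgueN_is_measure (R : realType) n :
  exists mu : {sigma_finite_measure set (borel 'cV[R]_n) -> \bar R}, is_lebesgueN mu.
Proof.
elim: n => [|n [mu muP]]; last exact: is_lebesgueN_step muP.
pose mu : {sigma_finite_measure set (borel 'cV[R]_0) -> \bar R} :=
  \d_(0 : borel 'cV[R]_0).
exists mu; split => [A mA|M|u A mA].
- by [].
- by rewrite /= diracE ltry.
have uE (v : 'cV[R]_0) : v + u = v by apply/matrixP => -[].
by congr (mu _); apply/seteqP; split => v /=; rewrite uE.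
Qed.

(** * Overlap of a non-singular law with its small translates *)

Section thickening.
Context (R : realType) (n : nat).
Implicit Types (F : set 'cV[R]_n).

(** The interiors make the thickening open by definition. *)
Definition thicken F k : set 'cV[R]_n := \bigcup_(y in F) (ball y k.+1%:R^-1)°.

Lemma inv_succ_gt0 k : 0 < k.+1%:R^-1 :> R.
Proof. by rewrite invr_gt0 ltr0n. Qed.

Lemma open_thicken F k : open (thicken F k).
Proof. by apply: bigcup_open => y _; exact: open_interior. Qed.

Lemma sub_thicken F k : F `<=` thicken F k.
Proof. by move=> y Fy; exists y => //; apply: nbhsx_ballx; exact: inv_succ_gt0. Qed.

Lemma thicken_nonincreasing F : nonincreasing_seq (thicken F).
Proof.
move=> i j ij; apply/subsetPset => v [y Fy vy]; exists y => //.
by apply: (interiorS _ vy); apply: le_ball; rewrite lef_pV2 ?posrE ?ltr0n// ler_nat ltnS.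
Qed.

Lemma closed_box M : closed (box M : set 'cV[R]_n).
Proof.
move=> v clv i; rewrite leNgt; apply/negP => Mv.
have e0 : 0 < `|v i ord0| - M by rewrite subr_gt0.
have [z [zM /(ball_colP _ _ e0) /(_ i) vz]] := clv _ (nbhsx_ballx v _ e0).
have := zM i; have := ler_normB (v i ord0) (v i ord0 - z i ord0).
by rewrite (_ : _ - (_ - _) = z i ord0); [have := ler_distD (z i ord0) (v i ord0) 0; rewrite !subr0; lra|ring].
Qed.

Lemma bigcap_thicken F : closed F -> \bigcap_k thicken F k = F.
Proof.
move=> cF; apply/seteqP; split => [v vF|v Fv k _]; last exact: sub_thicken.
apply: cF => U; rewrite -nbhs_ballE => -[e /= e0 eU].
have [y Fy vy] := vF (Num.truncn e^-1) I.
exists y; split => //; apply: eU; apply: ball_sym; apply: le_ball (interior_subset vy).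
by rewrite invf_ple ?posrE ?ltr0n// ltW// truncnS_gt.
Qed.

Lemma cvg_thicken (mu : {measure set (borel 'cV[R]_n) -> \bar R}) F : closed F ->
  (mu (thicken F 0) < +oo)%E -> mu (thicken F k) @[k --> \oo] --> mu F.
Proof.
move=> cF fin; rewrite -{2}(bigcap_thicken cF).
apply: nonincreasing_cvg_mu => //.
- by move=> k; apply: measurable_open; exact: open_thicken.
- by rewrite bigcap_thicken//; exact: measurable_closed.
- exact: thicken_nonincreasing.
Qed.

End thickening.

Lemma cvge_near_lt (R : realType) (f : nat -> \bar R) (a b : \bar R) :
  f @ \oo --> a -> (a < b)%E -> \forall k \near \oo, (f k < b)%E.
Proof.
move=> fa ab; apply: (fa [set y | (y < b)%E]).
by apply: open_nbhs_nbhs; split => //; exact: open_ereal_lt_ereal.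
Qed.

Section inner_regularity.
Local Open Scope ereal_scope.
Context (R : realType) (n : nat).
Variable nu : {finite_measure set (borel 'cV[R]_n) -> \bar R}.

(** Approximation from both sides, rather than from inside only, so that the class
    of these sets is closed under complements. *)
Definition squeezed (A : set (borel 'cV[R]_n)) := forall e : R, (0 < e)%R ->
  exists F U : set 'cV[R]_n, [/\ closed F, open U, F `<=` A, A `<=` U &
    nu (U `\` F) <= e%:E].

Let measurable_gap (F U : set 'cV[R]_n) : closed F -> open U ->
  measurable (U `\` F : set (borel 'cV[R]_n)).
Proof.
by move=> cF oU; apply: measurableD; [exact: measurable_open|exact: measurable_closed].
Qed.

Let nu_fin A : measurable A -> nu A < +oo.
Proof. by move=> mA; rewrite -ge0_fin_numE// fin_num_measure. Qed.

Let squeezed_closed F : closed F -> squeezed F.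
Proof.
move=> cF e e0.
have mk k : measurable (thicken F k : set (borel 'cV[R]_n)).
  by apply: measurable_open; exact: open_thicken.
have mF : measurable (F : set (borel 'cV[R]_n)) by exact: measurable_closed.
have cv := cvg_thicken cF (nu_fin (mk 0%N)).
have finF : nu F \is a fin_num by exact: fin_num_measure.
have [k _ /(_ k (leqnn k)) hk] : \forall k \near \oo, nu (thicken F k) < nu F + e%:E.
  by apply: cvge_near_lt cv _; rewrite lteDl// lte_fin.
exists F, (thicken F k); split => //; [exact: open_thicken|exact: sub_thicken|].
rewrite measureD// ?nu_fin// setIidr; last exact: sub_thicken.
by rewrite leeBlDl// ltW.
Qed.

Let squeezedC A : squeezed A -> squeezed (~` A).
Proof.
move=> sA e /sA[F [U [cF oU FA AU h]]]; exists (~` U), (~` F); split.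
- exact: open_closedC.
- exact: closed_openC.
- exact: subsetC.
- exact: subsetC.
by rewrite setDE setCK setIC -setDE.
Qed.

Let squeezed_bigcup (A : nat -> set (borel 'cV[R]_n)) :
  (forall i, squeezed (A i)) -> squeezed (\bigcup_i A i).
Proof.
move=> sA e e0; pose e2 := (e / 2)%R.
have e20 : (0 < e2)%R by rewrite divr_gt0.
have dl i : (0 < e2 / (2 ^ i.+1)%:R)%R by rewrite divr_gt0// ltr0n expn_gt0.
pose F i := sval (cid (sA i _ (dl i))).
have FP i : exists U : set 'cV[R]_n, [/\ closed (F i), open U, F i `<=` A i, A i `<=` U &
  nu (U `\` F i) <= (e2 / (2 ^ i.+1)%:R)%:E] by rewrite /F; case: cid.
pose U i := sval (cid (FP i)).
have UP i : [/\ closed (F i), open (U i), F i `<=` A i, A i `<=` U i &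
  nu (U i `\` F i) <= (e2 / (2 ^ i.+1)%:R)%:E] by rewrite /U; case: cid.
pose UU := \bigcup_i U i; pose G N := UU `\` \big[setU/set0]_(i < N) F i.
have oUU : open UU by apply: bigcup_open => i _; case: (UP i).
have cFN N : closed (\big[setU/set0]_(i < N) F i).
  by apply: closed_bigsetU => i _; case: (UP i).
have mG N : measurable (G N : set (borel 'cV[R]_n)) by exact: measurable_gap.
have GE : \bigcap_N G N = UU `\` \bigcup_i F i.
  apply/seteqP; split => [v vG|v [vU vF] N _].
    split; first by have [] := vG 0%N I.
    move=> [i _ Fiv]; have [_] := vG i.+1 I; apply.
    by rewrite -bigcup_mkord; exists i => //=.
  by split => // ; rewrite -bigcup_mkord => -[i _ Fiv]; apply: vF; exists i.
have mGI : measurable (\bigcap_N G N : set (borel 'cV[R]_n)) by exact: bigcapT_measurable.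
have ndG : nonincreasing_seq G.
  apply/nonincreasing_seqP => N; apply/subsetPset; apply: setDS.
  by rewrite big_ord_recr/=; exact: subsetUl.
have cv := nonincreasing_cvg_mu (nu_fin (mG 0%N)) mG mGI ndG.
have small : nu (\bigcap_N G N) <= e2%:E.
  have mUF i : measurable (U i `\` F i : set (borel 'cV[R]_n)).
    by have [cF oU _ _ _] := UP i; exact: measurable_gap.
  apply: (@le_trans _ _ (\sum_(i <oo) nu (U i `\` F i))).
    apply: measure_sigma_subadditive => // v.
    rewrite GE => -[[i _ Uiv] vF]; exists i => //; split => // Fiv.
    by apply: vF; exists i.
  apply: le_trans (epsilon_trick0 xpredT (ltW e20)).
  by apply: lee_nneseries => // i _; case: (UP i).
have [N _ /(_ N (leqnn N)) hN] : \forall N \near \oo, nu (G N) < e%:E.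
  apply: cvge_near_lt cv _; apply: le_lt_trans small _.
  by rewrite lte_fin /e2 ltr_pdivrMr// ltr_pMr// ltr1n.
exists (\big[setU/set0]_(i < N) F i), UU; split => //.
- by rewrite -bigcup_mkord => v [i _ Fiv]; exists i => //; have [_ _ FA _ _] := UP i; exact: FA.
- by move=> v [i _ Aiv]; exists i => //; have [_ _ _ AU _] := UP i; exact: AU.
exact: ltW.
Qed.

(** Closed sets are squeezed by their thickenings, and the squeezed sets form a
    sigma-algebra. *)
Lemma inner_regular A : measurable A -> squeezed A.
Proof.
apply: smallest_sub; last first.
  move=> U oU; rewrite -[U]setCK; apply: squeezedC; apply: squeezed_closed.
  exact: open_closedC.
split=> [|B sB|B sB].
- exact: squeezed_closed closed0.
- by rewrite setTD; exact: squeezedC.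
- exact: squeezed_bigcup.
Qed.

End inner_regularity.

Section steinhaus.
Local Open Scope ereal_scope.
Context (R : realType) (n : nat).
Variable mu : {sigma_finite_measure set (borel 'cV[R]_n) -> \bar R}.
Hypothesis muP : is_lebesgueN mu.

(** A thickening of F of measure less than twice that of F has no room for F and a
    disjoint copy of F. *)
Let steinhaus_closed (F : set 'cV[R]_n) (M : R) : closed F -> F `<=` box M ->
  mu F != 0 -> exists2 dl : R, (0 < dl)%R & forall u : 'cV[R]_n,
    (forall i, (`|u i ord0| < dl)%R) -> exists2 x, F x & F (x + u)%R.
Proof.
have [_ mufin mutr] := muP => cF FM F0.
have mF : measurable (F : set (borel 'cV[R]_n)) by exact: measurable_closed.
have mk k : measurable (thicken F k : set (borel 'cV[R]_n)).
  by apply: measurable_open; exact: open_thicken.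
have fin0 : mu (thicken F 0) < +oo.
  apply: le_lt_trans (mufin (M + 1)%R); apply: le_measure; rewrite ?inE//.
    exact: measurable_box.
  move=> v [y Fy /interior_subset]; rewrite invr1 => /(ball_colP _ _ ltr01) h i.
  have := FM y Fy i; have := h i; rewrite !ler_norml !ltr_norml.
  by move=> /andP[? ?] /andP[? ?]; apply/andP; split; lra.
have finF : mu F < +oo.
  by apply: le_lt_trans fin0; apply: le_measure; rewrite ?inE//; exact: sub_thicken.
have finF' : mu F \is a fin_num by rewrite ge0_fin_numE.
have cv := cvg_thicken cF fin0.
have [k _ /(_ k (leqnn k)) hk] : \forall k \near \oo, mu (thicken F k) < mu F + mu F.
  by apply: cvge_near_lt cv _; rewrite lteDl// lt0e F0/=.
exists (k.+1%:R^-1 / 2)%R; first by rewrite divr_gt0// invr_gt0 ltr0n.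
move=> u uk; apply: contrapT => nx.
pose F' : set (borel 'cV[R]_n) := [set v | F ((v : 'cV[R]_n) + u)%R].
have mF' : measurable F'.
  rewrite -[X in measurable X]setTI.
  exact: (@measurable_addl_col R n u measurableT _ mF).
have disj : F `&` F' = set0.
  by apply/seteqP; split => // v [Fv F'v]; apply: nx; exists v.
have : mu (F `|` F') <= mu (thicken F k).
  apply: le_measure; rewrite ?inE//; first exact: measurableU.
  move=> v [Fv|F'v]; first exact: sub_thicken.
  exists (v + u)%R => //; rewrite /interior -nbhs_ballE.
  exists (k.+1%:R^-1 / 2)%R; first by rewrite /= divr_gt0// invr_gt0 ltr0n.
  have k2 : (0 < k.+1%:R^-1 / 2 :> R)%R by rewrite divr_gt0// invr_gt0 ltr0n.
  move=> z /(ball_colP _ _ k2) vz; apply/ball_colP; first exact: inv_succ_gt0.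
  move=> i; have := uk i; have := vz i; rewrite mxE !ltr_norml.
  move: (k.+1%:R^-1 : R)%R (u i ord0) (v i ord0) (z i ord0) => r a b c.
  by move=> /andP[? ?] /andP[? ?]; apply/andP; split; lra.
rewrite measureU// [X in _ + X](mutr u F mF) => /le_lt_trans/(_ hk).
by rewrite ltxx.
Qed.

(** The theorem of Steinhaus. Restricted to a bounded box, mu is finite, hence
    regular, and A contains a closed bounded set of positive measure. *)
Lemma steinhaus (A : set (borel 'cV[R]_n)) : measurable A -> mu A != 0 ->
  exists2 dl : R, (0 < dl)%R & forall u : 'cV[R]_n,
    (forall i, (`|u i ord0| < dl)%R) -> exists2 x : 'cV[R]_n, A x & A (x + u)%R.
Proof.
have [_ mufin mutr] := muP => mA A0.
have [M AM0] : exists k : nat, mu (A `&` box k%:R) != 0.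
  apply: contrapT => /forallNP H; move/negP : A0; apply; rewrite eq_le measure_ge0 andbT.
  have mAb k : measurable (A `&` box k%:R).
    by apply: measurableI => //; exact: measurable_box.
  apply: (@le_trans _ _ (\sum_(k <oo) mu (A `&` box k%:R))).
    by apply: measure_sigma_subadditive => //; rewrite -setI_bigcupr bigcup_box setIT.
  by rewrite eseries0// => k _ _; apply/eqP/negPn/negP; exact: H.
pose B : set (borel 'cV[R]_n) := box M%:R; have mB : measurable B by exact: measurable_box.
pose nu0 : {measure set (borel 'cV[R]_n) -> \bar R} := mrestr mu mB.
have nufin : fin_num_fun nu0.
  move=> Z mZ; rewrite ge0_fin_numE//; apply: le_lt_trans (mufin M%:R).
  by apply: le_measure; rewrite ?inE//; exact: measurableI.
pose fm := Measure_isFinite.Build _ _ _ nu0 nufin.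
pose nu : {finite_measure set (borel 'cV[R]_n) -> \bar R} :=
  HB.pack (Measure.sort nu0) (Measure.class nu0) fm.
have nuA : 0 < nu A by rewrite lt0e AM0 measure_ge0.
have nuAfin : nu A \is a fin_num by exact: fin_num_measure.
have eA : (0 < fine (nu A) / 2)%R by rewrite divr_gt0// fine_gt0// nuA ltey_eq nuAfin.
have [F [U [cF oU FA AU UF]]] := inner_regular nu mA eA.
have mF : measurable (F : set (borel 'cV[R]_n)) by exact: measurable_closed.
have nuF : nu F != 0.
  apply/negP => /eqP nuF0; move: nuA; rewrite ltNge => /negP; apply.
  have mUF : measurable (U `\` F : set (borel 'cV[R]_n)).
    by apply: measurableD => //; exact: measurable_open.
  have hA : nu A <= nu F + nu (U `\` F).
    apply: le_trans (measureU2 nu mF mUF); apply: le_measure; rewrite ?inE//.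
      exact: measurableU.
    by move=> v Av; have [Fv|Fv] := pselect (F v); [left|right; split => //; exact: AU].
  have h : nu A <= (fine (nu A) / 2)%:E.
    by apply: le_trans hA _; rewrite nuF0 add0e.
  move: h; rewrite -{1}(fineK nuAfin) lee_fin => h.
  by rewrite -(fineK nuAfin) lee_fin; lra.
have [dl dl0 H] := @steinhaus_closed (F `&` box M%:R) M%:R
  ltac:(by apply: closedI => //; exact: closed_box) (@subIsetr _ _ _) nuF.
by exists dl => // u /H[x [Fx _] [Fxu _]]; exists x; exact: FA.
Qed.

End steinhaus.

(** Suppose that p and its translates by u j overlap less and less, with u j
    tending to 0 summably fast. By Borel-Cantelli, p-almost every point lies in
    finitely many of the sets Z j that witness this. The other points form a
    countable union of sets that are disjoint from arbitrarily small translates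
    of themselves, hence Lebesgue null by Steinhaus; so p would be singular. *)
Lemma translation_overlap (R : realType) (n : nat)
    (p : probability (borel 'cV[R]_n) R) :
  ~ mutually_singular p (@lebesgueN R n) ->
  exists dl eta : R, [/\ 0 < dl, 0 < eta, eta <= 1 &
    forall (u : 'cV[R]_n) (B : set (borel 'cV[R]_n)), (forall i, `|u i ord0| < dl) ->
      measurable B ->
      (p B <= p [set v | B ((v : 'cV[R]_n) + u)%R] + (1 - eta)%:E)%E].
Proof.
move=> nonsing; have [mu muP] := lebesgueN_is_measure R n.
apply: contrapT => nex; apply: nonsing.
pose r j : R := 1 / (2 ^ j.+1)%:R.
have r0 j : 0 < r j by rewrite divr_gt0// ltr0n expn_gt0.
have r1 j : r j <= 1.
  by rewrite /r ler_pdivrMr ?ltr0n ?expn_gt0// mul1r ler1n expn_gt0.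
have bad j : exists uB : 'cV[R]_n * set (borel 'cV[R]_n),
    [/\ forall i, `|uB.1 i ord0| < r j, measurable uB.2 &
      (p [set v | uB.2 ((v : 'cV[R]_n) + uB.1)%R] + p (~` uB.2) < (r j)%:E)%E].
  apply: contrapT => /forallNP H; apply: nex; exists (r j), (r j); split => //.
  move=> u B ub mB; rewrite leNgt; apply/negP => hlt; apply: (H (u, B)); split => //=.
  have mBu : measurable [set v : borel 'cV[R]_n | B ((v : 'cV[R]_n) + u)].
    by rewrite -[X in measurable X]setTI; exact: (@measurable_addl_col R n u measurableT _ mB).
  rewrite probability_setC//; move: hlt.
  rewrite -(fineK (fin_num_measure p _ mB)) -(fineK (fin_num_measure p _ mBu)).
  by rewrite -EFinB -!EFinD !lte_fin; lra.
pose u j := (sval (cid (bad j))).1; pose B j := (sval (cid (bad j))).2.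
have uBP j : [/\ forall i, `|u j i ord0| < r j, measurable (B j) &
    (p [set v | B j ((v : 'cV[R]_n) + u j)%R] + p (~` B j) < (r j)%:E)%E].
  by rewrite /u /B; case: cid.
pose Z j : set (borel 'cV[R]_n) := [set v | B j ((v : 'cV[R]_n) + u j)] `|` ~` B j.
have mBu j : measurable [set v : borel 'cV[R]_n | B j ((v : 'cV[R]_n) + u j)].
  have [_ mB _] := uBP j.
  by rewrite -[X in measurable X]setTI; exact: (@measurable_addl_col R n (u j) measurableT _ mB).
have mZ j : measurable (Z j).
  by apply: measurableU => //; apply: measurableC; have [] := uBP j.
have pZ j : (p (Z j) <= (r j)%:E)%E.
  have [_ mB /ltW h] := uBP j; apply: le_trans h.
  by apply: measureU2 => //; exact: measurableC.
exists (lim_sup_set Z); split.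
- by apply: bigcapT_measurable => k; apply: bigcup_measurable.
- apply: lim_sup_set_cvg0 => //.
  apply: (@le_lt_trans _ _ 1%E); last exact: ltry.
  apply: le_trans (epsilon_trick0 xpredT ler01).
  by apply: lee_nneseries => // j _; exact: pZ.
have mC k : measurable (\bigcap_(j in [set j | (k <= j)%N]) ~` Z j).
  by apply: bigcap_measurableType => j _; exact: measurableC.
have -> : ~` lim_sup_set Z = \bigcup_k \bigcap_(j in [set j | (k <= j)%N]) ~` Z j.
  by rewrite /lim_sup_set setC_bigcap; apply: eq_bigcupr => k _; rewrite setC_bigcup.
have [muE _ _] := muP; rewrite muE; last exact: bigcupT_measurable.
apply/eqP; rewrite eq_le measure_ge0 andbT.
apply: (@le_trans _ _ (\sum_(k <oo) mu (\bigcap_(j in [set j | (k <= j)%N]) ~` Z j))%E).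
  by apply: measure_sigma_subadditive => //; exact: bigcupT_measurable.
rewrite eseries0// => k _ _; apply/eqP/negPn/negP => mun0.
have [dl dl0 H] := steinhaus muP (mC k) mun0.
have [j kj rj] : exists2 j, (k <= j)%N & r j < dl.
  exists (maxn k (Num.truncn dl^-1)); first exact: leq_maxl.
  set j := maxn _ _; have rj : r j <= j.+1%:R^-1.
    by rewrite /r div1r lef_pV2 ?posrE ?ltr0n ?expn_gt0// ler_nat ltnW// ltn_expl.
  apply: le_lt_trans rj _; rewrite invf_plt ?posrE ?ltr0n//.
  apply: lt_le_trans (truncnS_gt _) _; rewrite ler_nat ltnS; exact: leq_maxr.
have [uj _ _] := uBP j.
have [x xZ xuZ] := H (u j) (fun i => lt_trans (uj i) rj).
have /not_orP[nB _] := xZ j kj; have /not_orP[_ nnB] := xuZ j kj.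
by apply: nnB => /nB.
Qed.

(** * Overlap for controllable linear systems *)

Section product_overlap.
Local Open Scope ereal_scope.
Context (R : realType) (n : nat).
Local Notation T := (borel 'cV[R]_n).
Local Notation S := (seqspace T).
Variables (mu : probability T R) (Q : probability S R).
Hypothesis splitQ : forall F : T * S -> \bar R,
  measurable_fun setT F -> (forall x, 0 <= F x) ->
  \int[Q]_v F (v 0%N, shift v) = \int[mu]_x \int[Q]_v F (x, v).
Variables (dl eta : R).
Hypotheses (eta_gt0 : (0 < eta)%R) (eta_le1 : (eta <= 1)%R).
Hypothesis overlap_mu : forall (u : 'cV[R]_n) (B : set T),
  (forall i, `|u i ord0| < dl)%R -> measurable B ->
  mu B <= mu [set v | B ((v : 'cV[R]_n) + u)%R] + (1 - eta)%:E.

Definition translate_seq (u : nat -> 'cV[R]_n) (v : S) : S :=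
  fun k => ((v k : 'cV[R]_n) + u k)%R.

Lemma measurable_translate_seq u : measurable_fun setT (translate_seq u).
Proof.
apply: (@measurable_to_seqspace _ _ _ S) => k.
exact: measurableT_comp (measurable_addl_col (u k)) (measurable_coord k).
Qed.

Lemma integral_scons (F : S -> \bar R) : measurable_fun setT F ->
  (forall v, 0 <= F v) ->
  \int[Q]_v F v = \int[mu]_x \int[Q]_v F (scons (x, v)).
Proof.
move=> mF F0.
rewrite -(splitQ (measurableT_comp mF (@measurable_scons _ T)) (fun y => F0 _)).
by apply: eq_integral => v _; rewrite /= scons_head_shift.
Qed.

Lemma translate_scons u x v :
  translate_seq u (scons (x, v)) =
  scons (((x : 'cV[R]_n) + u 0%N)%R : T, translate_seq (fun k => u k.+1) v).
Proof. by apply/funext => -[|k]. Qed.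

(** Overlap passes to products: if each factor shares the fraction eta of its mass
    with its translate, the laws of k terms share the fraction eta ^ k. The
    induction conditions on the first term x. *)
Lemma translate_overlap k (u : nat -> 'cV[R]_n) (B : set S) :
  (forall j i, (j < k)%N -> `|u j i ord0| < dl)%R ->
  (forall j, (k <= j)%N -> u j = 0%R) -> measurable B ->
  Q B <= Q [set v | B (translate_seq u v)] + (1 - eta ^+ k)%:E.
Proof.
elim: k u B => [|k IH] u B ul u0 mB.
  rewrite expr0 subrr adde0 (_ : [set v | B _] = B)//.
  suff tE v : translate_seq u v = v by apply/seteqP; split => v /=; rewrite tE.
  by apply/funext => j; rewrite /translate_seq u0// addr0.
pose u' j := u j.+1; pose e := (eta ^+ k)%R.
have e0 : (0 <= e)%R by rewrite exprn_ge0// ltW.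
have e1 : (e <= 1)%R by rewrite exprn_ile1// ltW.
have mt (C : set S) (h : S -> S) : measurable_fun setT h -> measurable C ->
    measurable [set v | C (h v)].
  by move=> mh mC; rewrite -[X in measurable X]setTI; exact: mh.
have m1 (C : set S) : measurable C -> measurable_fun setT (fun v => (\1_C v)%:E : \bar R).
  by move=> mC; apply/measurable_EFinP; exact: measurable_indic.
have i0 (C : set S) v : 0 <= (\1_C v)%:E :> \bar R by rewrite lee_fin.
have mBx x : measurable [set v | B (scons (x, v))].
  by apply: (mt _ (fun v => scons (x, v))) => //; exact: measurableT_comp (@measurable_scons _ T) (pair1_measurable x).
have QE (C : set S) (h : T -> S -> S) x : measurable [set v | C (h x v)] ->
    \int[Q]_v (\1_C (h x v))%:E = Q [set v | C (h x v)].
  by move=> mC; rewrite -integral_indicT.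
pose a x := Q [set v | B (scons (x, v))].
pose a' x := Q [set v | B (scons (x, translate_seq u' v))].
have aE : Q B = \int[mu]_x a x.
  rewrite -integral_indicT// (integral_scons (m1 B mB) (i0 B)).
  by apply: eq_integral => x _; rewrite (QE B (fun x v => scons (x, v))).
have mtu : measurable_fun setT (fun y : T * S => scons (y.1, translate_seq u' y.2)).
  apply: (measurableT_comp (@measurable_scons _ T)).
  apply: measurable_fun_pair => //.
  exact: measurableT_comp (measurable_translate_seq u') measurable_snd.
have mBx' x : measurable [set v | B (scons (x, translate_seq u' v))].
  exact: (mt _ _ (measurable_translate_seq u') (mBx x)).
have ma' : measurable_fun setT a'.
  have := @measurable_fun_fubini_tonelli_F _ _ _ _ _ Q
    (fun y : T * S => (\1_B (scons (y.1, translate_seq u' y.2)))%:E)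
    (measurableT_comp (m1 B mB) mtu) (fun y => i0 B _).
  by apply: eq_measurable_fun => x _; rewrite /fubini_F /= (QE B (fun x v => scons (x, translate_seq u' v))).
have a'E : Q [set v | B (translate_seq u v)] = \int[mu]_x a' ((x : 'cV[R]_n) + u 0%N)%R.
  have mBu : measurable [set v | B (translate_seq u v)].
    exact: (mt _ _ (measurable_translate_seq u) mB).
  rewrite -integral_indicT// (integral_scons (m1 _ mBu) (i0 _)).
  apply: eq_integral => x _; rewrite /a'.
  rewrite -(QE B (fun x v => scons (((x : 'cV[R]_n) + u 0%N)%R : T, translate_seq u' v)) x); last exact: mBx'.
  apply: eq_integral => v _; rewrite !indicE; congr ((nat_of_bool _)%:R%:E).
  by apply/idP/idP => /set_mem h; apply/mem_set; move: h; rewrite /= translate_scons.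
have aa' x : a x <= a' x + (1 - e)%:E.
  apply: (IH u' [set v | B (scons (x, v))]) => //.
  - by move=> j i jk; exact: ul.
  - by move=> j kj; exact: u0.
have a1 x : a x <= 1 by exact: probability_le1.
(* The induction hypothesis reads a <= a' + (1 - e); since a <= 1, the minimum of
   a' and e serves as well as a', and its bound e turns the overlap of the
   first factor into a loss of only e * (1 - eta). *)
pose G x := mine (a' x) e%:E.
have mG : measurable_fun setT G by exact: measurable_mine.
have G0 x : 0 <= G x by rewrite le_min measure_ge0 lee_fin.
have Ge x : G x <= e%:E by rewrite ge_min lexx orbT.
have Ga' x : G x <= a' x by rewrite ge_min lexx.
have aG x : a x <= G x + (1 - e)%:E.
  rewrite /G; have [ae|/ltW ea] := leP (a' x) e%:E; first exact: aa'.
  by rewrite -EFinD addrC subrK.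
have ma : measurable_fun setT a.
  have := @measurable_fun_fubini_tonelli_F _ _ _ _ _ Q
    (fun y : T * S => (\1_B (scons y))%:E)
    (measurableT_comp (m1 B mB) (@measurable_scons _ T)) (fun y => i0 B _).
  apply: eq_measurable_fun => x _.
  by rewrite /fubini_F /= (QE B (fun x v => scons (x, v))).
have mtr := @measurable_addl_col R n (u 0%N).
pose q : probability T R := distribution mu (mfun_Sub (mem_set mtr)).
rewrite aE a'E.
apply: (@le_trans _ _ (\int[mu]_x (G x + (1 - e)%:E))).
  apply: ge0_le_integral => //.
  - by apply: emeasurable_funD.
rewrite ge0_integralD//; last by move=> x _; rewrite lee_fin subr_ge0.
rewrite (integral_prob_cst mu).
have st : \int[mu]_x G x <= \int[q]_x G x + (e * (1 - eta))%:E.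
  apply: le_integral_almost_dominated => // C mC.
  by apply: overlap_mu => // i; exact: ul.
apply: (le_trans (leeD2r _ st)).
rewrite ge0_integral_distribution// -addeA -EFinD.
have -> : (e * (1 - eta) + (1 - e) = 1 - eta ^+ k.+1)%R.
  by rewrite exprSr -/e; ring.
have mGt := measurableT_comp mG mtr; have ma't := measurableT_comp ma' mtr.
rewrite leeD2r//; by apply: ge0_le_integral => // x _; [exact: G0|exact: Ga'].
Qed.

End product_overlap.

Lemma small_mulmx (R : realType) (a b : nat) (M : 'M[R]_(a, b)) (e : R) : 0 < e ->
  exists2 dl, 0 < dl & forall z : 'cV[R]_b, (forall i, `|z i ord0| <= dl) ->
    forall k, `|(M *m z) k ord0| < e.
Proof.
move=> e0; pose K := \sum_k \sum_l `|M k l|.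
have K0 : 0 <= K by apply: sumr_ge0 => k _; exact: sumr_ge0.
exists (e / (K + 1)); first by rewrite divr_gt0// ltr_wpDl.
move=> z zl k; rewrite mxE.
have K1 : 0 < K + 1 by rewrite ltr_wpDl.
apply: (@le_lt_trans _ _ (K * (e / (K + 1)))).
  apply: le_trans (ler_norm_sum _ _ _) _.
  apply: (@le_trans _ _ (\sum_l `|M k l| * (e / (K + 1)))).
    by apply: ler_sum => l _; rewrite normrM ler_wpM2l.
  rewrite -mulr_suml ler_wpM2r ?divr_ge0 ?(ltW e0) ?(ltW K1)//.
  by rewrite /K (bigD1 k)//= lerDl sumr_ge0// => i _; exact: sumr_ge0.
rewrite mulrA ltr_pdivrMr// mulrDr mulr1 mulrC ltrDl//.
Qed.

Section linear_system.
Context (R : realType) (n k : nat) (A : 'M[R]_n) (D : 'M[R]_(n, k)).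

Fixpoint linear_orbit m (x : 'cV[R]_n) (v : nat -> 'cV[R]_k) : 'cV[R]_n :=
  if m is m'.+1 then A *m linear_orbit m' x v + D *m v m' else x.

Lemma linear_orbitB m x y v :
  linear_orbit m y v = linear_orbit m x v + A ^+ m *m (y - x).
Proof.
elim: m => [|m IH] /=; first by rewrite expr0 mul1mx subrKC.
by rewrite IH mulmxDr addrAC mulmxA -[A *m A ^+ m]/(A * A ^+ m) -exprS.
Qed.

Lemma linear_orbitD m x v u :
  linear_orbit m x (fun j => v j + u j) =
  linear_orbit m x v + \sum_(i < m) A ^+ i *m D *m u (m - i.+1)%N.
Proof.
elim: m => [|m IH] /=; first by rewrite big_ord0 addr0.
rewrite IH !mulmxDr big_ord_recl /= expr0 mul1mx subn1 /= mulmx_sumr.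
rewrite addrACA [D *m u m + _]addrC; congr (_ + (_ + _)).
apply: eq_bigr => i _; rewrite !mulmxA subSS; congr (_ *m _ *m _).
by rewrite exprS.
Qed.

Lemma measurable_linear_orbit m x :
  measurable_fun setT (fun v : seqspace (borel 'cV[R]_k) =>
    linear_orbit m x (v : nat -> 'cV[R]_k) : borel 'cV[R]_n).
Proof.
elim: m => [|m IH] /=; first exact: measurable_cst.
apply: (@measurable_into_col _ _ _ (seqspace (borel 'cV[R]_k))) => i.
apply: (eq_measurable_fun (fun v : seqspace (borel 'cV[R]_k) =>
  (A *m linear_orbit m x v) i ord0 + (D *m (v m : 'cV[R]_k)) i ord0)).
  by move=> v _; rewrite [RHS]mxE.
apply: measurable_funD; first exact: measurable_mulmx.
apply: measurable_mulmx.
exact: (@measurable_coord _ (borel 'cV[R]_k) m).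
Qed.

(** By the rank condition, the difference A ^ n (y - x) between two free motions is
    a linear image of n control values, which is inverted linearly by pinvmx;
    small differences need small controls. *)
Lemma small_controls (dl : R) : controllable A D -> 0 < dl ->
  exists2 rho, 0 < rho & forall x y : 'cV[R]_n,
    (forall i, `|x i ord0| <= rho) -> (forall i, `|y i ord0| <= rho) ->
    exists u : nat -> 'cV[R]_k,
      [/\ forall j i, (j < n)%N -> `|u j i ord0| < dl,
          forall j, (n <= j)%N -> u j = 0 &
          forall v, linear_orbit n x (fun j => v j + u j) = linear_orbit n y v].
Proof.
move=> ctr dl0.
pose C := \mxrow_(i < n) (A ^+ i *m D).
have Cfree : row_free C by rewrite /row_free ctr.
pose M := pinvmx C *m A ^+ n.
have [d' d'0 Hd] := small_mulmx M dl0.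
exists (d' / 2); first by rewrite divr_gt0.
move=> x y xr yr; pose s := M *m (y - x).
have sd t : `|s t ord0| < dl.
  apply: Hd => i; rewrite !mxE; apply: le_trans (ler_normB _ _) _.
  by have := xr i; have := yr i; lra.
pose c (i : 'I_n) : 'cV[R]_k := submxcol s i.
(* The block c i is multiplied by A ^ i, so it is applied i + 1 steps before
   time n. *)
pose u j : 'cV[R]_k :=
  if insub (n - j.+1)%N is Some i then (if (j < n)%N then c i else 0) else 0.
exists u; split.
- move=> j i jn; rewrite /u jn; case: insubP => [t _ _|_]; last by rewrite mxE normr0.
  by rewrite /c mxE; exact: sd.
- by move=> j nj; rewrite /u ltnNge nj; case: insubP.
move=> v; rewrite linear_orbitD (linear_orbitB n x y); congr (_ + _).
have -> : \sum_(i < n) A ^+ i *m D *m u (n - i.+1)%N = C *m \mxcol_i c i.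
  rewrite mul_mxrow_mxcol; apply: eq_bigr => i _; congr (_ *m _).
  have iE : (n - (n - i.+1).+1)%N = i by rewrite -subSn// subSS subKn// ltnW.
  rewrite /u iE insubT//= => ilt; rewrite (_ : (_ < n)%N); last by rewrite ltn_subrL /= (leq_ltn_trans _ ilt).
  by congr c; apply: val_inj.
by rewrite /c submxcolK /s /M -mulmxA (mulmxA C) mulmxVp// mul1mx.
Qed.

End linear_system.

(** * Lyapunov functions *)

Section comparison_functions.
Variable R : realType.
Implicit Types phi : R -> R.

Lemma class_K_le phi s t : class_K phi -> 0 <= s -> s <= t -> phi s <= phi t.
Proof.
move=> [_ incr _] s0; rewrite le_eqVlt => /orP[/eqP->//|st].
by apply: ltW; exact: incr.
Qed.

Lemma class_K_ge0 phi s : class_K phi -> 0 <= s -> 0 <= phi s.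
Proof. by move=> K s0; have [_ _ <-] := K; exact: class_K_le. Qed.

Lemma class_K_gt0 phi s : class_K phi -> 0 < s -> 0 < phi s.
Proof. by move=> [_ incr p0] s0; rewrite -p0; exact: incr. Qed.

Lemma class_K_small phi (e : R) : class_K phi -> 0 < e ->
  exists2 dl, 0 < dl & forall s, 0 <= s -> s <= dl -> phi s <= e.
Proof.
move=> K e0; have [/continuous_within_itvcyP[_ c0] _ p0] := K.
move: c0; rewrite p0 => /cvgr0Pnorm_le /(_ _ e0) [dl /= dl0 H].
have d2 : 0 < dl / 2 by rewrite divr_gt0.
exists (dl / 2) => // s s0 sd; apply: le_trans (class_K_le K s0 sd) _.
apply: le_trans (ler_norm _) _; apply: H => //=.
by rewrite sub0r normrN gtr0_norm// ltr_pdivrMr// ltr_pMr// ltr1n.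
Qed.

Lemma class_Koo_large phi (m : R) : class_Koo phi ->
  exists2 s, 0 <= s & m <= phi s.
Proof.
move=> [_ /cvgryPge /(_ m) [N [_ H]]].
exists (Num.max 0 (N + 1)); first by rewrite le_max lexx.
by apply: H; rewrite /= lt_max ltrDl ltr01 orbT.
Qed.

(** As long as u exceeds b + c it loses c at each step, and once below b it stays
    there. *)
Lemma max_decrease (u : nat -> R) (b c : R) n : 0 <= c ->
  (forall k, (k < n)%N -> u k.+1 <= Num.max b (u k - c)) ->
  u n <= Num.max b (u 0%N - n%:R * c).
Proof.
move=> c0; elim: n => [|n IH] H; first by rewrite mul0r subr0 le_max lexx orbT.
apply: le_trans (H n (ltnSn n)) _; rewrite ge_max le_max lexx /=.
have : u n <= Num.max b (u 0%N - n%:R * c).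
  by apply: IH => k kn; apply: H; exact: ltnW.
rewrite !le_max -natr1 mulrDl mul1r => /orP[h|h]; apply/orP.
  by left; lra.
by right; lra.
Qed.

End comparison_functions.

Section euclidean_norm.
Variables (R : realType).

Lemma enorm_ge0 n (v : 'cV[R]_n) : 0 <= enorm v.
Proof. exact: sqrtr_ge0. Qed.

Lemma coord_le_enorm n (v : 'cV[R]_n) i : `|v i ord0| <= enorm v.
Proof.
rewrite -sqrtr_sqr ler_wsqrtr// (bigD1 i)//= lerDl.
by apply: sumr_ge0 => j _; exact: sqr_ge0.
Qed.

Lemma enorm_le_sum n (v : 'cV[R]_n) : enorm v <= \sum_i `|v i ord0|.
Proof.
have s0 : 0 <= \sum_i `|v i ord0| by exact: sumr_ge0.
rewrite -[leRHS]ger0_norm// -sqrtr_sqr ler_wsqrtr// expr2 mulr_suml.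
apply: ler_sum => i _; rewrite -real_normK ?num_real// expr2 ler_wpM2l//.
by rewrite (bigD1 i)//= lerDl; exact: sumr_ge0.
Qed.

Lemma enorm_col0 n k (v : 'cV[R]_k) : enorm (col_mx (0 : 'cV[R]_n) v) = enorm v.
Proof.
rewrite /enorm big_split_ord /= big1 ?add0r; last first.
  by move=> i _; rewrite col_mxEu mxE expr0n.
by congr Num.sqrt; apply: eq_bigr => i _; rewrite col_mxEd.
Qed.

Lemma enorm_castmx n k (e : n = k) (v : 'cV[R]_n) :
  enorm (castmx (e, erefl 1%N) v) = enorm v.
Proof. by case: k / e; rewrite castmx_id. Qed.

Lemma coord_le_norm n (v : 'cV[R]_n) i : `|v i ord0| <= `|v|.
Proof.
rewrite [leRHS]/Num.norm /= mx_normrE.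
exact: (le_bigmax _ (fun ij => `|v ij.1 ij.2|) (i, ord0)).
Qed.

Lemma bounded_enorm n (W : set 'cV[R]_n) : bounded_set W ->
  exists2 K : R, 0 <= K & forall v, W v -> enorm v <= K.
Proof.
move=> /pinfty_ex_gt0[M M0 WM]; exists (n%:R * M); first by rewrite mulr_ge0// ltW.
move=> v Wv; apply: le_trans (enorm_le_sum v) _.
rewrite mulr_natl -[n in leRHS]card_ord -sumr_const; apply: ler_sum => i _.
by apply: le_trans (coord_le_norm v i) _; exact: WM.
Qed.

Lemma measurable_enorm n : measurable_fun setT (fun v : borel 'cV[R]_n => enorm (v : 'cV[R]_n)).
Proof.
apply: (measurableT_comp (continuous_measurable_fun (@sqrt_continuous R))).
apply: measurable_sum => i; apply: measurable_funX; exact: measurable_coord_col.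
Qed.

End euclidean_norm.

Section lyapunov_functions.
Variables (R : realType) (nx nw : nat).
Variables (X : set 'cV[R]_nx) (X0 : X 0) (W : set 'cV[R]_nw).
Variables (g : state X0 -> state X0) (D : 'M[R]_(nx, nw)).
Hypothesis W0 : W 0.
Variable K : R.
Hypothesis W_le : forall v, W v -> enorm v <= K.

Lemma lipschitz_state_continuous (V : state X0 -> R) (L : R) :
  (forall x y, `|V x - V y| <= L * enorm (point_of x - point_of y)) ->
  continuous V.
Proof.
move=> VL x U; rewrite -nbhs_ballE => -[e /= e0 eU].
pose c := `|L| * nx%:R + 1.
have c0 : 0 < c by rewrite ltr_wpDl// mulr_ge0.
have ec : 0 < e / c by rewrite divr_gt0.
have xin : nbhs x (point_of @^-1` ball (point_of x) (e / c)).
  exact: (point_of_continuous (nbhsx_ballx _ _ ec)).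
apply: (@filterS _ _ (nbhs_filter x) _ _ _ xin) => y /(ball_colP _ _ ec) xy.
apply: eU; rewrite /ball /=.
apply: le_lt_trans (VL x y) _.
apply: (@le_lt_trans _ _ (`|L| * (nx%:R * (e / c)))).
  apply: (@le_trans _ _ (`|L| * enorm (point_of x - point_of y))).
    by rewrite ler_wpM2r ?enorm_ge0// ler_norm.
  rewrite ler_wpM2l//; apply: le_trans (enorm_le_sum _) _.
  rewrite mulr_natl -[nx in leRHS]card_ord -sumr_const; apply: ler_sum => i _.
  by rewrite !mxE ltW.
by rewrite !mulrA ltr_pdivrMr// [ltLHS]mulrC ltr_pM2l// /c ltrDl.
Qed.

(** A common form for the two kinds of Lyapunov functions. In the ISS form the gain
    sg is the given class-K function. In the nominal form, V at the disturbed
    successor differs from V at the undisturbed one by a multiple of the noise,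
    since both V and the noise dependence are Lipschitz. The gain is only ever
    evaluated at norms of noise values, which are at most K. *)
Lemma dissipation_inequality : has_ISS_lyapunov W g D ->
  exists (V : state X0 -> R) (a1 a2 a3 sg : R -> R),
    [/\ continuous V, lyapunov_bounds V a1 a2,
        class_Koo a1, class_Koo a2 & class_Koo a3] /\
    [/\ forall e, 0 < e -> exists2 dl, 0 < dl &
          forall s, 0 <= s -> s <= dl -> sg s <= e,
        exists sb, forall s, 0 <= s -> s <= K -> sg s <= sb &
        forall (x y : state X0) (w : 'cV[R]_nw), W w ->
          point_of y = dynamics g D x w ->
          V y - V x <= - a3 (enorm (point_of x)) + sg (enorm w)].
Proof.
move=> [_ rob [[V [a1 [a2 [a3 [sg [[K1 K2 K3 Ks] [cV bV H]]]]]]]|]].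
  exists V, a1, a2, a3, sg; split => //; split => //.
    by move=> e e0; exact: class_K_small.
  by exists (sg K) => s s0 sK; exact: class_K_le.
move=> [[V [a1 [a2 [a3 [[K1 K2 K3] [[L VL] bV H]]]]]] lip].
have [L' HL'] : exists L', forall (x : state X0) (w : 'cV[R]_nw), W w ->
    enorm (dynamics g D x w - dynamics g D x 0) <= L' * enorm w.
  case: lip => [[L' HL']|[e He]].
    exists L' => x w Ww; apply: le_trans (HL' x x w 0 Ww W0) _.
    by rewrite subrr subr0 enorm_col0.
  exists 1 => x w Ww; rewrite !He// opprD addrACA subrr add0r mul1r.
  have -> : castmx (e, erefl 1%N) 0 = 0 :> 'cV[R]_nx.
    by apply/matrixP => i j; rewrite castmxE !mxE.
  by rewrite subr0 enorm_castmx.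
pose c := `|L| * `|L'|.
have c0 : 0 <= c by rewrite mulr_ge0.
exists V, a1, a2, a3, (fun s => c * s); split.
  by split => //; exact: lipschitz_state_continuous VL.
split.
- move=> e e0; have c1 : 0 < c + 1 by rewrite ltr_wpDl.
  exists (e / (c + 1)); first by rewrite divr_gt0.
  move=> s s0; rewrite ler_pdivlMr// => h.
  by apply: le_trans h; rewrite mulrC ler_wpM2l// lerDl.
- by exists (c * K) => s _ sK; rewrite ler_wpM2l.
move=> x y w Ww yE.
pose z : state X0 := insubd (x : set_type X) (dynamics g D x 0).
have zE : point_of z = dynamics g D x 0.
  rewrite /z /point_of /= insubdK//; apply: mem_set; apply: rob => //.
  exact: point_of_in.
have h1 := H x z zE; have h2 := VL y z; have h3 := HL' x w Ww.
rewrite yE zE in h2.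
have h4 : V y - V z <= c * enorm w.
  apply: le_trans (ler_norm _) _; apply: le_trans h2 _.
  apply: (@le_trans _ _ (`|L| * enorm (dynamics g D x w - dynamics g D x 0))).
    by rewrite ler_wpM2r ?enorm_ge0// ler_norm.
  rewrite /c -mulrA ler_wpM2l//; apply: le_trans h3 _.
  by rewrite ler_wpM2r ?enorm_ge0// ler_norm.
by lra.
Qed.

Variables (V : state X0 -> R) (a1 a2 a3 sg : R -> R).
Hypotheses (bV : lyapunov_bounds V a1 a2).
Hypotheses (K1 : class_Koo a1) (K2 : class_Koo a2) (K3 : class_Koo a3).
Hypothesis sg_small : forall e, 0 < e -> exists2 dl, 0 < dl &
  forall s, 0 <= s -> s <= dl -> sg s <= e.
Hypothesis sg_bounded : exists sb, forall s, 0 <= s -> s <= K -> sg s <= sb.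
Hypothesis dissipation : forall (x y : state X0) (w : 'cV[R]_nw), W w ->
  point_of y = dynamics g D x w ->
  V y - V x <= - a3 (enorm (point_of x)) + sg (enorm w).

(** Where the decrease a3 does not dominate the largest gain by 1, the state is
    bounded, and so is the next value of V. *)
Lemma absorbing_level : exists M : R, forall (x y : state X0) (w : 'cV[R]_nw),
  W w -> point_of y = dynamics g D x w -> V y <= Num.max M (V x - 1).
Proof.
have [sb Hsb] := sg_bounded.
have [rho rho0 Hrho] := class_Koo_large (sb + 1) K3.
have [[K2' _] [K3' _]] := (K2, K3).
exists (a2 rho + sb) => x y w Ww yE.
have h := dissipation Ww yE; have sgw := Hsb _ (enorm_ge0 w) (W_le Ww).
have [_ _ Vx] := bV x; rewrite le_max; apply/orP.
have [xr|rx] := lerP rho (enorm (point_of x)).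
  by right; have := class_K_le K3' rho0 xr; lra.
left; have := class_K_le K2' (enorm_ge0 _) (ltW rx).
by have := class_K_ge0 K3' (enorm_ge0 (point_of x)); lra.
Qed.

(** The level b is chosen below all values of V outside the ball of radius r. Near
    the origin, where V is at most b / 2, noise with gain at most b / 2 cannot
    raise V above b; elsewhere the decrease a3 is bounded below, and noise with
    gain at most half of it leaves a decrease. *)
Lemma small_noise_contraction (r : R) : 0 < r -> exists (lam b c : R),
  [/\ 0 < lam, 0 < c,
      forall (x y : state X0) (w : 'cV[R]_nw), W w -> enorm w <= lam ->
        point_of y = dynamics g D x w -> V y <= Num.max b (V x - c) &
      forall x, V x <= b -> enorm (point_of x) < r].
Proof.
move=> r0; have [[K1' _] [K2' _] [K3' _]] := And3 K1 K2 K3.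
pose b := a1 r / 2.
have b0 : 0 < b by rewrite divr_gt0//; exact: class_K_gt0.
have b2 : 0 < b / 2 by rewrite divr_gt0.
have [ka ka0 Hka] := class_K_small K2' b2.
have a3k : 0 < a3 ka by exact: class_K_gt0.
pose e := Num.min (b / 2) (a3 ka / 2).
have e0 : 0 < e by rewrite lt_min b2 divr_gt0.
have [lam lam0 Hlam] := sg_small e0.
exists lam, b, (a3 ka / 2); split => //; first by rewrite divr_gt0.
  move=> x y w Ww wl yE; have h := dissipation Ww yE.
  have := Hlam _ (enorm_ge0 w) wl; rewrite le_min => /andP[h1 h2].
  have [_ _ Vx] := bV x; rewrite le_max; apply/orP.
  have [kx|xk] := lerP ka (enorm (point_of x)).
    by right; have := class_K_le K3' (ltW ka0) kx; lra.
  left; have := Hka _ (enorm_ge0 _) (ltW xk).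
  by have := class_K_ge0 K3' (enorm_ge0 (point_of x)); lra.
move=> x Vb; rewrite ltNge; apply/negP => rx; have [_ Vx _] := bV x.
have := class_K_le K1' (ltW r0) rx; move: b0 Vb; rewrite /b; lra.
Qed.

End lyapunov_functions.

(** * The disturbed system *)

Section noise_in_W.
Context (R : realType) (nw : nat) (W : set 'cV[R]_nw) (W0 : W 0).
Context (d : measure_display) (Omega : measurableType d) (P : probability Omega R).
Variable w : nat -> {RV P >-> borel 'cV[R]_nw}.
Hypothesis wW : forall k t, W (w k t).
Local Notation T := (borel (state W0)).

(** The noise as a random element of the subspace W. The step of the chain is only
    defined for noise in W, which need not be a Borel set, so that measurability
    of the step can only be asked for on W itself. *)
Definition lift_noise k (t : Omega) : T :=
  insubd (origin W0 : set_type W) (w k t : 'cV[R]_nw).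

Lemma point_of_lift_noise k t : point_of (lift_noise k t : state W0) = w k t.
Proof. by rewrite /point_of /lift_noise /= insubdK//; exact: mem_set. Qed.

Lemma measurable_lift_noise k : measurable_fun setT (lift_noise k).
Proof.
apply: measurable_into_state; under eq_fun do rewrite point_of_lift_noise.
exact: measurable_funP.
Qed.

Definition noise_rv k : {RV P >-> T} := mfun_Sub (mem_set (measurable_lift_noise k)).

Lemma noise_rv_preimage (B : set (borel 'cV[R]_nw)) k :
  noise_rv k @^-1` (point_of @^-1` B) = w k @^-1` B.
Proof. by apply/seteqP; split => t /=; rewrite point_of_lift_noise. Qed.

Lemma noise_rv_independent : independent_seq w -> independent_seq noise_rv.
Proof.
move=> indw s A mA.
have /choice[B HB] k : exists B : set (borel 'cV[R]_nw),
    measurable B /\ A k = point_of @^-1` B.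
  by have [B mB AB] := measurable_state_trace (mA k); exists B.
have AB k : noise_rv k @^-1` A k = w k @^-1` B k.
  by rewrite (HB k).2; exact: noise_rv_preimage.
rewrite (_ : \bigcap_(k in _) _ = \bigcap_(k in [set` s]) (w k @^-1` B k)); last first.
  by apply: eq_bigcapr => k _; exact: AB.
under eq_bigr do rewrite AB.
by apply: indw => k; exact: (HB k).1.
Qed.

Lemma noise_rv_identically_distributed :
  identically_distributed w -> identically_distributed noise_rv.
Proof.
move=> idw j k A mA; have [B mB AB] := measurable_state_trace mA.
have h i : distribution P (noise_rv i) A = distribution P (w i) B.
  by congr (P _); rewrite AB; exact: noise_rv_preimage.
by rewrite !h; exact: idw.
Qed.

End noise_in_W.

Section controlled_chain.
Context (R : realType) (nx nw : nat).
Variables (X : set 'cV[R]_nx) (X0 : X 0) (W : set 'cV[R]_nw) (W0 : W 0).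
Variables (g : state X0 -> state X0) (D : 'M[R]_(nx, nw)).
Context (d : measure_display) (Omega : measurableType d) (P : probability Omega R).
Variable w : nat -> {RV P >-> borel 'cV[R]_nw}.
Hypothesis wW : forall k t, W (w k t).
Hypothesis g_continuous : continuous g.
Hypothesis robX : robustly_invariant W g D X.
Local Notation E := (borel (state X0)).
Local Notation T := (borel (state W0)).

Definition step (y : E * T) : E :=
  insubd (y.1 : set_type X) (dynamics g D y.1 (point_of (y.2 : state W0))).

Lemma point_of_step y : point_of (step y : state X0) =
  dynamics g D (y.1 : state X0) (point_of (y.2 : state W0)).
Proof.
rewrite /step {1}/point_of /= insubdK//; apply: mem_set; apply: robX.
  exact: point_of_in.
exact: point_of_in.
Qed.

Lemma measurable_step : measurable_fun setT step.
Proof.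
apply: measurable_into_state; under eq_fun do rewrite point_of_step.
apply: measurable_into_col => i; rewrite /dynamics.
under eq_fun do rewrite mxE.
apply: measurable_funD.
  have m1 : measurable_fun [set: E * T] (fun y => point_of (g y.1) : borel 'cV[R]_nx).
    apply: (measurableT_comp (@measurable_point_of _ _ _ X0)).
    exact: (measurableT_comp (continuous_borel g_continuous) measurable_fst).
  exact: (measurableT_comp (measurable_coord_col i) m1).
apply: measurable_mulmx.
exact: (measurableT_comp (@measurable_point_of _ _ _ W0) measurable_snd).
Qed.

Let f := step.
Let mf : measurable_fun setT f := measurable_step.
Let w' := noise_rv W0 wW.
Let Q := noise_law w'.
Let L k (x : E) : probability E R := law Q mf k x.

Lemma trajectoryE x k t : trajectory g D w x k t = orbit step k (x, noise w' t).
Proof.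
elim: k => //= k IH; rewrite orbitS -IH /step /=; congr (insubd _ (dynamics _ _ _ _)).
by rewrite /noise /w' /= point_of_lift_noise.
Qed.

Lemma transitionE k x A : measurable (A : set E) ->
  transition g D w k x A = L k x A.
Proof.
move=> mA; rewrite /transition /law /= /pushforward /Q /noise_law /= /pushforward.
by congr (P _); apply/seteqP; split => t /=; rewrite trajectoryE.
Qed.

Hypotheses (indw : independent_seq w) (idw : identically_distributed w).
Let indw' := noise_rv_independent (W0 := W0) wW indw.
Let idw' := noise_rv_identically_distributed (W0 := W0) wW idw.
Let splitQ := noise_law_split indw' idw'.

Hypothesis near0_charged : forall lam : R, 0 < lam ->
  (0 < P [set t | (enorm (w 0%N t : 'cV[R]_nw) <= lam)%R])%E.

Lemma orbit_transition (x : E) v k :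
  point_of (orbit f k.+1 (x, v) : state X0) =
  dynamics g D (orbit f k (x, v)) (point_of (v k : state W0)).
Proof. by rewrite orbitS point_of_step. Qed.

Section small_noise.
Variables (V : state X0 -> R) (lam b c : R).
Hypotheses (lam_gt0 : 0 < lam) (c_gt0 : 0 < c).
Hypothesis V_decrease : forall (x y : state X0) (v : 'cV[R]_nw), W v ->
  enorm v <= lam -> point_of y = dynamics g D x v -> V y <= Num.max b (V x - c).

(** With noise of norm at most lam during N steps, V falls to at most b from any
    state with V at most M. By independence this has probability s ^ N, where s is
    the probability that one noise term is that small. *)
Lemma sublevel_charged (M : R) : exists (N : nat) (e : R), [/\ (0 < N)%N, 0 < e, e <= 1 &
  forall (x : E) (B : set E), measurable B -> V x <= M ->
    (forall y : state X0, V y <= b -> B y) -> (e%:E <= L N x B)%E].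
Proof.
pose N := (Num.truncn ((M - b) / c)).+1.
pose S := [set a : T | enorm (point_of (a : state W0)) <= lam].
have mS : measurable S.
  have := measurable_fun_ler (measurableT_comp (@measurable_enorm R nw)
    (@measurable_point_of _ _ _ W0)) (measurable_cst (lam : R)).
  by move=> /(_ measurableT [set true] I); rewrite setTI.
have Sgt0 : (0 < coord_law w' S)%E.
  rewrite (_ : coord_law w' S = P [set t | (enorm (w 0%N t : 'cV[R]_nw) <= lam)%R]).
    exact: near0_charged.
  by congr (P _); apply/seteqP; split => t; rewrite /S /= point_of_lift_noise.
pose s := fine (coord_law w' S).
have sE : coord_law w' S = s%:E by rewrite fineK// fin_num_measure.
have s0 : 0 < s by rewrite -lte_fin -sE.
have s1 : s <= 1 by rewrite -lee_fin -sE probability_le1.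
exists N, (s ^+ N); split; [by []|exact: exprn_gt0|by rewrite exprn_ile1// ltW|].
move=> x B mB xM bB.
have -> : ((s ^+ N)%:E = \prod_(k < N) coord_law w' S)%E.
  by under eq_bigr do rewrite sE; rewrite prodEFin prodr_const card_ord.
rewrite -(noise_law_cylinder indw' idw' _ (fun=> mS)).
apply: le_measure; rewrite ?inE.
- exact: (measurable_cylinder _ (fun=> mS)).
- rewrite -[X in measurable X]setTI.
  exact: (measurable_orbit_from mf N x).
move=> v Sv; apply: bB.
have h : V (orbit f N (x, v)) <= Num.max b (V (orbit f 0 (x, v)) - N%:R * c).
  apply: (@max_decrease _ (fun k => V (orbit f k (x, v)))) => [|k kN]; first exact: ltW.
  apply: (V_decrease _ (Sv k kN) (orbit_transition x v k)).
  exact: point_of_in.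
apply: le_trans h _; rewrite ge_max lexx /= lerBlDr.
have : (M - b) / c < N%:R by exact: truncnS_gt.
rewrite ltr_pdivrMr// => h; have : V (orbit f 0 (x, v)) <= M by [].
lra.
Qed.

End small_noise.

Section absorbing.
Variables (V : state X0 -> R) (M : R).
Hypothesis V_absorbed : forall (x y : state X0) (v : 'cV[R]_nw), W v ->
  point_of y = dynamics g D x v -> V y <= Num.max M (V x - 1).

Lemma orbit_below (x : E) v k : V (orbit f k (x, v)) <= Num.max M (V x - k%:R).
Proof.
rewrite -[k%:R]mulr1.
apply: (@max_decrease _ (fun k => V (orbit f k (x, v)))) => // j _.
by apply: (V_absorbed _ (orbit_transition x v j)); exact: point_of_in.
Qed.

Lemma law_above (x : E) k : V x - k%:R <= M -> L k x (~` [set y : E | V y <= M]) = 0%E.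
Proof.
move=> xk; rewrite -[RHS](measure0 Q); congr (Q _).
apply/seteqP; split => v //=; apply.
by apply: le_trans (orbit_below x v k) _; rewrite ge_max lexx.
Qed.

End absorbing.

Section local_overlap.
Variables (Xf : set 'cV[R]_nx) (A : 'M[R]_nx).
Hypothesis robXf : robustly_invariant W g D Xf.
Hypothesis ctrAD : controllable A D.
Hypothesis linXf : forall (x : state X0) (v : 'cV[R]_nw), Xf (point_of x) ->
  W v -> dynamics g D x v = A *m point_of x + D *m v.

Lemma orbit_linear (x : E) v k : Xf (point_of (x : state X0)) ->
  Xf (point_of (orbit f k (x, v) : state X0)) /\
  point_of (orbit f k (x, v) : state X0) =
    linear_orbit A D k (point_of (x : state X0)) (fun j => point_of (v j : state W0)).
Proof.
move=> Xfx; elim: k => [|k [Xfk IH]]; first by split.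
rewrite orbit_transition; split; first by apply: robXf => //; exact: point_of_in.
by rewrite linXf//= ?IH//; exact: point_of_in.
Qed.

(** In Xf the state after nx steps is a linear function of the noise, and changing
    the initial state within the small box amounts to adding small controls to
    the noise, a translation under which its law keeps a fixed overlap. *)
Lemma local_overlap : ~ mutually_singular (distribution P (w 0%N)) (@lebesgueN R nw) ->
  exists rho q : R, [/\ 0 < rho, 0 <= q, q < 1 &
    forall (x y : E) B, measurable B ->
      Xf (point_of (x : state X0)) -> Xf (point_of (y : state X0)) ->
      (forall i, `|point_of (x : state X0) i ord0| <= rho) ->
      (forall i, `|point_of (y : state X0) i ord0| <= rho) ->
      (L nx x B <= L nx y B + q%:E)%E].
Proof.
move=> /translation_overlap[dl [eta [dl0 eta0 eta1 ovl]]].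
have [rho rho0 ctl] := small_controls ctrAD dl0.
exists rho, (1 - eta ^+ nx); split => //.
- by rewrite subr_ge0 exprn_ile1// ltW.
- by rewrite ltrBlDr ltrDl exprn_gt0.
move=> x y B mB Xfx Xfy xr yr.
have [B' mB' BB'] := measurable_state_trace mB.
have LE (z : E) : Xf (point_of (z : state X0)) -> L nx z B =
    noise_law w [set v | B' (linear_orbit A D nx (point_of (z : state X0)) v)].
  move=> Xfz; rewrite /L /law /Q /noise_law /= /distribution /= /pushforward /=.
  congr (P _); apply/seteqP; split => t; rewrite /= BB' /= (orbit_linear _ _ Xfz).2;
  have -> : (fun j => point_of (noise w' t j : state W0)) = noise w t by
    apply/funext => j; exact: point_of_lift_noise.
  by [].
  by [].
have [u [ul u0 uE]] := ctl _ _ xr yr.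
rewrite !LE//.
apply: le_trans (translate_overlap (noise_law_split indw idw) eta0 eta1 ovl ul u0 _) _.
  rewrite -[X in measurable X]setTI; exact: (measurable_linear_orbit A D nx).
rewrite (_ : [set v | B' (linear_orbit A D nx (point_of (y : state X0)) v)] =
  [set v | B' (linear_orbit A D nx (point_of (x : state X0)) (translate_seq u v))])//.
by apply/seteqP; split => v /=; rewrite uE.
Qed.

End local_overlap.

Hypotheses (bW : bounded_set W) (linear0 : linear_near_origin W g D).
Hypothesis nonsing : ~ mutually_singular (distribution P (w 0%N)) (@lebesgueN R nw).
Hypothesis lyapunov : has_ISS_lyapunov W g D.

(** From any two states of the absorbing set, N steps of small noise lead both
    chains close to the origin with probability at least e, where the next nx
    steps have overlapping laws. *)
Lemma absorbing_set_overlap : exists (C : set E) (T0 : nat) (q : R),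
  [/\ measurable C, C (origin X0), (0 < T0)%N, 0 <= q & q < 1] /\
  [/\ forall k x, C x -> L k x (~` C) = 0%E,
      forall x, exists k, L k x (~` C) = 0%E &
      forall x y B, C x -> C y -> measurable B -> (L T0 x B <= L T0 y B + q%:E)%E].
Proof.
have [Xf [A [[_ _ intXf robXf] [_ ctrAD linXf]]]] := linear0.
have [K K0 W_le] := bounded_enorm bW.
have [V [a1 [a2 [a3 [sg [[cV bV K1 K2 K3] [sg_small sg_bounded dissip]]]]]]] :=
  dissipation_inequality W0 K lyapunov.
have mV (m : R) : measurable [set y : E | V y <= m].
  have := measurable_fun_ler (continuous_borel_real cV) (measurable_cst (m : R)).
  by move=> /(_ measurableT [set true] I); rewrite setTI.
have [M0 HM0] := absorbing_level W_le bV K2 K3 sg_bounded dissip.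
(* The level is raised so that the absorbing set contains the origin. *)
pose M := Num.max M0 (V (origin X0)).
have HM (x y : state X0) (v : 'cV[R]_nw) : W v -> point_of y = dynamics g D x v ->
    V y <= Num.max M (V x - 1).
  move=> Wv yE; apply: le_trans (HM0 x y v Wv yE) _.
  by rewrite ge_max /M; apply/andP; split; rewrite !le_max lexx ?orbT.
have [rho [q [rho0 q0 q1 ovl]]] :=
  local_overlap robXf ctrAD linXf nonsing.
have [r1 r10 Hr1] : exists2 r1 : R, 0 < r1 & forall v : 'cV[R]_nx, enorm v < r1 -> Xf v.
  move: intXf; rewrite /interior -nbhs_ballE => -[r1 /= r10 H].
  exists r1 => // v vr; apply: H; apply/ball_colP => // i.
  by rewrite mxE sub0r normrN; apply: le_lt_trans (coord_le_enorm v i) vr.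
have r0 : 0 < Num.min r1 rho by rewrite lt_min r10.
have [lam [b [c [lam0 c0 Vdec Vb]]]] :=
  small_noise_contraction bV K1 K2 K3 sg_small dissip r0.
have [N [e [N0 e0 e1 He]]] := sublevel_charged lam0 c0 Vdec M.
pose C : set E := [set y | V y <= M]; pose B0 : set E := [set y | V y <= b].
have absC k x : C x -> L k x (~` C) = 0%E.
  move=> Cx; apply: (law_above HM).
  by apply: le_trans Cx; rewrite gerBl.
have Lstep j k x B : measurable B -> L (j + k) x B = (\int[L j x]_y L k y B)%E.
  by move=> mB; apply: (law_compA mf splitQ).
have HB0 x : C x -> (e%:E <= L N x B0)%E by move=> Cx; exact: (He x B0 (mV b) Cx (fun y h => h)).
have near (x : E) : B0 x -> Xf (point_of (x : state X0)) /\
    forall i, `|point_of (x : state X0) i ord0| <= rho.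
  move=> /Vb; rewrite lt_min => /andP[xr xrho]; split; first exact: Hr1.
  by move=> i; apply: le_trans (coord_le_enorm _ i) (ltW xrho).
exists C, (N + nx)%N, (1 - e * (1 - q)); split.
  split.
  - exact: mV.
  - by have : V (origin X0) <= M by rewrite /M le_max lexx orbT.
  - by rewrite addn_gt0 N0.
  - by rewrite subr_ge0 mulr_ile1 ?(ltW e0) ?subr_ge0 ?(ltW q1)// gerBl.
  - by rewrite ltrBlDr ltrDl mulr_gt0// subr_gt0.
split => //.
  move=> x; exists (Num.truncn (V x - M)).+1.
  apply: (law_above HM).
  by rewrite lerBlDr -lerBlDl ltW// truncnS_gt.
move=> x y B Cx Cy mB; rewrite !Lstep//.
apply: (overlap_bridge (mV b) (measurable_law Q mf nx mB) _ e0 _ (HB0 x Cx) (HB0 y Cy)).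
  by move=> z; rewrite measure_ge0 probability_le1.
move=> y1 z1 /near[y1f y1r] /near[z1f z1r].
exact: ovl.
Qed.

Theorem chain_ergodic : exists pi : probability E R,
  [/\ stationary Q mf pi,
      (forall x, exists k0 (r : nat -> R), [/\ forall k, (0 <= r k)%R, (r @ \oo --> 0)%R &
        forall k A, measurable A -> `|L (k0 + k) x A - pi A| <= (r k)%:E]%E) &
      forall (h : E -> R) x, pi.-integrable setT (EFin \o h) ->
        Q [set v | diverging f h (\int[pi]_y h y) (skew f (x, v))] = 0%E].
Proof.
have [C [T0 [q [[mC Cx0 T00 q0 q1] [absC reachC ovl]]]]] := absorbing_set_overlap.
have [pi [pi_stat piC pi_le pi_tv]] :=
  uniform_ergodicity (measurable_law Q mf) (law_compA mf splitQ) mC Cx0 absC T00 q0 q1 ovl reachC.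
exists pi; split => //.
  move=> x; have [k0 tv] := pi_tv x; exists k0, (rate T0 q); split => //.
    exact: rate_ge0.
  exact: cvg_rate.
move=> h x ih.
apply: (markov_law_of_large_numbers splitQ pi_stat mC piC (r := rate T0 q)) => //.
- exact: rate_ge0.
- exact: cvg_rate.
move=> y e e0; have [k0 tv] := pi_tv y.
have [k _ /(_ k (leqnn k)) rk] : \forall k \near \oo, `|rate T0 q k| <= e.
  by move/cvgr0Pnorm_le : (cvg_rate T00 q0 q1); exact.
exists (k0 + k)%N => A mA.
have := tv k A mA.
have aE : L (k0 + k) y A = (fine (L (k0 + k) y A))%:E by rewrite fineK ?fin_num_measure.
have pE : pi A = (fine (pi A))%:E by rewrite fineK ?fin_num_measure.
rewrite -/(L _ _) aE pE -EFinB abse_EFin -EFinD !lee_fin => close.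
have := le_trans (le_trans (ler_norm _) close) (le_trans (ler_norm _) rk).
by rewrite lerBlDl.
Qed.

End controlled_chain.

Theorem theorem4 (R : realType) (nx nw : nat)
    (X : set 'cV[R]_nx) (X0 : X 0) (W : set 'cV[R]_nw)
    (g : state X0 -> state X0) (D : 'M[R]_(nx, nw))
    (d : measure_display) (Omega : measurableType d) (P : probability Omega R)
    (w : nat -> {RV P >-> borel 'cV[R]_nw}) :
  continuous g -> g (origin X0) = origin X0 ->
  admissible_disturbance W w ->
  linear_near_origin W g D ->
  has_ISS_lyapunov W g D ->
  exists pi : probability (borel (state X0)) R,
    [/\ invariant_measure g D w pi,
        forall x : state X0,
          ereal_sup [set `|transition g D w k x A - pi A|%E |
                      A in (measurable : set (set (borel (state X0))))]
            @[k --> \oo] --> 0%E &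
        forall (x0 : state X0) (h : borel (state X0) -> R),
          pi.-integrable setT (EFin \o h) ->
          {ae P, forall t,
            k%:R^-1 * (\sum_(1 <= j < k.+1) h (trajectory g D w x0 j t))
              @[k --> \oo] --> \int[pi]_x h x}].
Proof.
move=> cg _ [[bW W0i wW] [indw idw _ nonsing charged]] linear0 lya.
have W0 : W 0 := interior_subset W0i.
have [_ robX _] := lya.
have [pi [pi_stat tv lln]] :=
  chain_ergodic W0 wW cg robX indw idw (charged 0%N) bW linear0 (nonsing 0%N) lya.
have trE := transitionE W0 wW cg robX.
exists pi; split.
- move=> A mA; rewrite (pi_stat A mA); apply: eq_integral => x _.
  by rewrite trE.
- move=> x; have [k0 [r [r0 rcvg bound]]] := tv x.
  rewrite -(cvg_shiftn k0).
  have r_cvg0 : (r k)%:E @[k --> \oo] --> (0%E : \bar R).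
    by apply/fine_cvgP; split => //; exact: nearW.
  apply: (squeeze_cvge _ (cvg_cst (0%E : \bar R)) r_cvg0).
  apply: nearW => k; apply/andP; split.
      apply: (@le_trans _ _ `|transition g D w (k + k0) x set0 - pi set0|%E) => //.
      by apply: ereal_sup_ubound; exists set0 => //; exact: measurable0.
    apply: ge_ereal_sup => _ /= [A mA <-]; rewrite trE// addnC; exact: bound.
move=> x0 h ih; have ae0 := lln h x0 ih.
have mh : measurable_fun setT h by apply/measurable_EFinP; exact: measurable_int ih.
set B := [set v | _] in ae0.
have mf := measurable_step (W0 := W0) cg robX.
have mB : measurable B.
  have md := measurable_diverging mf (\int[pi]_x h x) mh.
  have ms := measurableT_comp (measurable_skew mf) (pair1_measurable (x0 : borel (state X0))).
  by rewrite -[B]setTI; exact: (ms measurableT _ md).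
exists (noise (noise_rv W0 wW) @^-1` B); split.
- by rewrite -[X in measurable X]setTI; exact: measurable_noise.
- exact: ae0.
move=> t /= ndiv cv; apply: ndiv.
rewrite (_ : (fun k : nat => _) = fun k : nat => k%:R^-1 *
  birkhoff_sum (skew (step g D)) (h \o fst) k
    (skew (step g D) (x0, noise (noise_rv W0 wW) t)))//.
apply/funext => n; congr (_ * _).
rewrite big_add1 /=; apply: eq_bigr => j _.
congr (h _); apply: etrans (trajectoryE W0 g D wW x0 j.+1 t) _.
by rewrite -orbit_skew.
Qed.
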